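(* There are bijections between the set $\mathcal T_\infty$ of graph limits of threshold graphs and each of the following sets. (i) The set $\mathcal P_{\mathsf s}$ of probability distributions on $[0,1]$ symmetric with respect to $\dagger$. (ii) The set $\mathcal C_{\mathcal T}$ of symmetric increasing closed sets $S\subseteq[0,1]^2$ that contain the upper and right edges $[0,1]\times\{1\}\cup\{1\}\times[0,1]$. (iii) The set $\mathcal O_{\mathcal T}$ of symmetric increasing open sets $S\subseteq(0,1)^2$. (iv) The set $\mathcal W_{\mathcal T}$ of symmetric increasing $0$–$1$ valued functions $W:[0,1]^2\to\{0,1\}$ modulo a.e. equality. More precisely, there are commuting bijections between these sets given by the following mappings and their compositions: $$\begin{aligned} \iota_{\mathcal T\mathcal P}&:\mathcal T_\infty\to\mathcal P_{\mathsf s}, & \iota_{\mathcal T\mathcal P}(\Gamma)&:=\nu(\Gamma);\\ \iota_{\mathcal P\mathcal C}&:\mathcal P_{\mathsf s}\to\mathcal C_{\mathcal T}, & \iota_{\mathcal P\mathcal C}(\mu)&:=S_\mu;\\ \iota_{\mathcal C\mathcal O}&:\mathcal C_{\mathcal T}\to\mathcal O_{\mathcal T}, & \iota_{\mathcal C\mathcal O}(S)&:=S^\circ;\\ \iota_{\mathcal C\mathcal W}&:\mathcal C_{\mathcal T}\to\mathcal W_{\mathcal T}, & \iota_{\mathcal C\mathcal W}(S)&:=\mathbf 1_S;\\ \iota_{\mathcal O\mathcal W}&:\mathcal O_{\mathcal T}\to\mathcal W_{\mathcal T}, & \iota_{\mathcal O\mathcal W}(S)&:=\mathbf 1_S;\\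 \iota_{\mathcal W\mathcal T}&:\mathcal W_{\mathcal T}\to\mathcal T_\infty, & \iota_{\mathcal W\mathcal T}(W)&:=\Gamma_W. \end{aligned}$$ (That is, the diagram formed by the cycle $\mathcal T_\infty\to\mathcal P_{\mathsf s}\to\mathcal C_{\mathcal T}\to\mathcal O_{\mathcal T}\to\mathcal W_{\mathcal T}\to\mathcal T_\infty$ together with $\iota_{\mathcal C\mathcal W}$ commutes.) In particular, a probability distribution $\mu\in\mathcal P_{\mathsf s}$ corresponds to $\Gamma_\mu\in\mathcal T_\infty$ and to $S_\mu\in\mathcal C_{\mathcal T}$, $S_\mu^\circ\in\mathcal O_{\mathcal T}$, and $W_\mu\in\mathcal W_{\mathcal T}$. Conversely, $\Gamma\in\mathcal T_\infty$ corresponds to $\nu(\Gamma)\in\mathcal P_{\mathsf s}$. Thus the mappings $\Gamma\mapsto\nu(\Gamma)$ and $\mu\mapsto\Gamma_\mu$ are the inverses of each other. Moreover, these bijections are homeomorphisms, with any of the following topologies or metrics: the standard (weak) topology on $\mathcal P_{\mathsf s}\subset\mathcal P$; the Hausdorff metric, or the Fell topology, or the measure distance on $\mathcal C_{\mathcal T}$; the measure distance on $\mathcal O_{\mathcal T}$; the $L^1$-distance or the cut-distance $\delta_\square$ on the set $\mathcal W_{\mathcal T}$ (and on $\mathcal T_\infty$ the subspace topology from the space of graph limits). These homeomorphic topological spaces are compact metric spaces.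
   Context: Graphs are finite, simple, with at least one vertex; $v(G)=|V(G)|$. A graph is a threshold graph if there are real weights $w_i$ on the vertices and $t\in\mathbb R$ such that distinct $i,j$ are adjacent iff $w_i+w_j>t$. For graphs $F,G$, $t(F,G)$ is the probability that a uniformly random map $V(F)\to V(G)$ is a graph homomorphism. Let $\mathcal U$ be the countable set of unlabeled graphs and $\overline{\mathcal U}$ the compact metric space obtained as the closure of the image of $\mathcal U$ under the embedding $G\mapsto\big((t(F,G))_{F\in\mathcal U},1/v(G)\big)$ into $[0,1]^{\mathcal U}\times[0,1]$. Elements of $\mathcal U_\infty:=\overline{\mathcal U}\setminus\mathcal U$ are called graph limits. The functionals $t(F,\cdot)$ extend continuously to $\overline{\mathcal U}$; $G_n\to\Gamma\in\mathcal U_\infty$ iff $v(G_n)\to\infty$ and $t(F,G_n)\to t(F,\Gamma)$ for every graph $F$, and $\Gamma\in\mathcal U_\infty$ is determined by the values $t(F,\Gamma)$. $\mathcal T_\infty\subset\mathcal U_\infty$ is the set of graph limits that are limits of sequences of threshold graphs. For a symmetric measurable $W:[0,1]^2\to[0,1]$, $\Gamma_W\in\mathcal U_\infty$ is the graph limit with $t(F,\Gamma_W)=\int_{[0,1]^{v(F)}}\prod_{ij\in E(F)}W(x_i,x_j)\,dx_1\cdots dx_{v(F)}$ for every graph $F$. $\mathcal P$ is the set of (Borel) probability measures on $[0,1]$ with the topology of weak convergence. For $\Gamma\in\mathcal U_\infty$, $\nu(\Gamma)\in\mathcal P$ is the degree distribution: the unique element of $\mathcal P$ with $\int_0^1 s^k\,d\nu(\Gamma)(s)=t(K_{1,k},\Gamma)$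 for all $k\ge1$, where $K_{1,k}$ is the star with $k$ edges. ''Increasing'' is in the weak sense: $W:[0,1]^2\to\mathbb R$ is increasing if $W(x,y)\le W(x',y')$ whenever $x\le x'$, $y\le y'$; a set $S$ is increasing if its indicator $\mathbf 1_S$ is increasing, i.e. $(x,y)\in S$, $x\le x'$, $y\le y'$ imply $(x',y')\in S$ (for points of $[0,1]^2$, resp. of $(0,1)^2$ for subsets of $(0,1)^2$; the indicator of a subset of $(0,1)^2$ is then regarded as a function on $[0,1]^2$ modulo a.e. equality). A set $S$ is symmetric if $S=S^\dagger:=\{(x,y):(y,x)\in S\}$; a function is symmetric if $W(x,y)=W(y,x)$. $S^\circ$ is the interior of $S$ in $\mathbb R^2$. For $\mu\in\mathcal P$ put $F_\mu(x)=\mu([0,x])$, $F_\mu(x-)=\mu([0,x))$, $$S_\mu:=\{(x,y)\in[0,1]^2: x\ge F_\mu((1-y)-)\},\qquad W_\mu:=\mathbf 1_{S_\mu}.$$ For $\mu\in\mathcal P$ there is a unique $\mu^\dagger\in\mathcal P$ with $S_{\mu^\dagger}=(S_\mu)^\dagger$ (its distribution function is the reflection of that of $\mu$ in the diagonal between $(0,1)$ and $(1,0)$, adjusted at jumps). ''Symmetric with respect to $\dagger$'' means $\mu^\dagger=\mu$, so $\mathcal P_{\mathsf s}:=\{\mu\in\mathcal P:\mu^\dagger=\mu\}=\{\mu\in\mathcal P:S_\mu=S_\mu^\dagger\}$. For $\mu\in\mathcal P_{\mathsf s}$, $\Gamma_\mu:=\Gamma_{W_\mu}$. The Hausdorff metric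 is the usual one on non-empty compact subsets of $[0,1]^2$; the Fell topology is the usual one on closed subsets. The measure distance of $S_1,S_2$ is $\lambda_2(S_1\triangle S_2)$ with $\lambda_2$ Lebesgue measure. The $L^1$-distance is $\int_{[0,1]^2}|W_1-W_2|$. The cut-distance is $\delta_\square(W_1,W_2)=\inf_{\varphi}\sup_{A,B}\big|\int_{A\times B}\big(W_1(x,y)-W_2(\varphi(x),\varphi(y))\big)\,dx\,dy\big|$, where $\varphi$ ranges over measure-preserving bijections of $[0,1]$ and $A,B$ over measurable subsets of $[0,1]$. *)

(* Defs.v *)
From HB Require Import structures.
From mathcomp Require Import all_boot all_order all_algebra generic_quotient.
From mathcomp Require Import all_classical all_reals all_analysis.

Set Implicit Arguments.
Unset Strict Implicit.
Unset Printing Implicit Defensive.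

Import Order.TTheory GRing.Theory Num.Theory.
Import numFieldNormedType.Exports.

Local Open Scope classical_set_scope.
Local Open Scope ring_scope.
Local Open Scope quotient_scope.

Record graph := Graph {
  nvert : nat;
  adj : rel 'I_nvert;
  nvert_gt0 : (0 < nvert)%N;
  adj_sym : symmetric adj;
  adj_irr : irreflexive adj }.

HB.instance Definition _ := gen_eqMixin graph.
HB.instance Definition _ := gen_choiceMixin graph.

Definition graph_iso (G H : graph) : bool :=
  `[< exists f : 'I_(nvert G) -> 'I_(nvert H),
        bijective f /\ forall i j, adj (f i) (f j) = adj i j >].

Lemma graph_iso_refl : reflexive graph_iso.
Proof. by move=> G; apply/asboolP; exists id; split=> //; exists id. Qed.

Lemma graph_iso_sym : symmetric graph_iso.
Proof.
have imp G H : graph_iso G H -> graph_iso H G.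
  move=> /asboolP[f [[g fK gK] fE]]; apply/asboolP; exists g.
  by split=> [|i j]; [exists f | rewrite -fE !gK].
by move=> G H; apply/idP/idP; exact: imp.
Qed.

Lemma graph_iso_trans : transitive graph_iso.
Proof.
move=> G H K /asboolP[f [bf fE]] /asboolP[g [bg gE]]; apply/asboolP.
by exists (g \o f); split=> [|i j]; [exact: bij_comp | rewrite /= gE fE].
Qed.

Canonical graph_iso_equiv :=
  EquivRel graph_iso graph_iso_refl graph_iso_sym graph_iso_trans.

(** The countable set of unlabeled graphs: isomorphism classes, on which
    isomorphism-invariant notions are evaluated at the representative [repr]. *)
Definition ugraph : Type := {eq_quot graph_iso}.
HB.instance Definition _ := Choice.on ugraph.
HB.instance Definition _ := EqQuotient.on ugraph.

Definition star_adj (k : nat) : rel 'I_k.+1 :=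
  fun i j => (i == ord0) (+) (j == ord0).

Lemma star_adj_sym k : symmetric (@star_adj k).
Proof. by move=> i j; rewrite /star_adj addbC. Qed.

Lemma star_adj_irr k : irreflexive (@star_adj k).
Proof. by move=> i; rewrite /star_adj addbb. Qed.

Definition star (k : nat) : graph :=
  @Graph k.+1 (@star_adj k) isT (@star_adj_sym k) (@star_adj_irr k).

Section GraphLimits.
Context (R : realType).

Definition is_threshold (G : graph) : Prop :=
  exists (w : 'I_(nvert G) -> R) (t : R),
    forall i j, i != j -> (adj i j <-> w i + w j > t).

Definition hom_density (F G : graph) : R :=
  #|[pred f : {ffun 'I_(nvert F) -> 'I_(nvert G)} |
      [forall i, forall j, adj i j ==> adj (f i) (f j)]]|%:R
  / (nvert G ^ nvert F)%N%:R.

Definition graph_space : topologicalType := ({ptws ugraph -> R} * R)%type.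

Definition graph_embedding (G : ugraph) : graph_space :=
  ((fun F : ugraph => hom_density (repr F) (repr G)), (nvert (repr G))%:R^-1).

Definition graph_limits : set graph_space :=
  closure (range graph_embedding) `\` range graph_embedding.

Definition limit_density (F : graph) (Gamma : graph_space) : R :=
  Gamma.1 (\pi_ugraph F).

Definition threshold_limits : set graph_space :=
  [set Gamma | graph_limits Gamma /\
     exists G : nat -> ugraph, (forall n, is_threshold (repr (G n))) /\
       (fun n => graph_embedding (G n)) @ \oo --> Gamma].

End GraphLimits.

Arguments graph_limits R : clear implicits.
Arguments threshold_limits R : clear implicits.

Section Square.
Context (R : realType).
Implicit Types (S : set (R * R)) (W : R * R -> R).

Definition I01 : set R := `[0, 1].

Definition square : set (R * R) := I01 `*` I01.

Definition open_square : set (R * R) := `]0, 1[ `*` `]0, 1[.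

Definition edges : set (R * R) := I01 `*` [set 1] `|` [set 1] `*` I01.

Definition dagger S : set (R * R) := [set p | S (p.2, p.1)].

(** Equivalently, the indicator of [S] is increasing on [D]. *)
Definition increasing_set (D S : set (R * R)) : Prop :=
  forall p q, S p -> D q -> p.1 <= q.1 -> p.2 <= q.2 -> S q.

Definition threshold_closed_sets : set (set (R * R)) :=
  [set S | [/\ closed S, S `<=` square, dagger S = S,
               increasing_set square S & edges `<=` S]].

Definition threshold_open_sets : set (set (R * R)) :=
  [set S | [/\ open S, S `<=` open_square, dagger S = S &
               increasing_set open_square S]].

Definition lambda1 : {measure set (measurableTypeR R) -> \bar R} := @lebesgue_measure R.

Definition lambda2 :
  {measure set (measurableTypeR R * measurableTypeR R) -> \bar R} :=
  (@lebesgue_measure R \x @lebesgue_measure R)%E.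

(** A function on the square is represented by a function on the plane, whose
    values outside the square are irrelevant. *)

Definition ae_eq_square W1 W2 : bool :=
  `[< W1 = W2 %[ae lambda2 in square] >].

Lemma ae_eq_square_refl : reflexive ae_eq_square.
Proof. by move=> W; apply/asboolP; exact: ae_eq_refl. Qed.

Lemma ae_eq_square_sym : symmetric ae_eq_square.
Proof. by move=> V W; apply/idP/idP => /asboolP h; apply/asboolP/ae_eq_sym. Qed.

Lemma ae_eq_square_trans : transitive ae_eq_square.
Proof. by move=> V U W /asboolP h /asboolP k; apply/asboolP/(ae_eq_trans h k). Qed.

Canonical ae_eq_square_equiv :=
  EquivRel ae_eq_square ae_eq_square_refl ae_eq_square_sym ae_eq_square_trans.

Definition fun_class : Type := {eq_quot ae_eq_square}.
HB.instance Definition _ := Choice.on fun_class.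
HB.instance Definition _ := EqQuotient.on fun_class.

Definition class_of W : fun_class := \pi_fun_class W.

Definition threshold_function W : Prop :=
  [/\ forall p, square p -> W p = 0 \/ W p = 1,
      forall x y, square (x, y) -> W (x, y) = W (y, x) &
      forall p q, square p -> square q ->
        p.1 <= q.1 -> p.2 <= q.2 -> W p <= W q].

Definition threshold_functions : set fun_class :=
  class_of @` threshold_function.

Fixpoint cube_integral n : (n.-tuple R -> R) -> R :=
  match n with
  | 0 => fun f => f [tuple]
  | m.+1 => fun f =>
      \int[lambda1]_(x in I01) cube_integral (fun t => f [tuple of x :: t])
  end.

Definition graphon_density (F : graph) W : R :=
  cube_integral (fun x : (nvert F).-tuple R =>
    \prod_(i < nvert F) \prod_(j < nvert F | (i < j)%N && adj i j)
      W (tnth x i, tnth x j)).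

(** The second coordinate, the limit of [1 / v(G_n)], vanishes at every graph
    limit. *)
Definition graphon_limit W : graph_space R :=
  ((fun F : ugraph => graphon_density (repr F) W), 0).

End Square.

Arguments I01 R : clear implicits.
Arguments square R : clear implicits.
Arguments open_square R : clear implicits.
Arguments edges R : clear implicits.
Arguments threshold_closed_sets R : clear implicits.
Arguments threshold_open_sets R : clear implicits.
Arguments threshold_functions R : clear implicits.

(** A library measure is a function on all sets, constrained on measurable ones
    only, so measures are identified when they agree on Borel sets. A measure on
    [0,1] is a measure on the line giving full mass to [0,1]. *)

Section Probability.
Context (R : realType).

Definition prob01_rep : Type :=
  [set mu : probability (measurableTypeR R) R | mu (I01 R) = 1%E].
HB.instance Definition _ := Choice.on prob01_rep.

Definition prob01_eq (mu nu : prob01_rep) : bool :=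
  `[< forall A : set (measurableTypeR R),
        measurable A -> set_val mu A = set_val nu A >].

Lemma prob01_eq_refl : reflexive prob01_eq.
Proof. by move=> mu; apply/asboolP. Qed.

Lemma prob01_eq_sym : symmetric prob01_eq.
Proof.
by move=> mu nu; apply/idP/idP => /asboolP h; apply/asboolP => A mA;
  rewrite h.
Qed.

Lemma prob01_eq_trans : transitive prob01_eq.
Proof.
by move=> nu mu pi /asboolP h /asboolP k; apply/asboolP => A mA; rewrite h ?k.
Qed.

Canonical prob01_equiv :=
  EquivRel prob01_eq prob01_eq_refl prob01_eq_sym prob01_eq_trans.

Definition prob01 : Type := {eq_quot prob01_eq}.
HB.instance Definition _ := Choice.on prob01.
HB.instance Definition _ := EqQuotient.on prob01.

Definition prob01_measure (mu : prob01) : probability (measurableTypeR R) R :=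
  set_val (repr mu).
Coercion prob01_measure : prob01 >-> Probability.type.

Definition test_function : Type :=
  [set f : R -> R | {within I01 R, continuous f}].

Definition test_integrals (mu : prob01) : {ptws test_function -> R} :=
  fun f => \int[mu]_(x in I01 R) set_val f x.

(** The topology of weak convergence; the subspace topology on
    [dagger_symmetric] below comes from the library instance on [set_type]. *)
HB.instance Definition _ :=
  Topological.copy prob01 (initial_topology test_integrals).

Definition is_degree_distribution (Gamma : graph_space R) (nu : prob01) : Prop :=
  unique (fun mu : prob01 => forall k, (1 <= k)%N ->
    \int[mu]_(s in I01 R) s ^+ k = limit_density (star k) Gamma) nu.

Definition S_ (mu : prob01) : set (R * R) :=
  [set p | square R p /\ fine (mu `[0%R, 1 - p.2[%classic) <= p.1].

Definition W_ (mu : prob01) : R * R -> R := \1_(S_ mu).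

Definition Gamma_ (mu : prob01) : graph_space R := graphon_limit (W_ mu).

Definition is_dagger (mu mu' : prob01) : Prop := S_ mu' = dagger (S_ mu).

Definition dagger_symmetric : set prob01 := [set mu | is_dagger mu mu].

End Probability.

Arguments dagger_symmetric R : clear implicits.

Section Topologies.
Context (R : realType).

(** The topology of a distance: a set is open when it contains a ball around
    each of its points. *)
Definition dist_space (T : choiceType) (d : T -> T -> R) : Type := T.

Section DistTopology.
Context (T : choiceType) (d : T -> T -> R).

Definition dist_open : set (set T) :=
  [set U | forall x, U x -> exists2 e : R, 0 < e & forall y, d x y < e -> U y].

Lemma dist_openT : dist_open setT.
Proof. by move=> x _; exists 1. Qed.

Lemma dist_openI : setI_closed dist_open.
Proof.
move=> U V oU oV x [/oU[e e0 eU] /oV[f f0 fV]].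
exists (Num.min e f); first by rewrite lt_min e0.
by move=> y; rewrite lt_min => /andP[/eU Uy /fV Vy].
Qed.

Lemma dist_open_bigU (I : Type) (f : I -> set T) :
  (forall i, dist_open (f i)) -> dist_open (\bigcup_i f i).
Proof.
by move=> of_ x [i _ /(of_ i)[e e0 eU]]; exists e => // y /eU ?; exists i.
Qed.

HB.instance Definition _ := Choice.on (dist_space d).
HB.instance Definition _ := isOpenTopological.Build (dist_space d)
  dist_openT dist_openI dist_open_bigU.

Definition is_metric : Prop :=
  [/\ forall x y, 0 <= d x y,
      forall x y, d x y = 0 <-> x = y,
      forall x y, d x y = d y x &
      forall x y z, d x z <= d x y + d y z].

Definition compact_metric : Prop := is_metric /\ compact [set: dist_space d].

End DistTopology.

Definition compact_metrizable (X : topologicalType) : Prop :=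
  compact [set: X] /\
  exists d : X -> X -> R, is_metric d /\ @open X = dist_open d.

Definition homeomorphism (X Y : topologicalType) (f : X -> Y) : Prop :=
  exists g : Y -> X,
    [/\ cancel f g, cancel g f, continuous f & continuous g].

(** The Fell topology on a family [A] of closed sets, generated by the families
    of the sets hitting a given open set and of those missing a given compact
    set. For families of closed subsets of the unit square, open and compact
    sets of the plane yield the same subbase as relatively open and compact
    subsets of the square. *)
Definition fell_space (X : topologicalType) (A : set (set X)) : Type := A.

Section FellTopology.
Context (X : topologicalType) (A : set (set X)).

Definition fell_hit (U : set X) : set A := [set F | set_val F `&` U !=set0].
Definition fell_miss (K : set X) : set A := [set F | set_val F `&` K = set0].

Definition fell_subbase : set (set A) :=
  fell_hit @` open `|` fell_miss @` compact.

HB.instance Definition _ := Choice.on (fell_space A).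
HB.instance Definition _ :=
  isSubBaseTopological.Build (fell_space A) fell_subbase id.

End FellTopology.

Definition euclidean_dist (p q : R * R) : R :=
  Num.sqrt ((p.1 - q.1) ^+ 2 + (p.2 - q.2) ^+ 2).

Definition dist_to_set (p : R * R) (S : set (R * R)) : R :=
  inf [set euclidean_dist p q | q in S].

Definition hausdorff_dist (S1 S2 : set (R * R)) : R :=
  Num.max (sup [set dist_to_set p S2 | p in S1])
          (sup [set dist_to_set p S1 | p in S2]).

Definition measure_dist (S1 S2 : set (R * R)) : R :=
  fine (lambda2 R (S1 `+` S2)).

Definition l1_dist (W1 W2 : R * R -> R) : R :=
  \int[lambda2 R]_(p in square R) `|W1 p - W2 p|.

Definition measure_preserving_bijection (phi : R -> R) : Prop :=
  [/\ set_bij (I01 R) (I01 R) phi,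
      measurable_fun (I01 R) phi,
      forall A, measurable A -> A `<=` I01 R -> measurable (phi @` A) &
      forall A, measurable A -> A `<=` I01 R ->
        lambda1 R (I01 R `&` phi @^-1` A) = lambda1 R A].

Definition cut_norm (W : R * R -> R) : R :=
  sup [set r | exists A B : set R, [/\ measurable A, measurable B,
    A `<=` I01 R, B `<=` I01 R & r = `|\int[lambda2 R]_(p in A `*` B) W p|]].

Definition cut_dist (W1 W2 : R * R -> R) : R :=
  inf [set cut_norm (fun p => W1 p - W2 (phi p.1, phi p.2))
      | phi in measure_preserving_bijection].

End Topologies.

Section Spaces.
Context (R : realType).

Definition T_oo : topologicalType := threshold_limits R.
Definition P_s : topologicalType := dagger_symmetric R.
Definition C_T : choiceType := threshold_closed_sets R.
Definition O_T : choiceType := threshold_open_sets R.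
Definition W_T : choiceType := threshold_functions R.

Definition hausdorff_C (S1 S2 : C_T) : R :=
  hausdorff_dist (set_val S1) (set_val S2).
Definition measure_C (S1 S2 : C_T) : R :=
  measure_dist (set_val S1) (set_val S2).
Definition measure_O (S1 S2 : O_T) : R :=
  measure_dist (set_val S1) (set_val S2).
Definition l1_W (w1 w2 : W_T) : R :=
  l1_dist (repr (set_val w1)) (repr (set_val w2)).
Definition cut_W (w1 w2 : W_T) : R :=
  cut_dist (repr (set_val w1)) (repr (set_val w2)).

Definition C_hausdorff : topologicalType := dist_space hausdorff_C.
Definition C_fell : topologicalType := fell_space (threshold_closed_sets R).
Definition C_measure : topologicalType := dist_space measure_C.
Definition O_measure : topologicalType := dist_space measure_O.
Definition W_l1 : topologicalType := dist_space l1_W.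
Definition W_cut : topologicalType := dist_space cut_W.

End Spaces.

(* Main.v *)
(* All spaces are compared with the closed sets under the measure distance. Two
   increasing subsets of the square differ by a small measure iff each contains
   the other after a small diagonal shift, and whether it does is decided by
   finitely many grid points; so this space is compact, and a continuous bijection
   from it onto a Hausdorff space is a homeomorphism.

   The function class and the open set of a closed set S differ from S by null sets.
   A measure mu is recovered as the law of the degree function of S_mu, and the
   degree law of S is determined by its moments, which are the star densities of
   Gamma_S and are continuous for the cut distance; this gives injectivity on all
   sides.

   For graph limits, averaging over the grid points i/n approximates integrals of
   increasing functions, so the graph on {0, ..., n-1} with i ~ j iff
   (i/n, j/n) is in S has densities within O(1/n) of those of S. These graphs are
   exactly the threshold graphs, up to isomorphism: order the vertices by weight.
   Hence every limit of threshold graphs is a limit of the Gamma_S, and by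
   compactness is itself some Gamma_S. *)

Require Import Defs.
From HB Require Import structures.
From mathcomp Require Import all_boot all_order all_algebra generic_quotient.
From mathcomp Require Import all_classical all_reals all_analysis.
From mathcomp Require Import measurable_realfun lra zify.

Set Implicit Arguments.
Unset Strict Implicit.
Unset Printing Implicit Defensive.

Import Order.TTheory GRing.Theory Num.Theory.
Import numFieldNormedType.Exports.

Local Open Scope classical_set_scope.
Local Open Scope ring_scope.

(** * Monotone functions on the cube and their grid averages *)

(** Monotonicity replaces measurability on the cube: iterated integrals of increasing functions are
    compared through grid sums, one coordinate at a time. The hinge is [step_le]. A difference of
    measure below 1/n^2, the area of a box of side 1/n, forces it at scale 1/n; in turn it bounds
    the change of the area and of every homomorphism density by a multiple of 1/n. Increasing sets
    met on the way need be neither closed nor Borel; [hull] replaces a symmetric one by a member of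
    [C_T] that differs from it by a null set. Representatives of function classes are arbitrary
    functions, so integrals must be shown to ignore null sets without any measurability. That
    moments determine a law is obtained from explicit polynomials with values in [0,1] that converge
    pointwise to the indicator of [0,a), so dominated convergence takes the place of uniform
    approximation. A point of the space of graph limits also carries a second coordinate, whose
    vanishing needs an argument of its own: bounded orders would leave only finitely many graphs. *)

Section MonotoneIntegral.
Context (R : realType).
Local Notation I := (I01 R).
Local Notation L1 := (lambda1 R).
Implicit Types (g h : R -> R) (n k : nat).

Lemma I01P (x : R) : I x <-> 0 <= x <= 1.
Proof. by rewrite /I01 /= in_itv. Qed.

Lemma measurable_I01 : measurable (I : set (measurableTypeR R)).
Proof. exact: measurable_itv. Qed.
Hint Resolve measurable_I01 : core.

Lemma lambda1_itv (x y : R) (b c : bool) : x <= y ->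
  L1 [set` Interval (BSide b x) (BSide c y)] = (y - x)%:E.
Proof.
move=> xy; apply: etrans (lebesgue_measure_itv _) _ => /=.
rewrite lte_fin; case: ltP => // yx.
by have -> : x = y; [apply/eqP; rewrite eq_le xy | rewrite subrr].
Qed.

Lemma lambda1_I01 : L1 I = 1%E.
Proof. by rewrite /I01 lambda1_itv// subr0. Qed.

Lemma I01_clamp (x : R) : I (Num.min 1 (Num.max 0 x)).
Proof. by apply/I01P; rewrite le_min ge_min le_max !lexx ler01. Qed.

Lemma clamp_I01 (x : R) : I x -> Num.min 1 (Num.max 0 x) = x.
Proof. by move=> /I01P/andP[x0 x1]; rewrite max_r// min_r. Qed.

Lemma measurable_nondecreasing_I01 g :
  (forall x y, I x -> I y -> x <= y -> g x <= g y) ->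
  measurable_fun (I : set (measurableTypeR R)) g.
Proof.
(* Clamping to [0,1] turns [g] into a function monotone on the whole line that agrees with [g] on
   [I]. *)
move=> gm; pose c x : R := Num.min 1 (Num.max 0 x).
have : measurable_fun (I : set (measurableTypeR R)) (g \o c).
  apply: nondecreasing_measurable => // x y xy /=; apply: gm; try exact: I01_clamp.
  have M : Num.max 0 x <= Num.max 0 y by rewrite ge_max !le_max lexx xy orbT.
  by rewrite /c le_min !ge_min lexx M orbT.
apply: eq_measurable_fun => x; rewrite inE => xI /=.
by rewrite /c clamp_I01.
Qed.

Definition mono01 g := (forall x, I x -> 0 <= g x <= 1) /\
  forall x y, I x -> I y -> x <= y -> g x <= g y.

Lemma bounded_integrable (A : set (measurableTypeR R)) g (M : R) : measurable A -> A `<=` I ->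
  measurable_fun A g -> (forall x, A x -> `|g x| <= M) ->
  L1.-integrable A (EFin \o g).
Proof.
move=> mA AI mg gM; apply: measurable_bounded_integrable => //.
  apply: (@le_lt_trans _ _ (L1 I)); last by rewrite lambda1_I01 ltry.
  by apply: le_measure => //; rewrite inE.
exists M; split; first exact: num_real.
by move=> x Mx y Ay /=; apply: le_trans (gM _ Ay) (ltW Mx).
Qed.

Lemma cst_integrable (A : set (measurableTypeR R)) (c : R) : measurable A -> A `<=` I ->
  L1.-integrable A (EFin \o cst c).
Proof.
by move=> mA AI; apply: (@bounded_integrable _ _ `|c|) => //; exact: measurable_cst.
Qed.

Lemma mono01_integrable g : mono01 g -> L1.-integrable I (EFin \o g).
Proof.
move=> [g01 gm]; apply: (@bounded_integrable _ _ 1) => //.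
  exact: measurable_nondecreasing_I01.
by move=> x /g01/andP[g0 g1]; rewrite ger0_norm.
Qed.

Lemma mono01_integral g : mono01 g -> 0 <= \int[L1]_(x in I) g x <= 1.
Proof.
move=> gm; have ig := mono01_integrable gm; case: gm => g01 _.
apply/andP; split.
  by apply: Rintegral_ge0 => x /g01/andP[].
have -> : 1 = \int[L1]_(x in I) (cst 1 x).
  by rewrite Rintegral_cst// lambda1_I01 mulr1.
apply: le_Rintegral => //; last by move=> x /g01/andP[].
exact: cst_integrable.
Qed.

Lemma mono01_le_integral g h : mono01 g -> mono01 h ->
  (forall x, I x -> g x <= h x) -> \int[L1]_(x in I) g x <= \int[L1]_(x in I) h x.
Proof. by move=> mg mh gh; apply: le_Rintegral => //; exact: mono01_integrable. Qed.

Definition grid_mean n g : R := (\sum_(i < n) g (i%:R / n%:R)) / n%:R.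

Lemma grid_I01 n i : (i <= n)%N -> I (i%:R / n%:R).
Proof.
move=> le_in; apply/I01P; rewrite divr_ge0 ?ler0n//=.
case: n le_in => [|n] le_in; first by rewrite invr0 mulr0 ler01.
by rewrite ler_pdivrMr ?ltr0n// mul1r ler_nat.
Qed.

Lemma grid_ord_I01 n (i : 'I_n) : I (i%:R / n%:R).
Proof. exact/grid_I01/ltnW. Qed.

Lemma mono01_cell g n i : (i < n)%N -> mono01 g ->
  g (i%:R / n%:R) / n%:R <=
    \int[L1]_(x in `[i%:R / n%:R, i.+1%:R / n%:R[) g x
  <= g (i.+1%:R / n%:R) / n%:R.
Proof.
move=> ltin [g01 gm]; have n0 : (0 < n)%N by exact: leq_trans ltin.
have n0R : 0 < n%:R :> R by rewrite ltr0n.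
set a := i%:R / _; set b := i.+1%:R / _.
have aI : I a by apply: grid_I01; exact: ltnW.
have bI : I b by exact: grid_I01.
have ab : a < b by rewrite ltr_pM2r ?invr_gt0// ltr_nat.
have sub : `[a, b[%classic `<=` I.
  move=> x /=; rewrite in_itv/= => /andP[ax xb]; apply/I01P.
  move/I01P: aI => /andP[a0 _]; move/I01P: bI => /andP[_ b1].
  by rewrite (le_trans a0)//= (le_trans (ltW xb)).
have mu : fine (L1 `[a, b[%classic) = n%:R^-1.
  rewrite lambda1_itv ?(ltW ab)//=.
  by rewrite /b /a -mulrBl -natrB// subSnn mul1r.
have cstI c : L1.-integrable `[a, b[ (EFin \o (fun=> c)).
  exact: cst_integrable.
have gI : L1.-integrable `[a, b[ (EFin \o g).
  by apply: integrableS (mono01_integrable _) => //.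
rewrite -mu -!(Rintegral_cst L1 (D := `[a, b[%classic))//.
by apply/andP; split; apply: le_Rintegral => // x /[dup] /sub xI /=;
  rewrite in_itv /= => /andP[ax xb]; apply: gm => //; exact: ltW.
Qed.

(** The left and right endpoint sums bracket the integral, and they differ by (g(1) - g(0))/n, which
    is at most 1/n. *)
Lemma mono01_grid g n : (0 < n)%N -> mono01 g ->
  grid_mean n g <= \int[L1]_(x in I) g x <= grid_mean n g + n%:R^-1.
Proof.
move=> n0 mg; have n0R : 0 < n%:R :> R by rewrite ltr0n.
have gI := mono01_integrable mg.
have part m : (m <= n)%N ->
   (\sum_(i < m) g (i%:R / n%:R)) / n%:R <=
   \int[L1]_(x in `[0, m%:R / n%:R[) g x <=
   (\sum_(i < m) g (i.+1%:R / n%:R)) / n%:R.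
  elim: m => [_|m IH ltmn].
    by rewrite !big_ord0 !mul0r set_itv_ge ?bnd_simp ?ltxx// Rintegral_set0 lexx.
  have bI : I (m%:R / n%:R) by exact/grid_I01/ltnW.
  have cI : I (m.+1%:R / n%:R) by exact/grid_I01.
  have bc : m%:R / n%:R <= m.+1%:R / n%:R :> R.
    by rewrite ler_pM2r ?invr_gt0// ler_nat.
  rewrite (@itv_bndbnd_setU _ _ _ (BLeft (m%:R / n%:R))) ?bnd_simp ?divr_ge0 ?ler0n //.
  rewrite Rintegral_setU//=; last 2 first.
  - rewrite -itv_bndbnd_setU ?bnd_simp ?divr_ge0 ?ler0n //.
    apply: integrableS gI => //.
    move=> x /=; rewrite in_itv /= => /andP[x0 xc]; apply/I01P; rewrite x0 /=.
    by move/I01P: cI => /andP[_]; apply: le_trans; exact: ltW.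
  - apply/disj_setPS => y [/=]; rewrite 2!in_itv/= => /andP[_ yx] /andP[].
    by rewrite leNgt yx.
  have /andP[l1 l2] := IH (ltnW ltmn).
  have /andP[k1 k2] := mono01_cell ltmn mg.
  by rewrite !big_ord_recr /= !mulrDl !lerD.
have /andP[l1 l2] := part n (leqnn n).
have E : \int[L1]_(x in I) g x = \int[L1]_(x in `[0, n%:R / n%:R[) g x.
  rewrite divff ?gt_eqF// /I01 Rintegral_itv_bndo_bndc//.
  apply: integrableS gI => //.
  by move=> x /=; rewrite in_itv /= => /andP[x0 /ltW x1]; apply/I01P/andP.
rewrite E l1 /= (le_trans l2)//.
rewrite /grid_mean -[X in _ + X]mul1r -mulrDl ler_pM2r ?invr_gt0//.
case: n n0 {part l1 l2 E n0R} => // n _.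
rewrite big_ord_recr big_ord_recl /= mul0r.
have -> : \sum_(i < n) g (i.+1%:R / n.+1%:R) =
  \sum_(i < n) g ((bump 0 i)%:R / n.+1%:R) by apply: eq_bigr => i _; rewrite /bump add1n.
case: mg => g01 _.
have /g01/andP[_ h1] : I (n.+1%:R / n.+1%:R) by exact: grid_I01.
have /g01/andP[h0 _] : I (0 : R) by apply/I01P; rewrite lexx ler01.
lra.
Qed.

(** In the left sums the shift matches each grid point of [g] with the next one of [h]. Only the
    last point of [g] and the first of [h] stay unmatched, which costs 1/n; passing from the
    integral of [g] to its sum costs another 1/n. The constant 3 leaves slack. *)
Lemma mono01_shift g h n (c : R) : (0 < n)%N -> 0 <= c -> mono01 g -> mono01 h ->
  (forall x, 0 <= x -> x + n%:R^-1 < 1 -> g x <= h (x + n%:R^-1) + c) ->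
  \int[L1]_(x in I) g x <= \int[L1]_(x in I) h x + c + 3 / n%:R.
Proof.
move=> n0 c0 mg mh gh; have n0R : 0 < n%:R :> R by rewrite ltr0n.
have /andP[_ l1] := mono01_grid n0 mg; have /andP[l2 _] := mono01_grid n0 mh.
suff : grid_mean n g <= grid_mean n h + c + 1 / n%:R.
  have : 3 / n%:R = 1 / n%:R + n%:R^-1 + n%:R^-1 :> R by lra.
  have := divr_gt0 ltr01 n0R; lra.
rewrite /grid_mean ler_pdivrMr// 2!mulrDl !divfK ?gt_eqF//.
case: n n0 {n0R l1 l2} gh => // n _ gh.
rewrite big_ord_recr [X in _ <= X + _ + _]big_ord_recl /= mul0r.
case: mg => g01 _; case: mh => h01 _.
have /g01/andP[_ h1] : I (n%:R / n.+1%:R) by exact: grid_I01.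
have /h01/andP[h0 _] : I (0 : R) by apply/I01P; rewrite lexx ler01.
suff : \sum_(i < n) g (i%:R / n.+1%:R) <=
       \sum_(i < n) h ((bump 0 i)%:R / n.+1%:R) + c * n.+1%:R by lra.
have -> : c * n.+1%:R = \sum_(i < n) c + c.
  by rewrite sumr_const card_ord -[n.+1%:R]natr1 mulrDr mulr1 mulr_natr.
rewrite addrA -big_split /= -[leLHS]addr0 lerD// ler_sum// => i _.
have -> : (bump 0 i)%:R / n.+1%:R = i%:R / n.+1%:R + n.+1%:R^-1 :> R.
  by rewrite /bump add1n -[i.+1%:R]natr1 mulrDl mul1r.
apply: gh; first by rewrite divr_ge0 ?ler0n.
rewrite -[X in _ + X]mul1r -mulrDl natr1 ltr_pdivrMr ?ltr0n// mul1r ltr_nat.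
by rewrite ltnS.
Qed.

(** * Monotone functions of several variables *)

Definition in_cube k (t : k.-tuple R) := forall i, I (tnth t i).

Definition cube_mono k (f : k.-tuple R -> R) :=
  (forall t, in_cube t -> 0 <= f t <= 1) /\
  forall t u, in_cube t -> in_cube u -> (forall i, tnth t i <= tnth u i) -> f t <= f u.

Lemma forall_tnth_cons (P : forall k, 'I_k -> R -> Prop) k x (t : k.-tuple R) :
  P k.+1 ord0 x -> (forall i, P k.+1 (lift ord0 i) (tnth t i)) ->
  forall i, P k.+1 i (tnth [tuple of x :: t] i).
Proof.
move=> P0 PS i; case: (unliftP ord0 i) => [j ->|->]; last by rewrite tnth0.
by rewrite tnthS.
Qed.

Lemma in_cube_cons k x (t : k.-tuple R) : I x -> in_cube t -> in_cube [tuple of x :: t].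
Proof. by move=> xI tI; apply: (@forall_tnth_cons (fun _ _ => I)). Qed.

Lemma cube_mono_cons k (f : k.+1.-tuple R -> R) x : I x -> cube_mono f ->
  cube_mono (fun t : k.-tuple R => f [tuple of x :: t]).
Proof.
move=> xI [f01 fm]; split => [t tI|t u tI uI tu]; first exact/f01/in_cube_cons.
apply: fm; try exact: in_cube_cons.
move=> i; case: (unliftP ord0 i) => [j ->|->]; last by rewrite !tnth0.
by rewrite !tnthS.
Qed.

(** Bounds and comparison go into one induction: the outer integrand is in [mono01] only once the
    inner integrals are known to be both bounded and ordered. *)
Lemma cube_integral_mono k (f f' : k.-tuple R -> R) : cube_mono f -> cube_mono f' ->
  (0 <= cube_integral f <= 1) /\
  ((forall t, in_cube t -> f t <= f' t) -> cube_integral f <= cube_integral f').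
Proof.
elim: k f f' => [|k IH] f f' mf mf' /=.
  by split => [|]; [apply: mf.1|apply]; case.
have mono (h : k.+1.-tuple R -> R) : cube_mono h ->
    mono01 (fun x => cube_integral (fun t : k.-tuple R => h [tuple of x :: t])).
  move=> mh; split => [x xI|x y xI yI xy].
    by apply: (proj1 (IH _ _ (cube_mono_cons xI mh) (cube_mono_cons xI mh))).
  apply: (proj2 (IH _ _ (cube_mono_cons xI mh) (cube_mono_cons yI mh))) => t tI.
  apply: mh.2; try exact: in_cube_cons.
  move=> i; case: (unliftP ord0 i) => [j ->|->]; first by rewrite !tnthS.
  by rewrite !tnth0.
split; first exact/mono01_integral/mono.
move=> ff'; apply: mono01_le_integral; try exact: mono.
move=> x xI.
apply: (proj2 (IH _ _ (cube_mono_cons xI mf) (cube_mono_cons xI mf'))) => t tI.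
exact/ff'/in_cube_cons.
Qed.

Lemma cube_integral_mono01 k (f : k.+1.-tuple R -> R) : cube_mono f ->
  mono01 (fun x => cube_integral (fun t : k.-tuple R => f [tuple of x :: t])).
Proof.
move=> mf; split => [x xI|x y xI yI xy].
  have mx := cube_mono_cons xI mf; exact: (cube_integral_mono mx mx).1.
apply: (cube_integral_mono (cube_mono_cons xI mf) (cube_mono_cons yI mf)).2 => t tI.
apply: mf.2; try exact: in_cube_cons.
move=> i; case: (unliftP ord0 i) => [j ->|->]; first by rewrite !tnthS.
by rewrite !tnth0.
Qed.

Lemma cube_integral_eq k (f f' : k.-tuple R -> R) :
  (forall t, in_cube t -> f t = f' t) -> cube_integral f = cube_integral f'.
Proof.
elim: k f f' => [|k IH] f f' ff' /=; first by apply: ff'; case.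
apply: eq_Rintegral => x; rewrite inE => xI; apply: IH => t tI.
exact/ff'/in_cube_cons.
Qed.

(** The error of the inner integrals enters [mono01_shift] as its constant [c], and each of the [k]
    coordinates adds 3/n. *)
Lemma cube_integral_shift k (f f' : k.-tuple R -> R) n : (0 < n)%N ->
  cube_mono f -> cube_mono f' ->
  (forall t t', in_cube t -> in_cube t' ->
     (forall i, tnth t' i = tnth t i + n%:R^-1 /\ tnth t' i < 1) -> f t <= f' t') ->
  cube_integral f <= cube_integral f' + 3 * k%:R / n%:R.
Proof.
move=> n0; elim: k f f' => [|k IH] f f' mf mf' ff' /=.
  by rewrite mulr0 mul0r addr0; apply: ff'; case.
rewrite -[k.+1%:R]natr1 mulrDr mulrDl mulr1 addrA.
have n0R : 0 < n%:R :> R by rewrite ltr0n.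
apply: mono01_shift => //; try exact: cube_integral_mono01.
move=> x x0 x1.
have nV : 0 < n%:R^-1 :> R by rewrite invr_gt0.
have xI : I x by apply/I01P; rewrite x0/=; lra.
have x'I : I (x + n%:R^-1) by apply/I01P; apply/andP; split; lra.
apply: IH; try exact: cube_mono_cons.
move=> t t' tI t'I tt'; apply: ff'; try exact: in_cube_cons.
move=> i; case: (unliftP ord0 i) => [j ->|->]; first by rewrite !tnthS.
by rewrite !tnth0.
Qed.

Fixpoint cube_mean n k : (k.-tuple R -> R) -> R :=
  match k with
  | 0 => fun f => f [tuple]
  | m.+1 => fun f => grid_mean n (fun x => cube_mean n (fun t => f [tuple of x :: t]))
  end.

Lemma grid_meanB n g h (c : R) : (0 < n)%N -> (forall i : 'I_n, `|g (i%:R / n%:R) - h (i%:R / n%:R)| <= c) ->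
  `|grid_mean n g - grid_mean n h| <= c.
Proof.
move=> n0 gh; have n0R : 0 < n%:R :> R by rewrite ltr0n.
rewrite /grid_mean -mulrBl -sumrB normrM (ger0_norm (_ : 0 <= n%:R^-1)) ?invr_ge0 ?ler0n//.
rewrite ler_pdivrMr// (le_trans (ler_norm_sum _ _ _))//.
rewrite (le_trans (ler_sum _ (fun i _ => gh i)))//.
by rewrite sumr_const card_ord mulr_natr.
Qed.

(** Each coordinate contributes 1/n: the outer integral by [mono01_grid], the inner ones because an
    average of errors is no larger than their common bound. *)
Lemma cube_mean_integral k (f : k.-tuple R -> R) n : (0 < n)%N -> cube_mono f ->
  `|cube_integral f - cube_mean n f| <= k%:R / n%:R.
Proof.
move=> n0; elim: k f => [|k IH] f mf /=; first by rewrite subrr normr0 mul0r.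
set g := fun x => cube_integral _.
have /andP[l1 l2] := mono01_grid n0 (cube_integral_mono01 mf).
have l3 : `|grid_mean n g - grid_mean n
    (fun x : R => cube_mean n (fun t : k.-tuple R => f [tuple of x :: t]))| <= k%:R / n%:R.
  apply: grid_meanB => // i; apply: IH; apply: cube_mono_cons => //.
  exact: grid_ord_I01.
rewrite -[k.+1%:R]natr1 mulrDl mul1r [leRHS]addrC.
apply: le_trans (ler_distD (grid_mean n g) _ _) _.
apply: lerD => //; rewrite ler_norml; lra.
Qed.

End MonotoneIntegral.

(** * Increasing subsets of the square *)

Section UpperSets.
Context (R : realType).
Local Notation I := (I01 R).
Local Notation L1 := (lambda1 R).
Local Notation L2 := (lambda2 R).
Local Notation plane := (measurableTypeR R * measurableTypeR R)%type.
Implicit Types (S T L : set (R * R)) (p q : R * R) (n k : nat).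

Lemma nbhs_planeP p U : nbhs p U <-> exists2 e : R, 0 < e &
  forall q, `|p.1 - q.1| < e -> `|p.2 - q.2| < e -> U q.
Proof.
split => [/nbhs_ballP[e e0 eU]|[e e0 eU]].
  by exists e => // q q1 q2; apply: eU; split.
by apply/nbhs_ballP; exists e => // q [q1 q2]; exact: eU.
Qed.

Lemma measurable_box (a b c d : R) (i j k l : bool) : measurable
  ([set` Interval (BSide i a) (BSide j b)] `*` [set` Interval (BSide k c) (BSide l d)] : set plane).
Proof. by apply: measurableX; exact: measurable_itv. Qed.

(** An open set is a countable union of boxes with rational corners, and boxes belong to the product
    sigma-algebra. *)
Lemma open_plane_measurable (U : set (R * R)) : open U -> measurable (U : set plane).
Proof.
move=> oU; pose box (a b c d : rat) : set (R * R) :=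
  `]ratr a, ratr b[%classic `*` `]ratr c, ratr d[%classic.
(* Building the inclusion in [U] into [B] makes each [B a b c d] a box or empty, so that the four
   unions may run over all rationals. *)
pose B a b c d := [set p | box a b c d p /\ box a b c d `<=` U].
have -> : U = \bigcup_a \bigcup_b \bigcup_c \bigcup_d B a b c d.
  apply/seteqP; split => [p Up|p [a _ [b _ [c _ [d _ [Bp BU]]]]]]; last exact: BU.
  have /nbhs_planeP[e e0 eU] : nbhs p U by rewrite nbhsE; exists U.
  have lt1 (x : R) : x - e < x by lra.
  have lt2 (x : R) : x < x + e by lra.
  have [a /itvP ha] := rat_in_itvoo (lt1 p.1); have [b /itvP hb] := rat_in_itvoo (lt2 p.1).
  have [c /itvP hc] := rat_in_itvoo (lt1 p.2); have [d /itvP hd] := rat_in_itvoo (lt2 p.2).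
  exists a => //; exists b => //; exists c => //; exists d => //; split.
    by split; rewrite /= in_itv /= ?ha ?hb ?hc ?hd.
  move=> q [] /=; rewrite !in_itv /= => /andP[q1 q2] /andP[q3 q4].
  have hb2 : ratr b < p.1 + e by rewrite hb.
  have ha2 : p.1 - e < ratr a by rewrite ha.
  have hd2 : ratr d < p.2 + e by rewrite hd.
  have hc2 : p.2 - e < ratr c by rewrite hc.
  by apply: eU; rewrite ltr_distlC; apply/andP; split; lra.
apply: bigcupT_measurable_rat => a; apply: bigcupT_measurable_rat => b.
apply: bigcupT_measurable_rat => c; apply: bigcupT_measurable_rat => d.
rewrite /B; have [BU|nBU] := pselect (box a b c d `<=` U).
  rewrite (_ : [set p | _] = box a b c d); first exact: measurable_box.
  by apply/seteqP; split => [p []|p].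
by rewrite (_ : [set p | _] = set0)//; apply/seteqP; split => [p []|p].
Qed.

Lemma closed_plane_measurable S : closed S -> measurable (S : set plane).
Proof.
by move=> cS; rewrite -(setCK S); apply: measurableC; apply: open_plane_measurable; exact: closed_openC.
Qed.

Lemma lambda2_box (a b c d : R) : a <= b -> c <= d ->
  L2 (`[a, b] `*` `[c, d]) = ((b - a) * (d - c))%:E.
Proof.
move=> ab cd; apply: etrans (product_measure1E _ _ _ _) _; try exact: measurable_itv.
by rewrite -/(lambda1 R) !lambda1_itv.
Qed.

Lemma squareP p : square R p <-> (0 <= p.1 <= 1) /\ (0 <= p.2 <= 1).
Proof. by split => [[] /I01P h1 /I01P h2|[] /I01P h1 /I01P h2]. Qed.

Lemma measurable_square : measurable (square R : set plane).
Proof. exact: measurable_box. Qed.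

Lemma lambda2_square : L2 (square R) = 1%E.
Proof. by rewrite lambda2_box ?ler01// subr0 mulr1. Qed.

Lemma lambda2_ltS S : S `<=` square R -> measurable (S : set plane) -> (L2 S <= 1)%E.
Proof.
move=> Ss mS; rewrite -lambda2_square; apply: le_measure => //; rewrite inE //.
exact: measurable_square.
Qed.

Lemma lambda2_fin S : S `<=` square R -> measurable (S : set plane) -> L2 S \is a fin_num.
Proof.
by move=> Ss mS; rewrite ge0_fin_numE//; apply: le_lt_trans (lambda2_ltS Ss mS) (ltry _).
Qed.

Lemma measurable_edges : measurable (edges R : set plane).
Proof.
by apply: measurableU; apply: measurableX => //; exact: measurable_I01.
Qed.

Lemma lambda2_leU S T : measurable (S : set plane) -> measurable (T : set plane) ->
  (L2 (S `|` T) <= L2 S + L2 T)%E.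
Proof. exact: measureU2. Qed.

Lemma lambda2_edges : L2 (edges R) = 0%E.
Proof.
apply/eqP; rewrite eq_le measure_ge0 andbT.
have -> : edges R = (`[0, 1] `*` `[1, 1]) `|` (`[1, 1] `*` `[0, 1]) by rewrite !set_itv1.
apply: le_trans (lambda2_leU _ _) _; try exact: measurable_box.
by rewrite !lambda2_box// subrr mulr0 mul0r adde0.
Qed.

Lemma edges_square : edges R `<=` square R.
Proof.
move=> p [[/I01P p1 p2]|[p1 /I01P p2]]; apply/squareP; split => //.
  by rewrite p2 ler01 lexx.
by rewrite p1 ler01 lexx.
Qed.

Lemma edgesP p : square R p -> edges R p <-> p.1 = 1 \/ p.2 = 1.
Proof. by move=> [s1 s2]; split => [[[]|[]]|[]]; [right|left|right|left]. Qed.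

Definition upset S := S `<=` square R /\ increasing_set (square R) S.

Lemma upsetU S T : upset S -> upset T -> upset (S `|` T).
Proof.
move=> [Ss iS] [Ts iT]; split => [p []|p q [Sp|Tp] sq p1 p2]; [exact: Ss|exact: Ts| |].
  by left; exact: iS p1 p2.
by right; exact: iT p1 p2.
Qed.

Lemma upset_edges : upset (edges R).
Proof.
split; first exact: edges_square.
move=> p q ep sq p1 p2; apply/(edgesP sq).
have sp := edges_square ep; move/(edgesP sp): ep; move/squareP: sq => [? ?].
by case=> ?; [left|right]; lra.
Qed.

(* For increasing sets this is inclusion up to scale [1/n]: it fails only if
   [S `\` T] contains a box of side [1/n], and it bounds [L2 (S `\` T)] by a
   multiple of [1/n]. *)
Definition step_le n S T := forall x y : R, 0 <= x -> x + n%:R^-1 < 1 -> 0 <= y -> y + n%:R^-1 < 1 ->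
  S (x, y) -> T (x + n%:R^-1, y + n%:R^-1).

Lemma step_le_sub n S T : (0 < n)%N -> upset T -> S `<=` T -> step_le n S T.
Proof.
move=> n0 [_ iT] ST x y x0 x1 y0 y1 Sxy.
have nV : 0 < n%:R^-1 :> R by rewrite invr_gt0 ltr0n.
apply: (iT (x, y)); [exact: ST|apply/squareP => /=; lra| |] => /=; lra.
Qed.

Lemma step_leU n S T : (0 < n)%N -> upset T -> step_le n S T -> step_le n (S `|` T) T.
Proof.
move=> n0 uT ST x y x0 x1 y0 y1 [|]; first exact: ST.
exact: (@step_le_sub n T).
Qed.

(** If [S] contains [(x, y)] and [T] misses the shifted point, then [S] contains everything above
    the first and [T] misses everything below the second; the box lies between them. *)
Lemma not_step_le n S T : (0 < n)%N -> upset S -> upset T -> ~ step_le n S T ->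
  exists x y : R, [/\ 0 <= x /\ x + n%:R^-1 < 1, 0 <= y /\ y + n%:R^-1 < 1 &
    `[x, x + n%:R^-1] `*` `[y, y + n%:R^-1] `<=` S `\` T].
Proof.
move=> n0 [Ss iS] [Ts iT] nst; apply: contrapT => H; apply: nst => x y x0 x1 y0 y1 Sxy.
apply: contrapT => nT; apply: H; exists x, y; split => // -[u v] []/=.
rewrite !in_itv/= => /andP[xu ux] /andP[yv vy].
have suv : square R (u, v) by apply/squareP => /=; lra.
split; first exact: (iS (x, y)).
move=> Tuv; apply: nT; apply: (iT (u, v)) => //=; apply/squareP => /=.
by have nV : 0 < n%:R^-1 :> R; [rewrite invr_gt0 ltr0n|lra].
Qed.

Lemma lambda2_step_box n (x y : R) : (0 < n)%N ->
  L2 (`[x, x + n%:R^-1] `*` `[y, y + n%:R^-1]) = (n%:R^-2)%:E.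
Proof.
move=> n0; rewrite lambda2_box ?lerDl ?invr_ge0//.
have E (z : R) : z + n%:R^-1 - z = n%:R^-1 by rewrite addrAC subrr add0r.
by rewrite !E -expr2 exprVn.
Qed.

Lemma negligible_step_le n S T : (0 < n)%N -> upset S -> upset T ->
  L2.-negligible (S `\` T) -> step_le n S T.
Proof.
move=> n0 uS uT [N [mN N0 sN]]; apply: contrapT => /(not_step_le n0 uS uT)[x [y [_ _ sB]]].
have : (L2 (`[x, (x + n%:R^-1)%R] `*` `[y, (y + n%:R^-1)%R]) <= L2 N)%E.
  apply: le_measure; rewrite ?inE//; first exact: measurable_box.
  by move=> p /sB /sN.
by rewrite lambda2_step_box// N0 lee_fin leNgt invr_gt0 exprn_gt0// ltr0n.
Qed.

(** The bound 1/n^2 is the area of the box that a failure of [step_le] would put into the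
    difference. *)
Lemma measure_step_le n S T : (0 < n)%N -> upset S -> upset T ->
  measurable (S : set plane) -> measurable (T : set plane) ->
  (L2 (S `\` T) < (n%:R^-2)%:E)%E -> step_le n S T.
Proof.
move=> n0 uS uT mS mT; rewrite ltNge => /negP H.
apply: contrapT => /(not_step_le n0 uS uT)[x [y [_ _ sB]]]; apply: H.
rewrite -(lambda2_step_box x y n0); apply: le_measure; rewrite ?inE//.
  exact: measurable_box.
exact: measurableD.
Qed.

(** * Areas of increasing sets *)

Lemma upset_ind_mono S p q : upset S -> square R q -> p.1 <= q.1 -> p.2 <= q.2 ->
  \1_S p <= \1_S q :> R.
Proof.
move=> [Ss iS] sq p1 p2; rewrite !indicE.
case: (boolP (p \in S)) => [|_]; last by case: (q \in S); rewrite ?lexx ?ler01.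
rewrite inE => Sp; have Sq : q \in S by rewrite inE; exact: iS p1 p2.
by rewrite Sq.
Qed.

Lemma ind01 S p : 0 <= (\1_S p : R) <= 1.
Proof. by rewrite indicE; case: (p \in S); rewrite ?lexx ?ler01. Qed.

(** An iterated integral instead of [lambda2], so that the results on [cube_integral] apply;
    [lambda2_area] identifies the two. *)
Definition area S : R := \int[L1]_(x in I) \int[L1]_(y in I) \1_S (x, y).

Definition area_fun S (t : 2.-tuple R) : R := \1_S (tnth t ord0, tnth t ord_max).

Lemma area_cube S : area S = cube_integral (area_fun S).
Proof. by []. Qed.

Lemma area_fun_mono S : upset S -> cube_mono (area_fun S).
Proof.
move=> uS; split => [t _|t u tI uI tu]; first exact: ind01.
by apply: upset_ind_mono => //=; split => /=.
Qed.

Lemma step_le_area n S T : (0 < n)%N -> upset S -> upset T -> step_le n S T ->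
  area S <= area T + 6 / n%:R.
Proof.
move=> n0 uS uT ST; rewrite !area_cube; have -> : 6 = 3 * 2%:R :> R by lra.
apply: cube_integral_shift => //; try exact: area_fun_mono.
move=> t t' tI t'I tt'.
rewrite /area_fun !indicE; case: (boolP (_ \in S)) => [|_]; last by case: (_ \in T); rewrite ?ler01.
rewrite inE => St; suff -> : (tnth t' ord0, tnth t' ord_max) \in T by [].
have [E1 h1] := tt' ord0; have [E2 h2] := tt' ord_max.
rewrite inE E1 E2; apply: ST => //; rewrite -?E1 -?E2//.
  by have /I01P/andP[] := tI ord0.
by have /I01P/andP[] := tI ord_max.
Qed.

Lemma integrable_square (A : set plane) (f : R * R -> R) (M : R) :
  measurable A -> A `<=` square R -> measurable_fun A f ->
  (forall p, A p -> `|f p| <= M) -> L2.-integrable A (EFin \o f).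
Proof.
move=> mA As mf fM; apply: measurable_bounded_integrable => //.
  exact: le_lt_trans (lambda2_ltS As mA) (ltry _).
exists M; split; first exact: num_real.
by move=> x Mx y Ay /=; apply: le_trans (fM _ Ay) (ltW Mx).
Qed.

Lemma Rintegral_prod (A B : set (measurableTypeR R)) (f : R * R -> R) (M : R) :
  measurable A -> measurable B -> A `<=` I -> B `<=` I ->
  measurable_fun (A `*` B : set plane) f ->
  (forall p, (A `*` B) p -> `|f p| <= M) ->
  \int[L2]_(p in A `*` B) f p = \int[L1]_(x in A) \int[L1]_(y in B) f (x, y).
Proof.
move=> mA mB AI BI mf fM; have mAB : measurable (A `*` B : set plane) by exact: measurableX.
have ABs : A `*` B `<=` square R by move=> p [/AI p1 /BI p2]; split.
rewrite [LHS]Rintegral_mkcond [in RHS]Rintegral_mkcond /Rintegral; congr fine.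
(* Fubini is applied on the whole plane to the extension of [f] by 0; the rows outside [A] then
   contribute 0. *)
have fi : L2.-integrable setT (EFin \o (f \_ (A `*` B))).
  by rewrite -restrict_EFin; apply/integrable_restrict => //; rewrite setTI; exact: integrable_square fM.
rewrite -[LHS](integral12_prod_meas1 fi); apply: eq_integral => x _.
rewrite /fubini_F patchE; case: ifPn => [|/negP]; rewrite inE => xA.
  have -> : (\int[lebesgue_measure]_y (EFin \o (f \_ (A `*` B))) (x, y) =
             \int[L1]_(y in B) (f (x, y))%:E)%E.
    rewrite [RHS]integral_mkcond; apply: eq_integral => y _ /=; rewrite !patchE.
    case: (boolP (y \in B)) => [|/negP]; rewrite inE => yB.
      by rewrite ifT// inE.
    by rewrite ifF//; apply/negP; rewrite inE => -[].
  rewrite fineK//; apply: integrable_fin_num => //.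
  apply: (@bounded_integrable _ _ (fun y => f (x, y)) M) => //.
    have -> : (fun y => f (x, y)) = f \o pair x by [].
    apply: (@measurable_comp _ _ _ _ _ _ (A `*` B : set plane)) => //.
      by move=> _ [y yB <-]; split.
    exact: measurable_funTS.
  by move=> y yB; apply: fM.
apply: integral0_eq => y _ /=; rewrite patchE ifF//.
by apply/negP; rewrite inE => -[].
Qed.

Lemma lambda2_area S : S `<=` square R -> measurable (S : set plane) ->
  L2 S = (area S)%:E.
Proof.
move=> Ss mS; rewrite /area -(Rintegral_prod (M := 1)) //; try exact: measurable_I01.
- rewrite /Rintegral integral_indic//; last exact: measurable_square.
  by rewrite setIidl// fineK// lambda2_fin.
- by move=> p _; have /andP[h0 h1] := ind01 S p; rewrite ger0_norm.
Qed.

(** Passing to the union of [S] and [T] makes the measure of the difference a difference of areas,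
    to which [step_le_area] applies. The 6 is 3 for each of two coordinates. *)
Lemma step_le_measure n S T : (0 < n)%N -> upset S -> upset T ->
  measurable (S : set plane) -> measurable (T : set plane) ->
  step_le n S T -> (L2 (S `\` T) <= (6 / n%:R)%:E)%E.
Proof.
move=> n0 uS uT mS mT ST.
have h := step_le_area n0 (upsetU uS uT) uT (step_leU n0 uT ST).
have mU : measurable (S `|` T : set plane) by exact: measurableU.
have mD : measurable (S `\` T : set plane) by exact: measurableD.
have uU := upsetU uS uT.
have E : L2 (S `|` T) = (L2 (S `\` T) + L2 T)%E.
  rewrite -measureU//; last by apply/seteqP; split => // p [[]].
  congr (L2 _); apply/seteqP; split => p [Sp|Tp]; try by [right|left; case: Sp].
  by have [Tp|nT] := pselect (T p); [right|left].
have fD : L2 (S `\` T) \is a fin_num.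
  by apply: lambda2_fin => // p [Sp _]; exact: uS.1.
rewrite -(fineK fD) lee_fin; move: E.
rewrite !lambda2_area//; try (exact: uU.1); try (exact: uT.1).
  by move=> [E] /=; rewrite E addrC lerD2l in h.
by move=> p [/uS.1].
Qed.

Lemma step_le_null S T : upset S -> upset T ->
  measurable (S : set plane) -> measurable (T : set plane) ->
  (forall n, (0 < n)%N -> step_le n S T) -> L2 (S `\` T) = 0%E.
Proof.
move=> uS uT mS mT H; have mD : measurable (S `\` T : set plane) by exact: measurableD.
have fD : L2 (S `\` T) \is a fin_num.
  by apply: lambda2_fin => // p [Sp _]; exact: uS.1.
apply/eqP; rewrite eq_le measure_ge0 andbT -(fineK fD) lee_fin leNgt; apply/negP => a0.
set a := fine _ in a0 *.
have [n] : exists n : nat, 6 / a < n%:R.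
  by exists (Num.truncn (6 / a)).+1; exact: truncnS_gt.
move=> an; have n0 : (0 < n)%N.
  by rewrite -(ltr0n R); apply: lt_trans an; rewrite divr_gt0.
have := step_le_measure n0 uS uT mS mT (H n n0).
rewrite -(fineK fD) lee_fin -/a leNgt => /negP; apply.
by rewrite ltr_pdivrMr ?ltr0n// mulrC -ltr_pdivrMr.
Qed.

(** The closed representative of an increasing set up to null sets. The edges are added because
    members of [C_T] must contain them. *)
Definition hull L := closure L `|` edges R.

(** The open quadrant strictly below [q] is a neighbourhood of [p], so it meets [L] if [p] is in the
    closure. If [p] is on an edge, no point of the square is strictly above it in both
    coordinates. *)
Lemma hull_lt L p q : upset L -> hull L p -> square R q -> p.1 < q.1 -> p.2 < q.2 -> L q.
Proof.
move=> [Ls iL] [cp|ep] sq p1 p2; last first.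
  have sp := edges_square ep; move/(edgesP sp): ep; move/squareP: sq => [? ?].
  by case => h; exfalso; lra.
have [] := cp [set z | z.1 < q.1 /\ z.2 < q.2].
  apply/nbhs_planeP; exists (Num.min (q.1 - p.1) (q.2 - p.2)).
    by rewrite lt_min !subr_gt0 p1.
  move=> z; rewrite !lt_min !ltr_distlC => /andP[/andP[? ?] _] /andP[_ /andP[? ?]] /=.
  by split; lra.
by move=> z [Lz [/ltW z1 /ltW z2]]; exact: iL z1 z2.
Qed.

Lemma closed_square : closed (square R).
Proof.
apply: compact_closed; first exact: norm_hausdorff.
by apply: compact_setX; exact: segment_compact.
Qed.

Lemma closed_edges : closed (edges R).
Proof.
by apply: closedU; apply: compact_closed; try exact: norm_hausdorff;
  apply: compact_setX; (exact: segment_compact || exact: compact_set1).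
Qed.

Lemma hull_upset L : upset L -> upset (hull L).
Proof.
move=> uL; have [Ls iL] := uL.
have cLs : closure L `<=` square R.
  by move=> p cp; apply: closed_square; apply: closureS Ls _ cp.
have Hs : hull L `<=` square R by move=> p [/cLs//|/edges_square].
split => // p q [cp|ep] sq p1 p2; last by right; exact: upset_edges.2 p1 p2.
left; move=> U /nbhs_planeP[e e0 eU].
have := cp [set z | `|p.1 - z.1| < e /\ `|p.2 - z.2| < e].
case; first by apply/nbhs_planeP; exists e.
move=> z [Lz [z1 z2]]; have sz := Ls _ Lz.
move/squareP: sz => [/andP[? ?] /andP[? ?]]; move/squareP: (sq) => [/andP[? ?] /andP[? ?]].
(* The coordinatewise maximum of [q] and [z] is above [z], hence in [L]. It is close to [q] because
   [z] is close to [p] and [p] is below [q]. *)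
exists (Num.max q.1 z.1, Num.max q.2 z.2); split.
  apply: (iL z) => //=; rewrite ?le_max ?lexx ?orbT//.
  by apply/squareP => /=; case: (leP q.1) => ?; case: (leP q.2) => ?; lra.
move: z1 z2; rewrite !ltr_distlC => /andP[z1 z2] /andP[z3 z4].
have H (a u v : R) : a <= u -> a - e < v -> v < a + e -> `|u - Num.max u v| < e.
  move=> au v1 v2; case: (leP u v) => uv; last by rewrite subrr normr0; lra.
  by rewrite ltr_distlC; apply/andP; split; lra.
by apply: (eU (Num.max q.1 z.1, Num.max q.2 z.2)) => /=; [apply: (H p.1)|apply: (H p.2)].
Qed.

Lemma closed_hull L : closed (hull L).
Proof. by apply: closedU; [exact: closed_closure|exact: closed_edges]. Qed.

Lemma sub_hull L : L `<=` hull L.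
Proof. by move=> p Lp; left; exact: subset_closure. Qed.

Lemma hull_dagger L : dagger L = L -> dagger (hull L) = hull L.
Proof.
have imp K : dagger K = K -> dagger (hull K) `<=` hull K.
  move=> dK p [cp|ep].
    left => U /nbhs_planeP[e e0 eU].
    have [|z [Kz Uz]] := cp [set z | U (z.2, z.1)].
      by apply/nbhs_planeP; exists e => // q q1 q2; apply: eU.
    by exists (z.2, z.1); split => //; rewrite -dK /dagger /= -surjective_pairing.
  by right; case: ep => -[? ?]; [right|left].
by move=> dL; apply/seteqP; split => [|p]; first exact: imp;
  move=> hp; apply: (imp _ dL); rewrite /dagger/= -surjective_pairing.
Qed.

Lemma hull_threshold L : upset L -> dagger L = L -> threshold_closed_sets R (hull L).
Proof.
move=> uL dL; have [h1 h2] := hull_upset uL; split => //; first exact: closed_hull.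
- exact: hull_dagger.
- by move=> p ep; right.
Qed.

(** From an interior point one can step diagonally down within the hull; [hull_lt] then leads back
    up into [L]. *)
Lemma hull_interior L : upset L -> (hull L)° `<=` L.
Proof.
move=> uL p /nbhs_planeP[e e0 eU].
have sp : square R p by apply: (hull_upset uL).1; apply: eU; rewrite subrr normr0.
apply: (hull_lt (p := (p.1 - e / 2, p.2 - e / 2))) => //=; try lra.
by apply: eU => /=; rewrite opprB addrC subrK ger0_norm; lra.
Qed.

Lemma threshold_upset S : threshold_closed_sets R S -> upset S.
Proof. by case. Qed.

Lemma threshold_measurable S : threshold_closed_sets R S -> measurable (S : set plane).
Proof. by case=> cS *; exact: closed_plane_measurable. Qed.

Lemma interior_lt S p q : upset S -> S p -> p.1 < q.1 < 1 -> p.2 < q.2 < 1 -> S° q.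
Proof.
move=> [Ss iS] Sp /andP[p1 q1] /andP[p2 q2]; apply/nbhs_planeP.
have /squareP[/andP[? ?] /andP[? ?]] := Ss _ Sp.
exists (Num.min (Num.min (q.1 - p.1) (q.2 - p.2)) (Num.min (1 - q.1) (1 - q.2))).
  by rewrite !lt_min !subr_gt0 p1 p2 q1.
move=> z; rewrite !lt_min !ltr_distlC.
move=> /andP[/andP[/andP[? ?] /andP[? ?]] /andP[/andP[? ?] /andP[? ?]]].
move=> /andP[/andP[/andP[? ?] /andP[? ?]] /andP[/andP[? ?] /andP[? ?]]].
by apply: (iS p) => //; [apply/squareP|..]; lra.
Qed.

Lemma interior_open_square S : S `<=` square R -> S° `<=` open_square R.
Proof.
move=> Ss p /nbhs_planeP[e e0 eU].
have /squareP[/= ? ?] : square R (p.1 - e / 2, p.2 - e / 2).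
  by apply: Ss; apply: eU => /=; rewrite opprB addrC subrK ger0_norm; lra.
have /squareP[/= ? ?] : square R (p.1 + e / 2, p.2 + e / 2).
  by apply: Ss; apply: eU => /=; rewrite opprD addrA subrr add0r normrN ger0_norm; lra.
by split; rewrite /= in_itv /=; lra.
Qed.

Lemma interior_increasing S : upset S -> increasing_set (open_square R) S°.
Proof.
move=> [Ss iS] p q /nbhs_planeP[e e0 eU] oq p1 p2.
move: oq => []; rewrite /= !in_itv /= => /andP[? ?] /andP[? ?].
apply: (@interior_lt S (p.1 - e / 2, p.2 - e / 2)) => //=; try (apply/andP; split; lra).
by apply: eU => /=; rewrite opprB addrC subrK ger0_norm; lra.
Qed.

(** A nonempty increasing open set is not increasing in the closed square, where the edge points
    above it are missing. Adding the edges, a null set, repairs this. *)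
Lemma interior_edges_upset S : increasing_set (open_square R) S -> S `<=` open_square R ->
  upset (S `|` edges R).
Proof.
move=> iS So.
have Ss : S `<=` square R.
  move=> p /So []; rewrite /= !in_itv /= => ? ?; apply/squareP; lra.
split => [p [/Ss//|/edges_square//]|p q [Sp|ep] sq p1 p2]; last first.
  by right; exact: upset_edges.2 p1 p2.
have [h|h] := pselect (edges R q); [by right|left].
apply: (iS p) => //; move: (So _ Sp) => []; rewrite /= !in_itv /= => ? ?.
move/squareP: (sq) => [? ?].
have q1 : q.1 != 1 by apply/eqP => E; apply/h/(edgesP sq); left.
have q2 : q.2 != 1 by apply/eqP => E; apply/h/(edgesP sq); right.
have q3 : q.1 < 1 by rewrite lt_neqAle q1; lra.
have q4 : q.2 < 1 by rewrite lt_neqAle q2; lra.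
by split; rewrite /= in_itv /=; lra.
Qed.

(** A diagonal shift of a point of [S] that stays below the edges lands in the interior. Hence
    [step_le] holds from [S] to its interior with the edges at every scale, and the edges are
    null. *)
Lemma boundary_null S : threshold_closed_sets R S -> L2 (S `\` S°) = 0%E.
Proof.
move=> cS; have uS := threshold_upset cS; have mS := threshold_measurable cS.
have uT := interior_edges_upset (interior_increasing uS) (interior_open_square uS.1).
have mi : measurable (S° : set plane) by apply: open_plane_measurable; exact: open_interior.
have mT : measurable (S° `|` edges R : set plane) by apply: measurableU => //; exact: measurable_edges.
have h : L2 (S `\` (S° `|` edges R)) = 0%E.
  apply: step_le_null => // n n0 x y x0 x1 y0 y1 Sxy; left.
  have nV : 0 < n%:R^-1 :> R by rewrite invr_gt0 ltr0n.
  by apply: interior_lt Sxy _ _ => //=; lra.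
have mD : measurable (S `\` (S° `|` edges R) : set plane) by exact: measurableD.
apply/eqP; rewrite eq_le measure_ge0 andbT.
apply: (@le_trans _ _ (L2 ((S `\` (S° `|` edges R)) `|` edges R))).
  apply: le_measure; rewrite ?inE//; first exact: measurableD.
    by apply: measurableU => //; exact: measurable_edges.
  by move=> p [Sp np]; have [e|e] := pselect (edges R p); [right|left; split => // -[]].
by apply: le_trans (lambda2_leU _ _) _ => //; [exact: measurable_edges|rewrite h lambda2_edges adde0].
Qed.

(** The difference lies in the boundary of the hull. It is only called negligible because [L] need
    not be Borel: an increasing set may be arbitrary on an antidiagonal. *)
Lemma negligible_hull L : upset L -> dagger L = L -> L2.-negligible (hull L `\` L).
Proof.
move=> uL dL; have h := hull_threshold uL dL.
exists (hull L `\` (hull L)°); split.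
- apply: measurableD; first exact: threshold_measurable.
  by apply: open_plane_measurable; exact: open_interior.
- exact: boundary_null.
- by move=> p [hp nL]; split => // /(hull_interior uL).
Qed.

(** Off the edges, the points shifted by 1/n lie in [T] and tend to [p], so closedness of [T]
    concludes. On the edges no shift fits into the square, but there [T] contains everything. *)
Lemma step_le_closed_sub S T : threshold_closed_sets R S -> threshold_closed_sets R T ->
  (forall n, (0 < n)%N -> step_le n S T) -> S `<=` T.
Proof.
move=> cS cT ST p Sp; have [ct Ts dT iT eT] := cT.
have sp := (threshold_upset cS).1 _ Sp.
have [ep|ne] := pselect (edges R p); first exact: eT.
have /squareP[? ?] := sp.
have p1 : p.1 < 1.
  by rewrite lt_neqAle; apply/andP; split; [apply/eqP => E; apply/ne/(edgesP sp); left|lra].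
have p2 : p.2 < 1.
  by rewrite lt_neqAle; apply/andP; split; [apply/eqP => E; apply/ne/(edgesP sp); right|lra].
rewrite closure_id in ct; rewrite ct => U /nbhs_planeP[e e0 eU].
pose m := Num.min e (Num.min (1 - p.1) (1 - p.2)).
have m0 : 0 < m by rewrite !lt_min e0 !subr_gt0 p1.
have mm : m <= e /\ m <= 1 - p.1 /\ m <= 1 - p.2.
  by rewrite /m !ge_min !lexx !orbT.
pose n := (Num.truncn m^-1).+1.
have nm : n%:R^-1 < m.
  rewrite invf_plt ?posrE ?ltr0n//; exact: truncnS_gt.
exists (p.1 + n%:R^-1, p.2 + n%:R^-1); split.
  by apply: (ST n) => //; [lra|lra|lra|lra|rewrite -surjective_pairing].
have nV : 0 < n%:R^-1 :> R by rewrite invr_gt0 ltr0n.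
by apply: eU => /=; rewrite opprD addrA subrr add0r normrN ger0_norm; lra.
Qed.

End UpperSets.

(** * Homeomorphisms and distance topologies *)

Section Topology.
Context (R : realType).
Implicit Types (X Y Z : topologicalType).

Lemma separated_hausdorff X :
  (forall x y : X, x <> y -> exists2 f : X -> R, continuous f & f x <> f y) ->
  hausdorff_space X.
Proof.
move=> sep p q pq; apply: contrapT => /sep[f cf]; apply.
apply: (@Rhausdorff R) => A B nA nB.
have [z [Az Bz]] := pq _ _ (cf p A nA) (cf q B nB).
by exists (f z).
Qed.

Lemma continuous_initial X (S : choiceType) Y (f : S -> Y)
    (g : X -> initial_topology f) :
  continuous (f \o g : X -> Y) -> continuous g.
Proof. by move=> /continuousP fg; apply/continuousP => _ [B oB <-]; exact: fg. Qed.

Lemma continuous_ptws X (J : choiceType) (h : X -> {ptws J -> R}) :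
  (forall j, continuous (fun x => h x j)) -> continuous h.
Proof.
move=> H x; apply/cvg_sup => j W /= [_ [[B oB <-] /= Bx] BW].
by apply: filterS BW _; apply: (H j x); exact: open_nbhs_nbhs.
Qed.

Lemma homeomorphism_compact X Y (f : X -> Y) : compact [set: X] ->
  hausdorff_space Y -> continuous f -> bijective f -> homeomorphism f.
Proof.
move=> cX hY cf [g fK gK]; exists g; split => //.
apply/continuous_closedP => A cA; rewrite (_ : g @^-1` A = f @` A).
  apply: (compact_closed hY); apply: continuous_compact; last exact: subclosed_compact cA cX _.
  exact: continuous_subspaceT.
apply/seteqP; split => [y /= Agy|_ [x Ax <-]]; last by rewrite /= fK.
by exists (g y); rewrite ?gK.
Qed.

Lemma homeomorphism_inv X Y (f : X -> Y) (g : Y -> X) :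
  homeomorphism f -> cancel f g -> homeomorphism g.
Proof.
move=> [g' [fK gK cf cg]] fK'; exists f; split => //.
  by move=> y; rewrite -{1}(gK y) fK' gK.
by rewrite (_ : g = g')//; apply/funext => y; rewrite -{1}(gK y) fK'.
Qed.

Lemma homeomorphism_comp X Y Z (f : X -> Y) (h : Y -> Z) :
  homeomorphism f -> homeomorphism h -> homeomorphism (h \o f).
Proof.
move=> [g [fK gK cf cg]] [k [hK kK ch ck]]; exists (g \o k); split.
- by move=> x /=; rewrite hK.
- by move=> x /=; rewrite gK.
- by move=> x; apply: (@continuous_comp _ _ _ f h); [exact: cf|exact: ch].
- by move=> x; apply: (@continuous_comp _ _ _ k g); [exact: ck|exact: cg].
Qed.

Lemma homeomorphism_open X Y (f : X -> Y) (A : set Y) : homeomorphism f ->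
  open A <-> open (f @^-1` A).
Proof.
move=> [g [fK gK /continuousP cf /continuousP cg]]; split => [/cf//|/cg].
by rewrite -comp_preimage (_ : f \o g = id)//; apply/funext => y /=.
Qed.

(** Any two of the spaces are compared through a common source [H], which below is the space of
    closed sets with the measure distance; [h] is then [g] after the inverse of [f]. *)
Lemma homeomorphism_factor (H : topologicalType) X Y (f : H -> X) (g : H -> Y) (h : X -> Y) :
  homeomorphism f -> homeomorphism g -> (forall x, h (f x) = g x) -> homeomorphism h.
Proof.
move=> [f' [fK f'K cf cf']] hg hf; have -> : h = g \o f'.
  by apply/funext => x /=; rewrite -hf f'K.
by apply: homeomorphism_comp hg; exists f.
Qed.

Lemma homeomorphism_compactT X Y (f : X -> Y) : homeomorphism f ->
  compact [set: X] -> compact [set: Y].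
Proof.
move=> [g [fK gK cf cg]] cX; rewrite (_ : [set: Y] = f @` setT).
  by apply: continuous_compact => //; exact: continuous_subspaceT.
by apply/seteqP; split => // y _; exists (g y).
Qed.

Section DistSpace.
Context (T : choiceType) (d : T -> T -> R).

Lemma dist_space_openE : @open (dist_space d) = dist_open d.
Proof. by []. Qed.

(** The topology is given by its open sets, so that balls are neighbourhoods has to come from the
    triangle inequality. *)
Lemma dist_space_nbhs (x : dist_space d) U : is_metric d ->
  nbhs x U <-> exists2 e : R, 0 < e & forall y, d x y < e -> U y.
Proof.
move=> [d0 dE dC dT]; split=> [|[e e0 eU]].
  rewrite nbhsE => -[B [oB Bx] BU].
  by have [e e0 eB] := oB x Bx; exists e => // y /eB; exact: BU.
rewrite nbhsE; exists [set y | d x y < e]; last exact: eU.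
split; last by rewrite /= (dE x x).2.
move=> y /= xy; exists (e - d x y); first by rewrite subr_gt0.
by move=> z yz /=; apply: le_lt_trans (dT x y z) _; lra.
Qed.

Lemma dist_space_hausdorff : is_metric d -> hausdorff_space (dist_space d).
Proof.
move=> dm; have [d0 dE dC dT] := dm; apply: separated_hausdorff => x y xy; exists (d x).
  move=> z U /nbhs_ballP[e e0 eU]; apply/(dist_space_nbhs _ _ dm).
  exists e => // t zt; apply: eU; rewrite /ball /= ltr_norml.
  have := dT x z t; have := dT x t z; rewrite (dC t z) => h1 h2.
  by apply/andP; split; lra.
by rewrite (dE x x).2// => /esym/dE.
Qed.

End DistSpace.

Lemma dist_space_homeomorphism (T : choiceType) (d : T -> T -> R) X (f : dist_space d -> X) : homeomorphism f ->
  is_metric d -> compact [set: dist_space d] -> compact_metrizable R X.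
Proof.
move=> hf [d0 dE dC dT] cd; split; first exact: homeomorphism_compactT hf cd.
have [g [fK gK _ _]] := hf.
exists (fun x y => d (g x) (g y)); split.
  by split => // x y; split => [/dE/(can_inj gK)//|->]; exact/dE.
apply/seteqP; split => A.
  move=> /(homeomorphism_open _ hf) oA x Ax.
  have [|e e0 eA] := oA (g x); first by rewrite /= gK.
  by exists e => // y /eA; rewrite /= gK.
move=> oA; apply/(homeomorphism_open _ hf); rewrite dist_space_openE => x Ax.
have [e e0 eA] := oA _ Ax; exists e => // y xy.
by apply: eA; rewrite !fK.
Qed.

Lemma dist_space_isometry (T : choiceType) (d : T -> T -> R) (T' : choiceType) (d' : T' -> T' -> R) (f : T -> T') :
  bijective f -> (forall x y, d' (f x) (f y) = d x y) -> is_metric d ->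
  is_metric d' /\ homeomorphism (f : dist_space d -> dist_space d').
Proof.
move=> [g fK gK] df dm; have [d0 dE dC dT] := dm.
have dg x y : d (g x) (g y) = d' x y by rewrite -df !gK.
have dm' : is_metric d'.
  split.
  - by move=> x y; rewrite -dg.
  - by move=> x y; rewrite -dg; split => [/dE/(can_inj gK)//|->]; exact/dE.
  - by move=> x y; rewrite -!dg.
  - by move=> x y z; rewrite -!dg.
split => //; exists g; split => // x U.
  move=> /(dist_space_nbhs _ _ dm')[e e0 eU]; apply/(dist_space_nbhs _ _ dm).
  by exists e => // y xy; apply: eU; rewrite df.
move=> /(dist_space_nbhs _ _ dm)[e e0 eU]; apply/(dist_space_nbhs _ _ dm').
by exists e => // y xy; apply: eU; rewrite dg.
Qed.

Lemma dist_space_le_continuous (T : choiceType) (d : T -> T -> R) (T' : choiceType) (d' : T' -> T' -> R) (f : T -> T') :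
  is_metric d -> is_metric d' -> (forall x (e : R), 0 < e ->
    exists2 a : R, 0 < a & forall y, d x y < a -> d' (f x) (f y) < e) ->
  continuous (f : dist_space d -> dist_space d').
Proof.
move=> dm dm' H x U /(dist_space_nbhs _ _ dm')[e e0 eU]; apply/(dist_space_nbhs _ _ dm).
by have [a a0 ha] := H x e e0; exists a => // y /ha; exact: eU.
Qed.

Lemma fell_continuous X Y (A : set (set Y)) (f : X -> fell_space A) :
  (forall U, open U -> open (f @^-1` (fell_hit (A := A) U))) ->
  (forall K, compact K -> open (f @^-1` (fell_miss (A := A) K))) -> continuous f.
Proof.
move=> hit miss; apply/continuousP => _ [D DA <-].
rewrite preimage_bigcup; apply: bigcup_open => _ /DA[E ED <-].
rewrite preimage_bigcap; rewrite bigcap_fset.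
rewrite big_seq; elim/big_ind: _ => [|B C oB oC|B /ED]; [exact: openT|exact: openI|].
by rewrite inE => -[[U oU <-]|[K cK <-]]; [exact: hit|exact: miss].
Qed.

End Topology.

(** * The measure distance *)

Section ClosedSets.
Context (R : realType).
Local Notation L2 := (lambda2 R).
Local Notation plane := (measurableTypeR R * measurableTypeR R)%type.
Implicit Types (S T L : set (R * R)) (p q : R * R) (n k : nat).

Lemma archi_div_lt (a e : R) : 0 <= a -> 0 < e -> exists2 n, (0 < n)%N & a / n%:R < e.
Proof.
move=> a0 e0; exists (Num.truncn (a / e)).+1 => //.
rewrite ltr_pdivrMr ?ltr0n// mulrC -ltr_pdivrMr//; exact: truncnS_gt.
Qed.

Lemma lambda2_leS S T : measurable (S : set plane) -> measurable (T : set plane) ->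
  S `<=` T -> (L2 S <= L2 T)%E.
Proof. by move=> mS mT ST; apply: le_measure => //; rewrite inE. Qed.

Definition meas_sub S := S `<=` square R /\ measurable (S : set plane).

Lemma meas_sub_symdiff S T : meas_sub S -> meas_sub T -> meas_sub (S `+` T).
Proof.
move=> [Ss mS] [Ts mT]; split => [p [[/Ss]|[/Ts]]//|].
by apply: measurableU; exact: measurableD.
Qed.

Lemma threshold_meas_sub S : threshold_closed_sets R S -> meas_sub S.
Proof.
by move=> cS; split; [exact: (threshold_upset cS).1|exact: threshold_measurable].
Qed.

Lemma measure_dist_ge0 S T : 0 <= measure_dist S T.
Proof. by rewrite fine_ge0. Qed.

Lemma measure_distC S T : measure_dist S T = measure_dist T S.
Proof. by rewrite /measure_dist setYC. Qed.

Lemma measure_distE S T : meas_sub S -> meas_sub T -> (measure_dist S T)%:E = L2 (S `+` T).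
Proof.
move=> hS hT; have [h1 h2] := meas_sub_symdiff hS hT.
by rewrite /measure_dist fineK// lambda2_fin.
Qed.

Lemma measure_dist_triangle S T U : meas_sub S -> meas_sub T -> meas_sub U ->
  measure_dist S U <= measure_dist S T + measure_dist T U.
Proof.
move=> hS hT hU; rewrite -lee_fin EFinD !measure_distE//.
have [_ m1] := meas_sub_symdiff hS hT; have [_ m2] := meas_sub_symdiff hT hU.
have [_ m3] := meas_sub_symdiff hS hU.
apply: le_trans (lambda2_leU m1 m2); apply: lambda2_leS => //.
  exact: measurableU.
move=> p [[Sp Up]|[Up Sp]].
  by have [Tp|Tp] := pselect (T p); [right; left|left; left].
by have [Tp|Tp] := pselect (T p); [left; right|right; right].
Qed.

Lemma measure_dist_step_le n S T : (0 < n)%N -> upset S -> upset T ->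
  meas_sub S -> meas_sub T -> measure_dist S T < n%:R^-2 -> step_le n S T /\ step_le n T S.
Proof.
move=> n0 uS uT hS hT; rewrite -lte_fin measure_distE// => lt.
have [_ m] := meas_sub_symdiff hS hT; have [_ mS] := hS; have [_ mT] := hT.
split; apply: measure_step_le => //; apply: le_lt_trans lt; apply: lambda2_leS => //;
  try exact: measurableD; move=> p hp; by [left|right].
Qed.

(** The 12 is the 6 of [step_le_measure], once for each half of the symmetric difference. *)
Lemma step_le_measure_dist n S T : (0 < n)%N -> upset S -> upset T ->
  meas_sub S -> meas_sub T -> step_le n S T -> step_le n T S -> measure_dist S T <= 12 / n%:R.
Proof.
move=> n0 uS uT hS hT ST TS; rewrite -lee_fin measure_distE//.
have [_ mS] := hS; have [_ mT] := hT.
apply: le_trans (lambda2_leU _ _) _; try exact: measurableD.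
have -> : 12 / n%:R = 6 / n%:R + 6 / n%:R :> R by rewrite -mulrDl; congr (_ / _); lra.
by rewrite EFinD leeD// step_le_measure.
Qed.

Definition mk_closed S (h : threshold_closed_sets R S) : C_T R := SigSub (mem_set h).

Lemma C_T_P (S : C_T R) : threshold_closed_sets R (set_val S).
Proof. exact: set_valP. Qed.
Hint Resolve C_T_P : core.

Lemma C_T_upset (S : C_T R) : upset (set_val S).
Proof. exact: threshold_upset. Qed.
Hint Resolve C_T_upset : core.

Lemma C_T_meas (S : C_T R) : meas_sub (set_val S).
Proof. exact: threshold_meas_sub. Qed.
Hint Resolve C_T_meas : core.

Lemma C_T_inj (S T : C_T R) : set_val S = set_val T -> S = T.
Proof. by move=> ST; apply: val_inj. Qed.

Lemma step_le_C_T_eq (S T : C_T R) :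
  (forall n, (0 < n)%N -> step_le n (set_val S) (set_val T) /\ step_le n (set_val T) (set_val S)) ->
  S = T.
Proof.
move=> H; apply: C_T_inj; apply/seteqP.
by split; apply: step_le_closed_sub => // n /H[].
Qed.

Lemma measure_C_metric : is_metric (@measure_C R).
Proof.
split.
- by move=> S T; exact: measure_dist_ge0.
- move=> S T; split=> [E|->]; last by rewrite /measure_C /measure_dist setYK measure0.
  apply: step_le_C_T_eq => n n0; apply: measure_dist_step_le => //.
  rewrite -/(measure_C S T) E; by rewrite invr_gt0 exprn_gt0// ltr0n.
- by move=> S T; exact: measure_distC.
- by move=> S T U; exact: measure_dist_triangle.
Qed.

(** The witness is the first multiple of 1/n strictly above [x]; the strictness is what [hull_lt]
    asks for. *)
Lemma grid_above n (x : R) : (0 < n)%N -> 0 <= x -> x + n%:R^-1 < 1 ->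
  exists i : 'I_n.+1, x < i%:R / n%:R /\ i%:R / n%:R <= x + n%:R^-1.
Proof.
move=> n0 x0 x1; have n0R : 0 < n%:R :> R by rewrite ltr0n.
have nx0 : 0 <= n%:R * x by rewrite mulr_ge0.
have /andP[t1 t2] := truncn_itv nx0.
have h : (Num.truncn (n%:R * x)).+1%:R / n%:R <= x + n%:R^-1.
  by rewrite ler_pdivrMr// mulrDl mulVf ?gt_eqF// -natr1 lerD2r (mulrC x).
have lt : ((Num.truncn (n%:R * x)).+1 < n.+1)%N.
  rewrite ltnS -(ler_nat R) -[leRHS]mul1r -ler_pdivrMr//.
  by apply: le_trans h (ltW x1).
exists (Ordinal lt); split => //=.
by rewrite ltr_pdivlMr// mulrC.
Qed.

Definition grid_agree n S T := forall i j : 'I_n.+1,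
  S (i%:R / n%:R, j%:R / n%:R) <-> T (i%:R / n%:R, j%:R / n%:R).

Lemma grid_square n (i j : 'I_n.+1) : square R (i%:R / n%:R, j%:R / n%:R).
Proof. by split => /=; apply: grid_I01; rewrite -ltnS. Qed.

(** A grid point lies between [(x, y)] and its shift. Membership is carried up to it, exchanged
    between the two sets there, and carried up again. In [hull L] the first move is strict and so
    lands in [L] itself. *)
Lemma grid_agree_step_le n S L : (0 < n)%N -> upset S -> upset L -> grid_agree n S L ->
  step_le n S (hull L) /\ step_le n (hull L) S.
Proof.
move=> n0 uS uL SL; split => x y x0 x1 y0 y1 h;
  have [i [xi ix]] := grid_above n0 x0 x1; have [j [yj jy]] := grid_above n0 y0 y1;
  have nV : 0 < n%:R^-1 :> R by [rewrite invr_gt0 ltr0n];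
  have sq := @grid_square n i j; have sq' : square R (x + n%:R^-1, y + n%:R^-1)
    by [apply/squareP => /=; lra].
- apply: ((hull_upset uL).2 (i%:R / n%:R, j%:R / n%:R) _ _ sq' ix jy); apply: sub_hull; apply/SL.
  by apply: (uS.2 (x, y)) => //=; exact: ltW.
- apply: (uS.2 (i%:R / n%:R, j%:R / n%:R) _ _ sq' ix jy); apply/SL.
  exact: hull_lt h sq xi yj.
Qed.

(* An ultrafilter on the closed sets converges to the hull of the set of points
   that belong to almost every member, because it decides the finitely many grid
   points that control the measure distance up to [12/n]. *)
Lemma C_measure_compact : compact [set: C_measure R].
Proof.
rewrite compact_ultra => F UF _.
pose L q := F [set S : C_T R | set_val S q].
have FF : ProperFilter F by exact: ultra_proper.
have uL : upset L.
  split=> [q /filter_ex[S /= Sq]|p q Lp sq p1 p2]; first exact: (C_T_upset S).1.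
  by apply: filterS Lp => S /= Sp; exact: (C_T_upset S).2 p1 p2.
have dL : dagger L = L.
  apply/seteqP; split => q; apply: filterS => S /= Sq; have [_ _ dS _ _] := C_T_P S;
    by rewrite -dS /dagger /= -?surjective_pairing.
exists (mk_closed (hull_threshold uL dL)); split => // U.
move=> /(dist_space_nbhs _ _ measure_C_metric)[e e0 eU].
have [n n0 ne] := archi_div_lt (ler0n R 12) e0.
have FG : F [set S : C_T R | grid_agree n (set_val S) L].
  apply: filter_forall => i; apply: filter_forall => j.
  set q := (_, _).
  have [Lq|nLq] := in_ultra_setVsetC [set S : C_T R | set_val S q] UF.
    by apply: filterS (Lq) => S Sq.
  apply: filterS (nLq) => S nSq; split => // Lq; exfalso.
  by have [S' []] := filter_ex (filterI nLq Lq).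
rewrite nbhs_filterE; apply: filterS FG => S SL; apply: eU.
have [SL1 SL2] := grid_agree_step_le n0 (C_T_upset S) uL SL.
by apply: le_lt_trans ne; apply: step_le_measure_dist.
Qed.

(** * Homomorphism densities of increasing sets *)

Lemma density_fun_mono (F : graph) S : upset S ->
  cube_mono (fun x : (nvert F).-tuple R =>
    \prod_(i < nvert F) \prod_(j < nvert F | (i < j)%N && adj i j)
      \1_S (tnth x i, tnth x j)).
Proof.
move=> uS; split => [t _|t u tI uI tu].
  apply/andP; split.
    apply: prodr_ge0 => i _; apply: prodr_ge0 => j _.
    by have /andP[] := ind01 S (tnth t i, tnth t j).
  by apply: prodr_ile1 => i _; apply/andP; split; [apply: prodr_ge0|apply: prodr_ile1] => j _;
    have /andP[h1 h2] := ind01 S (tnth t i, tnth t j); rewrite ?h1.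
apply: ler_prod => i _; apply/andP; split.
  by apply: prodr_ge0 => j _; have /andP[] := ind01 S (tnth t i, tnth t j).
apply: ler_prod => j _; apply/andP; split.
  by have /andP[] := ind01 S (tnth t i, tnth t j).
by apply: upset_ind_mono => //=; split => /=.
Qed.

(** Shifting all coordinates by 1/n takes the factor of every edge from [S] to [T], so
    [cube_integral_shift] applies with 3/n for each vertex. *)
Lemma step_le_density n (F : graph) S T : (0 < n)%N -> upset S -> upset T -> step_le n S T ->
  graphon_density F (\1_S : R * R -> R) <=
  graphon_density F (\1_T : R * R -> R) + 3 * (nvert F)%:R / n%:R.
Proof.
move=> n0 uS uT ST; apply: cube_integral_shift => //; try exact: density_fun_mono.
move=> t t' tI t'I tt'; apply: ler_prod => i _; apply/andP; split.
  by apply: prodr_ge0 => j _; have /andP[] := ind01 S (tnth t i, tnth t j).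
apply: ler_prod => j _; apply/andP; split.
  by have /andP[] := ind01 S (tnth t i, tnth t j).
have [E1 h1] := tt' i; have [E2 h2] := tt' j.
rewrite !indicE; case: (boolP (_ \in S)) => [|_]; last by case: (_ \in T); rewrite ?ler01.
rewrite inE => St; suff -> : (tnth t' i, tnth t' j) \in T by [].
rewrite inE E1 E2; apply: ST => //; rewrite -?E1 -?E2//.
  by have /I01P/andP[] := tI i.
by have /I01P/andP[] := tI j.
Qed.

Lemma step_le_density_eq (F : graph) S T : upset S -> upset T ->
  (forall n, (0 < n)%N -> step_le n S T /\ step_le n T S) ->
  graphon_density F (\1_S : R * R -> R) = graphon_density F (\1_T : R * R -> R).
Proof.
have H S' T' : upset S' -> upset T' -> (forall n, (0 < n)%N -> step_le n S' T') ->
    graphon_density F (\1_S' : R * R -> R) <= graphon_density F (\1_T' : R * R -> R).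
  move=> uS uT ST; apply/ler_addgt0Pr => e e0.
  have [n n0 ne] := @archi_div_lt (3 * (nvert F)%:R) e (mulr_ge0 (ler0n _ _) (ler0n _ _)) e0.
  apply: le_trans (step_le_density F n0 uS uT (ST n n0)) _.
  by rewrite lerD2l ltW.
by move=> uS uT ST; apply/eqP; rewrite eq_le !H// => n /ST[].
Qed.

(** * Closed and open increasing sets *)

Lemma dagger_interior S : dagger S = S -> dagger S° = S°.
Proof.
have imp T : dagger T = T -> dagger T° `<=` T°.
  move=> dT p /nbhs_planeP[e e0 eU]; apply/nbhs_planeP; exists e => // q q1 q2.
  by rewrite -dT; apply: eU.
move=> dS; apply/seteqP; split => [|p]; first exact: imp.
by move=> hp; apply: (imp _ dS); rewrite /dagger/= -surjective_pairing.
Qed.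

Lemma interior_threshold S : threshold_closed_sets R S -> threshold_open_sets R S°.
Proof.
move=> cS; have uS := threshold_upset cS; have [_ _ dS _ _] := cS; split.
- exact: open_interior.
- exact: interior_open_square uS.1.
- exact: dagger_interior.
- exact: interior_increasing.
Qed.

Definition mk_open (S : set (R * R)) (h : threshold_open_sets R S) : O_T R :=
  SigSub (mem_set h).

Definition closed_to_open (S : C_T R) : O_T R := mk_open (interior_threshold (C_T_P S)).

Lemma inj_surj_bij (A B : Type) (f : A -> B) : injective f ->
  (forall y, exists x, f x = y) -> bijective f.
Proof.
move=> fI fS; pose g y := projT1 (cid (fS y)).
have gK : cancel g f by move=> y; rewrite /g; case: cid.
by exists g => // x; apply: fI; rewrite gK.
Qed.

Lemma negligible_C_T_eq (S T : C_T R) : L2.-negligible (set_val S `\` set_val T) ->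
  L2.-negligible (set_val T `\` set_val S) -> S = T.
Proof.
by move=> h1 h2; apply: step_le_C_T_eq => n n0; split; apply: negligible_step_le.
Qed.

Lemma negligible_boundary (S : C_T R) : L2.-negligible (set_val S `\` (set_val S)°).
Proof.
have [_ mS] := C_T_meas S; exists (set_val S `\` (set_val S)°); split => //.
  by apply: measurableD => //; apply: open_plane_measurable; exact: open_interior.
exact: boundary_null.
Qed.

(** Two sets with the same interior differ only within their boundaries, which are null, and members
    of [C_T] equal up to null sets coincide. *)
Lemma closed_to_open_inj : injective closed_to_open.
Proof.
move=> S T E; have {}E : (set_val S)° = (set_val T)° by move/(congr1 set_val): E.
apply: negligible_C_T_eq.
  apply: negligibleS (negligible_boundary S) => p [Sp nT]; split => // iS.
  by apply: nT; apply: (@interior_subset _ (set_val T)); rewrite -E.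
apply: negligibleS (negligible_boundary T) => p [Sp nT]; split => // iS.
by apply: nT; apply: (@interior_subset _ (set_val S)); rewrite E.
Qed.

Lemma open_square_edges p : open_square R p -> ~ edges R p.
Proof.
move=> [/=]; rewrite !in_itv /= => /andP[? ?] /andP[? ?] [[_ h]|[h _]]; move: h => /= ?; lra.
Qed.

(** The preimage of [O] is the hull of [O] with the edges. By [hull_interior] its interior adds at
    most edge points to [O], and an open subset of the square contains none. *)
Lemma closed_to_open_bij : bijective closed_to_open.
Proof.
apply: inj_surj_bij => [|O]; first exact: closed_to_open_inj.
have [oO sO dO iO] : threshold_open_sets R (set_val O) := set_valP O.
have uL := interior_edges_upset iO sO.
have dL : dagger (set_val O `|` edges R) = set_val O `|` edges R.
  have dE : dagger (edges R) = edges R.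
    by apply/seteqP; split => p [[? ?]|[? ?]]; by [right|left].
  rewrite -{2}dO -{2}dE; by apply/seteqP; split => p.
exists (mk_closed (hull_threshold uL dL)); apply: val_inj => /=.
apply/seteqP; split => p.
  move=> ip; have := hull_interior uL ip => -[//|].
  by move/open_square_edges: (interior_open_square (hull_upset uL).1 ip).
move=> Op; apply: (@filterS _ _ _ (set_val O)); last exact: open_nbhs_nbhs.
by move=> q Oq; apply: sub_hull; left.
Qed.

Lemma interior_meas_sub (S : C_T R) : meas_sub (set_val S)°.
Proof.
split; first exact: subset_trans (@interior_subset _ _) (C_T_upset S).1.
by apply: open_plane_measurable; exact: open_interior.
Qed.

Lemma measure_dist_interior (S : C_T R) : measure_dist (set_val S) (set_val S)° = 0.
Proof.
rewrite /measure_dist /setY (_ : (set_val S)° `\` set_val S = set0); last first.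
  by apply/seteqP; split => // p [/interior_subset].
by rewrite setU0 boundary_null.
Qed.

Lemma measure_closed_to_open (S T : C_T R) :
  measure_O (closed_to_open S) (closed_to_open T) = measure_C S T.
Proof.
rewrite /measure_O /measure_C /=.
have mS := C_T_meas S; have mT := C_T_meas T.
have iS := interior_meas_sub S; have iT := interior_meas_sub T.
have h1 := measure_dist_interior S; have h2 := measure_dist_interior T.
have h3 := measure_dist_triangle iS mS iT; have h4 := measure_dist_triangle mS mT iT.
have h5 := measure_dist_triangle mS iS mT; have h6 := measure_dist_triangle iS iT mT.
rewrite (measure_distC _ (set_val S)) in h3; rewrite (measure_distC _ (set_val T)) in h6.
apply/eqP; rewrite eq_le; apply/andP; split.
  by apply: le_trans h3 _; rewrite h1 add0r; apply: le_trans h4 _; rewrite h2 addr0.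
apply: le_trans h5 _; rewrite h1 add0r measure_distC; apply: le_trans h6 _.
by rewrite (measure_distC _ (set_val T)) h2 addr0.
Qed.

End ClosedSets.

(** * 0-1 valued functions modulo null sets *)

Section AlmostEverywhere.
Context d (T : measurableType d) (R : realType) (mu : {measure set T -> \bar R}).
Implicit Types (D : set T) (f g : T -> \bar R).
Import HBNNSimple.
Local Open Scope ereal_scope.

(* The integral of a function that need not be measurable is a difference of
   lower integrals, each of which ignores null sets. *)
Lemma ge0_negligible_le_integral D f g : (forall x, D x -> 0 <= f x) ->
  (forall x, D x -> 0 <= g x) -> mu.-negligible [set x | D x /\ f x <> g x] ->
  \int[mu]_(x in D) f x <= \int[mu]_(x in D) g x.
Proof.
move=> f0 g0 [N [mN N0 fgN]]; rewrite (ge0_integralE mu f0) (ge0_integralE mu g0).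
apply: ge_ereal_sup => _ [h hf <-].
pose k : {nnsfun T >-> R} := mul_nnsfun h (indic_nnsfun R (measurableC mN)).
have -> : sintegral mu h = sintegral mu k.
  have E (s : {nnsfun T >-> R}) : sintegral mu s = \int[mu]_x (s x)%:E.
    by rewrite integral_nnsfun// patch_setT.
  rewrite !E; apply: ge0_ae_eq_integral => //.
  - by apply/measurable_EFinP; exact: measurable_funPT.
  - by apply/measurable_EFinP; exact: measurable_funPT.
  - by move=> x _; rewrite lee_fin.
  - by move=> x _; rewrite lee_fin.
  - exists N; split => // x /= hx; apply: contrapT => nN; apply: hx => _.
    by rewrite /= mindicE mem_set// mulr1.
apply: ereal_sup_ubound; exists k => // x /=; rewrite mindicE.
have [Nx|nNx] := pselect (N x).
  rewrite memNset ?mulr0; last by move=> /(_ Nx).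
  by rewrite patchE; case: ifPn => //; rewrite inE; exact: g0.
rewrite mem_set// mulr1; apply: le_trans (hf x) _; rewrite !patchE; case: ifPn => //.
rewrite inE => Dx; suff -> : f x = g x by [].
by apply: contrapT => fg; apply/nNx/fgN.
Qed.

Lemma ge0_negligible_eq_integral D f g : (forall x, D x -> 0 <= f x) ->
  (forall x, D x -> 0 <= g x) -> mu.-negligible [set x | D x /\ f x <> g x] ->
  \int[mu]_(x in D) f x = \int[mu]_(x in D) g x.
Proof.
move=> f0 g0 fg; apply/eqP; rewrite eq_le !ge0_negligible_le_integral//.
by apply: negligibleS fg => x [Dx ne]; split => // e; apply: ne.
Qed.

Lemma negligible_eq_integral D f g : mu.-negligible [set x | D x /\ f x <> g x] ->
  \int[mu]_(x in D) f x = \int[mu]_(x in D) g x.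
Proof.
move=> fg; rewrite [LHS]integralE [RHS]integralE; congr (_ - _);
  apply: ge0_negligible_eq_integral => //; apply: negligibleS fg => x [Dx ne];
  split => // e; apply: ne; by rewrite ?funeposE ?funenegE e.
Qed.

End AlmostEverywhere.

Section ThresholdFunctions.
Context (R : realType).
Local Notation L2 := (lambda2 R).
Implicit Types (S T L : set (R * R)) (W V : R * R -> R) (p q : R * R) (n k : nat).
Hint Resolve C_T_P C_T_upset C_T_meas : core.

Lemma class_ofP W V : class_of W = class_of V <->
  L2.-negligible [set p | square R p /\ W p <> V p].
Proof.
have aeP : ae_eq_square W V <-> L2.-negligible [set p | square R p /\ W p <> V p].
  split => [/asboolP h|h]; [|apply/asboolP]; apply: negligibleS h => p.
    by move=> [sp ne] /= /(_ sp).
  by move=> /= h; apply: contrapT => nn; apply: h => sp; apply: contrapT => ne; exact: nn.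
rewrite -aeP; split => [/eqmodP//|h]; exact/eqmodP.
Qed.

(** The chosen representative is an arbitrary function, possibly not measurable; this is all that is
    known of it. *)
Lemma repr_class W : L2.-negligible [set p | square R p /\ repr (class_of W) p <> W p].
Proof. by apply/class_ofP; rewrite /class_of reprK. Qed.

Definition upset_of W := [set p | square R p /\ W p = 1].

Lemma upset_of_upset W : threshold_function W -> upset (upset_of W).
Proof.
move=> [W01 Ws Wm]; split => [p []//|p q [sp Wp] sq p1 p2]; split => //.
by have := Wm _ _ sp sq p1 p2; case: (W01 _ sq) => ->//; rewrite Wp ler10.
Qed.

Lemma upset_of_dagger W : threshold_function W -> dagger (upset_of W) = upset_of W.
Proof.
move=> [W01 Ws Wm]; apply/seteqP; split => -[x y] [] [xI yI] /= Wxy;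
  have sxy : square R (x, y) by [split].
  by split => //; rewrite Ws.
by split; [split|rewrite /= -Ws].
Qed.

Lemma upset_of_ind W p : threshold_function W -> square R p -> W p = \1_(upset_of W) p.
Proof.
move=> [W01 Ws Wm] sp; rewrite indicE; case: (boolP (_ \in _)) => [|/negP]; rewrite inE.
  by case.
by move=> h; case: (W01 _ sp) => // Wp; exfalso; apply: h.
Qed.

Lemma ind_threshold S : upset S -> dagger S = S -> threshold_function (\1_S : R * R -> R).
Proof.
move=> uS dS; split => [p _|x y _|p q sp sq p1 p2]; last exact: upset_ind_mono.
  by rewrite indicE; case: (_ \in _); [right|left].
rewrite !indicE; congr (_%:R); congr nat_of_bool.
by apply/idP/idP; rewrite !inE -{1}dS.
Qed.

Lemma C_T_threshold (S : C_T R) : threshold_function (\1_(set_val S) : R * R -> R).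
Proof. by apply: ind_threshold => //; case: (C_T_P S). Qed.

Definition mk_W (c : fun_class R) (h : threshold_functions R c) : W_T R := SigSub (mem_set h).

Lemma closed_class (S : C_T R) : threshold_functions R (class_of \1_(set_val S)).
Proof. by exists (\1_(set_val S)) => //; exact: C_T_threshold. Qed.

Definition closed_to_fun (S : C_T R) : W_T R := mk_W (closed_class S).

Lemma negligible_ind S T : S `<=` square R -> T `<=` square R ->
  L2.-negligible [set p | square R p /\ (\1_S p : R) <> \1_T p] <->
  L2.-negligible (S `\` T) /\ L2.-negligible (T `\` S).
Proof.
move=> Ss Ts; split => [h|[h1 h2]].
  split; apply: negligibleS h => p [Sp Tp]; (split; first by [exact: Ss|exact: Ts]);
    rewrite !indicE (mem_set Sp) (memNset Tp) => /eqP.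
    by rewrite oner_eq0.
  by rewrite eq_sym oner_eq0.
apply: negligibleS (negligibleU h1 h2) => p [sp ne].
have [Sp|Sp] := pselect (S p); have [Tp|Tp] := pselect (T p); try by [left|right].
  by exfalso; apply: ne; rewrite !indicE !mem_set.
by exfalso; apply: ne; rewrite !indicE !memNset.
Qed.

Lemma closed_to_fun_inj : injective closed_to_fun.
Proof.
move=> S T /(congr1 set_val)/class_ofP/negligible_ind[].
- exact: (C_T_upset S).1.
- exact: (C_T_upset T).1.
- exact: negligible_C_T_eq.
Qed.

Lemma class_hull W (tW : threshold_function W) :
  class_of W = class_of \1_(hull (upset_of W)).
Proof.
have uW := upset_of_upset tW; have dW := upset_of_dagger tW.
apply/class_ofP; apply: negligibleS (negligible_hull uW dW) => p [sp ne].
have nL : ~ upset_of W p.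
  move=> Lp; apply: ne; rewrite (upset_of_ind tW sp) !indicE !mem_set//.
  exact: sub_hull.
split => //; apply: contrapT => nH; apply: ne.
by rewrite (upset_of_ind tW sp) !indicE !memNset.
Qed.

Definition closed_of_fun W (tW : threshold_function W) : C_T R :=
  mk_closed (hull_threshold (upset_of_upset tW) (upset_of_dagger tW)).

Lemma closed_to_fun_bij : bijective closed_to_fun.
Proof.
apply: inj_surj_bij => [|w]; first exact: closed_to_fun_inj.
have [W tW Ww] := set_valP w.
exists (closed_of_fun tW); apply: val_inj => /=.
by rewrite -class_hull // Ww.
Qed.

Lemma open_class (O : O_T R) : threshold_functions R (class_of \1_(set_val O)).
Proof.
have [g fK gK] := closed_to_open_bij R; rewrite -(gK O) /=.
exists (\1_(set_val (g O))); first exact: C_T_threshold.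
apply/class_ofP/negligible_ind.
- exact: (C_T_upset _).1.
- exact: subset_trans (@interior_subset _ _) (C_T_upset _).1.
split; first exact: negligible_boundary.
by rewrite (_ : _ `\` _ = set0); [exact: negligible_set0|apply/seteqP; split => // p [/interior_subset]].
Qed.

Definition open_to_fun (O : O_T R) : W_T R := mk_W (open_class O).

Lemma closed_open_fun (S : C_T R) : closed_to_fun S = open_to_fun (closed_to_open S).
Proof.
apply: val_inj => /=; apply/class_ofP/negligible_ind.
- exact: (C_T_upset _).1.
- exact: subset_trans (@interior_subset _ _) (C_T_upset _).1.
split; first exact: negligible_boundary.
by rewrite (_ : _ `\` _ = set0); [exact: negligible_set0|apply/seteqP; split => // p [/interior_subset]].
Qed.

Lemma graphon_density_eq F W V : (forall p, square R p -> W p = V p) ->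
  graphon_density F W = graphon_density F V.
Proof.
move=> WV; apply: cube_integral_eq => t tI; apply: eq_bigr => i _; apply: eq_bigr => j _.
by apply: WV; split; exact: tI.
Qed.

(** Equality almost everywhere in the plane is first turned into [step_le] at every scale. That
    controls the iterated integrals directly, with no null sets in the cube to discuss. *)
Lemma graphon_limit_fun (S : C_T R) W : threshold_function W ->
  class_of W = class_of \1_(set_val S) -> graphon_limit W = graphon_limit \1_(set_val S).
Proof.
move=> tW WS; congr (_, _); apply/funext => F.
have uW := upset_of_upset tW.
rewrite (@graphon_density_eq _ W \1_(upset_of W)); last by move=> p; exact: upset_of_ind.
apply: step_le_density_eq => // n n0.
have /negligible_ind[] : L2.-negligible
    [set p | square R p /\ (\1_(upset_of W) p : R) <> \1_(set_val S) p].
- move/class_ofP: WS; apply: negligibleS => p [sp ne]; split => //.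
  by rewrite (upset_of_ind tW sp).
- exact: uW.1.
- exact: (C_T_upset S).1.
by move=> h1 h2; split; apply: negligible_step_le.
Qed.

Lemma l1_dist_ind S T : meas_sub S -> meas_sub T -> l1_dist (\1_S) (\1_T) = measure_dist S T.
Proof.
move=> hS hT; have [sD mD] := meas_sub_symdiff hS hT.
have -> : l1_dist \1_S \1_T = \int[L2]_(p in square R) \1_(S `+` T) p.
  apply: eq_Rintegral => p _; rewrite !indicE.
  have [Sp|Sp] := pselect (S p); have [Tp|Tp] := pselect (T p).
  - by rewrite (mem_set Sp) (mem_set Tp) memNset ?subrr ?normr0// => -[[]|[]].
  - by rewrite (mem_set Sp) (memNset Tp) mem_set ?subr0 ?normr1//; left.
  - by rewrite (memNset Sp) (mem_set Tp) mem_set ?sub0r ?normrN ?normr1//; right.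
  - by rewrite (memNset Sp) (memNset Tp) memNset ?subrr ?normr0// => -[[]|[]].
rewrite /Rintegral integral_indic//; last exact: measurable_square.
by rewrite setIidl.
Qed.

Lemma l1_closed_to_fun (S T : C_T R) :
  l1_W (closed_to_fun S) (closed_to_fun T) = measure_C S T.
Proof.
rewrite /measure_C -l1_dist_ind// /l1_W /l1_dist /Rintegral; congr fine.
apply: negligible_eq_integral.
apply: negligibleS (negligibleU (repr_class \1_(set_val S)) (repr_class \1_(set_val T))).
move=> p [sp ne]; apply: contrapT => nn; apply: ne => /=.
have -> : repr (class_of \1_(set_val S)) p = \1_(set_val S) p.
  by apply: contrapT => h; apply: nn; left.
have -> // : repr (class_of \1_(set_val T)) p = \1_(set_val T) p.
by apply: contrapT => h; apply: nn; right.
Qed.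

End ThresholdFunctions.

(** * Laws of functions on the unit interval *)

Section Law.
Context (R : realType).
Local Notation I := (I01 R).
Local Notation L1 := (lambda1 R).
Local Notation mR := (measurableTypeR R).
Implicit Types (S T : C_T R) (X : R -> R) (mu nu : prob01 R) (p q : R * R) (n k : nat).
Local Hint Resolve measurable_I01 : core.
Local Hint Resolve C_T_P C_T_upset C_T_meas : core.

Section LawOf.
Context X (mX : measurable_fun (I : set mR) X) (XI : forall x, I x -> I (X x)).

(* Off [I01] the map takes the value -1, so that the preimage of a subset of
   [I01] stays within [I01] and the infinite measure [lambda1] is harmless. *)
Definition law_map : mR -> mR := fun x => ((fun z => X z + 1) \_ I) x - 1.

Lemma law_mapE x : I x -> law_map x = X x.
Proof. by move=> xI; rewrite /law_map patchE mem_set// addrK. Qed.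

Lemma law_map_out x : ~ I x -> law_map x = -1.
Proof. by move=> xI; rewrite /law_map patchE memNset// sub0r. Qed.

Lemma measurable_law_map : @measurable_fun _ _ mR mR setT law_map.
Proof.
apply: measurable_funB; last exact: measurable_cst.
by apply/(measurable_restrictT _ _).1; [exact: measurable_I01|apply: measurable_funD].
Qed.

Lemma law_map_preimage (A : set R) : A `<=` I -> law_map @^-1` A = I `&` X @^-1` A.
Proof.
move=> AI; apply/seteqP; split => x /=; last by move=> [xI]; rewrite law_mapE.
have [xI|xI] := pselect (I x); first by rewrite law_mapE.
by rewrite law_map_out// => /AI/I01P/andP[]; rewrite lerNr oppr0 ler10.
Qed.

Let unif : probability mR R := uniform_prob (@ltr01 R).

Let unifE (A : set mR) : measurable A -> A `<=` I -> unif A = L1 A.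
Proof.
move=> mA AI; have := @integral_uniform R 0 1 ltr01 (EFin \o \1_A).
rewrite integral_indic// setIT => ->; last first.
- by move=> x; rewrite lee_fin.
- by apply/measurable_EFinP; exact: measurable_indic.
by rewrite subr0 invr1 mul1e integral_indic// setIidl.
Qed.

Definition law_mfun : {mfun mR >-> mR} :=
  HB.pack law_map (isMeasurableFun.Build _ _ _ _ _ measurable_law_map).

Definition law : probability mR R := distribution unif law_mfun.

Lemma lawE (A : set mR) : measurable A -> A `<=` I -> law A = L1 (I `&` X @^-1` A).
Proof.
move=> mA AI; rewrite -law_map_preimage//; apply: unifE.
  by rewrite -[_ @^-1` _]setTI; exact: measurable_law_map.
by rewrite law_map_preimage//; exact: subIsetl.
Qed.

Lemma law_I01 : law I = 1%E.
Proof. by rewrite lawE// setIidl ?lambda1_I01. Qed.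

Lemma integral_law (f : R -> R) (M : R) : measurable_fun (I : set mR) f ->
  (forall x, I x -> `|f x| <= M) ->
  (\int[law]_(s in I) (f s)%:E = \int[L1]_(x in I) (f (X x))%:E)%E.
Proof.
move=> mf fM.
transitivity (\int[law]_(s in I) ((f \_ I) s)%:E)%E.
  by apply: eq_integral => s sI; rewrite patchE sI.
have pI : law_map @^-1` I = I by rewrite law_map_preimage// setIidl.
have mfI : measurable_fun (setT : set mR) (f \_ I).
  by apply/(measurable_restrictT _ _).1; [exact: measurable_I01|exact: mf].
rewrite (integral_pushforward (f := EFin \o (f \_ I)) measurable_law_map)//.
- rewrite pI (eq_measure_integral L1); last by move=> A mA AI; exact: unifE.
  by apply: eq_integral => x; rewrite inE => xI /=; rewrite law_mapE// patchE mem_set//; exact: XI.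
- exact/measurable_EFinP.
- rewrite pI; apply: (@measurable_bounded_integrable _ _ _ unif) => //.
  + by apply: (@le_lt_trans _ _ 1%E); [apply: (@probability_le1 _ _ _ unif)|rewrite ltry].
  + by apply: measurableT_comp => //; exact: measurable_funTS measurable_law_map.
  + exists M; split; first exact: num_real.
    move=> x Mx y yI /=; apply: le_trans (ltW Mx).
    by rewrite law_mapE// patchE mem_set//; [apply: fM; exact: XI|exact: XI].
Qed.

End LawOf.

Definition mk_prob (P : probability mR R) (h : P I = 1%E) : prob01 R :=
  \pi_(prob01 R)%qT (SigSub (mem_set h : P \in [set mu : probability mR R | mu I = 1%E]) : prob01_rep R).

(** The representative of the class agrees with [P] on Borel sets only. *)
Lemma mk_probE (P : probability mR R) (h : P I = 1%E) (A : set mR) : measurable A ->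
  mk_prob h A = P A.
Proof.
move=> mA; rewrite /mk_prob /prob01_measure.
have /eqmodP/asboolP H := reprK (\pi_(prob01 R)%qT (SigSub (mem_set h : P \in [set mu : probability mR R | mu I = 1%E]) : prob01_rep R)).
by rewrite H.
Qed.

Lemma prob01_eqP mu nu : (forall A : set mR, measurable A -> mu A = nu A) -> mu = nu.
Proof.
move=> H; rewrite -(reprK mu) -(reprK nu); apply/eqmodP/asboolP => A mA; exact: H.
Qed.

Lemma prob01_I01 mu : mu I = 1%E.
Proof. exact: (set_valP (repr mu)). Qed.

End Law.

(** * Degree distributions and the sets S_mu *)

Section Degree.
Context (R : realType).
Local Notation I := (I01 R).
Local Notation L1 := (lambda1 R).
Local Notation mR := (measurableTypeR R).
Implicit Types (S T : C_T R) (mu nu : prob01 R) (p q : R * R) (n k : nat).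
Local Hint Resolve measurable_I01 : core.
Local Hint Resolve C_T_P C_T_upset C_T_meas : core.

Definition degree (S : set (R * R)) (x : R) : R := \int[L1]_(y in I) \1_S (x, y).

Lemma section_mono01 (S : set (R * R)) x : upset S -> I x -> mono01 (fun y => \1_S (x, y) : R).
Proof.
move=> uS xI; split => [y _|y z yI zI yz]; first exact: ind01.
by apply: upset_ind_mono => //=; split.
Qed.

Lemma degree_mono01 (S : set (R * R)) : upset S -> mono01 (degree S).
Proof.
move=> uS; split => [x xI|x y xI yI xy]; first exact/mono01_integral/section_mono01.
apply: mono01_le_integral; try exact: section_mono01.
by move=> z zI; apply: upset_ind_mono => //=; split.
Qed.

Lemma degree_I01 (S : set (R * R)) x : upset S -> I x -> I (degree S x).
Proof. by move=> uS xI; apply/I01P/(degree_mono01 uS).1. Qed.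

Lemma measurable_degree (S : set (R * R)) : upset S -> measurable_fun (I : set mR) (degree S).
Proof. by move=> uS; apply: measurable_nondecreasing_I01; exact: (degree_mono01 uS).2. Qed.

Lemma integral_upper_interval (y : R) : I y -> \int[L1]_(z in I) \1_(`[y, 1]) z = 1 - y.
Proof.
move=> /I01P/andP[y0 y1]; rewrite /Rintegral integral_indic//.
rewrite setIidl ?lambda1_itv//.
by move=> z /=; rewrite in_itv /= => /andP[yz z1]; apply/I01P; rewrite z1 (le_trans y0).
Qed.

Lemma upper_interval_mono01 (y : R) : mono01 (fun z => \1_(`[y, 1]) z : R).
Proof.
split => [z _|z w zI /I01P/andP[_ w1] zw].
  by rewrite indicE; case: (_ \in _); rewrite ?lexx ?ler01.
rewrite !indicE; case: (boolP (z \in _)) => [|_]; last by case: (_ \in _); rewrite ?lexx ?ler01.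
rewrite inE /= in_itv /= => /andP[yz _]; rewrite mem_set//= in_itv/= w1 andbT.
exact: le_trans zw.
Qed.

(** The section of [S] at [x] contains [y,1]. *)
Lemma degree_ge (S : set (R * R)) x y : upset S -> S (x, y) -> 1 - y <= degree S x.
Proof.
move=> uS Sxy; have [xI yI] := uS.1 _ Sxy.
rewrite -(integral_upper_interval yI); apply: mono01_le_integral.
- exact: upper_interval_mono01.
- exact: section_mono01.
move=> z zI; rewrite indicE; case: (boolP (z \in _)) => [|_]; last by have /andP[] := ind01 S (x, z).
rewrite inE /= in_itv /= => /andP[yz _]; rewrite indicE mem_set//.
by apply: (uS.2 (x, y)) => //=; split.
Qed.

Lemma degree_le (S : set (R * R)) x y : upset S -> I x -> I y -> ~ S (x, y) ->
  degree S x <= 1 - y.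
Proof.
move=> uS xI yI nS; rewrite -(integral_upper_interval yI); apply: mono01_le_integral.
- exact: section_mono01.
- exact: upper_interval_mono01.
move=> z zI; rewrite !indicE; case: (boolP ((x, z) \in S)) => [|_]; last by case: (_ \in _).
rewrite inE => Sz; rewrite mem_set//= in_itv /=; move/I01P: (zI) => /andP[_ ->]; rewrite andbT.
rewrite leNgt; apply/negP => zy; apply: nS; apply: (uS.2 (x, z)) => //=.
exact: ltW.
Qed.

(** The complement of [S] is open and contains no edge point, so one can move up a little without
    entering [S] or reaching an edge. This turns weak inequalities into strict ones below. *)
Lemma not_closed_right S (x y : R) : I x -> I y -> ~ set_val S (x, y) ->
  exists2 e : R, 0 < e & [/\ x + e < 1, y + e < 1 & ~ set_val S (x + e, y + e)].
Proof.
move=> xI yI nS; have [cS Ss _ _ eS] := C_T_P S.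
have sxy : square R (x, y) by split.
have /nbhs_planeP[e e0 eU] : nbhs (x, y) (~` set_val S).
  by apply: open_nbhs_nbhs; split => //; exact: closed_openC.
have [x1 y1] : x < 1 /\ y < 1.
  move/I01P: xI => /andP[_ x1]; move/I01P: yI => /andP[_ y1]; rewrite !lt_neqAle x1 y1 !andbT.
  by split; apply/eqP => E; apply/nS/eS/(edgesP sxy); [left|right].
pose d := Num.min (e / 2) (Num.min ((1 - x) / 2) ((1 - y) / 2)).
have d0 : 0 < d by rewrite !lt_min !divr_gt0// subr_gt0.
have : d <= e / 2 /\ d <= (1 - x) / 2 /\ d <= (1 - y) / 2 by rewrite /d !ge_min !lexx !orbT.
move=> [d1 [d2 d3]]; exists d => //; split; [lra|lra|].
by apply: eU => /=; rewrite opprD addrA subrr add0r normrN ger0_norm; lra.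
Qed.

(** Strictness comes from closedness: if [S] misses [(x, y)], it also misses a slightly higher point
    [(x, y + e)], so the section has length at most 1 - y - e. *)
Lemma degree_lt S (x y : R) : I x -> I y -> degree (set_val S) x < 1 - y <-> ~ set_val S (x, y).
Proof.
move=> xI yI; split => [lt Sxy|nS].
  by have := degree_ge (C_T_upset S) Sxy; rewrite leNgt lt.
have [e e0 [x1 y1 nS']] := not_closed_right xI yI nS.
move/I01P: (xI) => /andP[x0 _]; move/I01P: (yI) => /andP[y0 _].
have y'I : I (y + e) by apply/I01P; apply/andP; split; lra.
apply: (@le_lt_trans _ _ (1 - (y + e))); last by lra.
apply: degree_le => // Sx; apply: nS'; apply: ((C_T_upset S).2 (x, y + e)) => //=; last by lra.
by apply/squareP => /=; lra.
Qed.

Definition degree_law S : prob01 R :=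
  mk_prob (law_I01 (measurable_degree (C_T_upset S)) (fun x => @degree_I01 _ x (C_T_upset S))).

Lemma degree_lawE S (A : set mR) : measurable A -> A `<=` I ->
  degree_law S A = L1 (I `&` degree (set_val S) @^-1` A).
Proof.
move=> mA AI; by rewrite mk_probE// lawE.
Qed.

Lemma integral_degree_law S (f : R -> R) (M : R) : measurable_fun (I : set mR) f ->
  (forall x, I x -> `|f x| <= M) ->
  \int[degree_law S]_(s in I) f s = \int[L1]_(x in I) f (degree (set_val S) x).
Proof.
move=> mf fM; rewrite /Rintegral; congr fine.
have XI x : I x -> I (degree (set_val S) x) by exact: degree_I01.
rewrite -(integral_law (measurable_degree (C_T_upset S)) XI mf fM).
by apply: eq_measure_integral => A mA _; exact: mk_probE.
Qed.

(** By [degree_lt], the mass of [0,1-y) is the length of the set of [z] with [(z, y)] outside [S].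
    This is an initial interval, so [x] is at least its length exactly when [(x, y)] is in [S],
    closedness settling the endpoint. *)
Lemma S_degree_law S : S_ (degree_law S) = set_val S.
Proof.
have [cS Ss _ _ eS] := C_T_P S.
apply/seteqP; suff H p : square R p ->
    (fine (degree_law S `[0%R, 1 - p.2[%classic) <= p.1 <-> set_val S p).
  by split => p; [move=> [sp /(H _ sp)]|move=> Sp; split; [exact: Ss|exact/H/Sp/Ss]].
case: p => x y [xI yI] /=.
move/I01P: (xI) => /= /andP[x0 x1]; move/I01P: (yI) => /= /andP[y0 y1].
have AI : `[0, 1 - y[%classic `<=` I.
  by move=> z /=; rewrite in_itv /= => /andP[z0 zy]; apply/I01P; apply/andP; split; lra.
rewrite degree_lawE//.
have E : I `&` degree (set_val S) @^-1` `[0, 1 - y[ = [set z | I z /\ ~ set_val S (z, y)].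
  apply/seteqP; split => z [zI] /=; rewrite in_itv /=.
    by move=> /andP[_ /(degree_lt _ zI yI)].
  move=> nS; split => //; apply/andP; split; last exact/degree_lt.
  by have /I01P/andP[] := degree_I01 (C_T_upset S) zI.
have mE : measurable (I `&` degree (set_val S) @^-1` `[0, 1 - y[ : set mR).
  by apply: (measurable_degree (C_T_upset S)); [exact: measurable_I01|exact: measurable_itv].
rewrite {}E in mE *.
have fE : L1 [set z | I z /\ ~ set_val S (z, y)] \is a fin_num.
  rewrite ge0_fin_numE//; apply: (@le_lt_trans _ _ (L1 I)); last by rewrite lambda1_I01 ltry.
  by apply: le_measure; rewrite ?inE// => z [].
rewrite -lee_fin fineK//; split => [le|Sxy].
  (* If [S] misses [(x, y)], it also misses [(x + e, y)], so the interval has length at least x +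
     e. *)
  apply: contrapT => nS; have [e e0 [/= xe1 ye1 nS']] := not_closed_right xI yI nS.
  have nS2 : ~ set_val S (x + e, y).
    move=> Sx; apply: nS'; apply: ((C_T_upset S).2 (x + e, y)) => //=; last by lra.
    by apply/squareP => /=; lra.
  have : (L1 `[0%R, (x + e)%R]%classic <= x%:E)%E.
    apply: le_trans le; apply: le_measure; rewrite ?inE//.
    move=> z /=; rewrite in_itv /= => /andP[z0 zx]; split; first by apply/I01P; apply/andP; split; lra.
    move=> Sz; apply: nS2; apply: ((C_T_upset S).2 (z, y)) => //=.
    by apply/squareP => /=; lra.
  by rewrite lambda1_itv ?addr_ge0 ?(ltW e0)// lee_fin; lra.
have h : (L1 `[0%R, x[%classic <= x%:E)%E by rewrite lambda1_itv// subr0.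
apply: le_trans h.
apply: le_measure; rewrite ?inE//.
move=> z [/I01P/andP[z0 z1] nS] /=; rewrite in_itv /= z0 /= ltNge; apply/negP => xz.
apply: nS; apply: ((C_T_upset S).2 (x, y)) => //=; apply/squareP => /=; lra.
Qed.

(** * Recovering a measure from its set *)

Definition cdf_lt mu (t : R) : R := fine (mu `[0%R, t[%classic).

Lemma prob01_fin mu (A : set mR) : measurable A -> mu A \is a fin_num.
Proof. by move=> mA; rewrite fin_num_measure. Qed.

Lemma prob01_le mu (A B : set mR) : measurable A -> measurable B -> A `<=` B ->
  fine (mu A) <= fine (mu B).
Proof.
move=> mA mB AB; rewrite fine_le ?prob01_fin//.
by apply: le_measure => //; rewrite inE.
Qed.

Lemma cdf_lt_le mu s t : s <= t -> cdf_lt mu s <= cdf_lt mu t.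
Proof.
move=> st; apply: prob01_le; try exact: measurable_itv.
by apply: subset_itvl; rewrite bnd_simp.
Qed.

Lemma cdf_lt01 mu t : 0 <= cdf_lt mu t <= 1.
Proof.
rewrite fine_ge0//= -lee_fin fineK; last by rewrite prob01_fin//; exact: measurable_itv.
by apply: probability_le1; exact: measurable_itv.
Qed.

(** Left continuity: [0,t) is the increasing union of the intervals [0,t-1/n). *)
Lemma cdf_lt_left mu (t x : R) : x < cdf_lt mu t -> exists2 s, s < t & x < cdf_lt mu s.
Proof.
move=> xt; have mI (s : R) : measurable (`[0%R, s[ : set mR) by exact: measurable_itv.
have E : `[0%R, t[%classic = \bigcup_n (`[0%R, t - n.+1%:R^-1[%classic : set mR).
  apply/seteqP; split => [z /=|z [n _] /=]; rewrite !in_itv /= => /andP[z0 zt].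
    have tz : 0 < t - z by rewrite subr_gt0.
    have [[//|n] _] := archi_div_lt ler01 tz; rewrite div1r => nt.
    by exists n => //=; rewrite in_itv /= z0 /= ltrBrDr -ltrBrDl.
  rewrite z0 /=; apply: lt_trans zt _.
  by rewrite ltrBlDr ltrDl invr_gt0.
have cv : (mu \o (fun n => `[0%R, t - n.+1%:R^-1[%classic : set mR)) @ \oo --> mu `[0%R, t[%classic.
  rewrite E; apply: nondecreasing_cvg_mu => //.
    by apply: bigcup_measurable => n _.
  move=> n m nm; apply/subsetPset; apply: subset_itvl; rewrite bnd_simp.
  by rewrite lerD2l lerN2 lef_pV2 ?posrE ?ltr0n// ler_nat.
apply: contrapT => H.
have : (mu `[0%R, t[%classic <= x%:E)%E.
  apply: cvge_le cv; apply: nearW => n /=.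
  rewrite -[leLHS]fineK ?prob01_fin// lee_fin leNgt; apply/negP => lt; apply: H.
  by exists (t - n.+1%:R^-1) => //; rewrite ltrBlDr ltrDl invr_gt0.
by rewrite -[leLHS]fineK ?prob01_fin// lee_fin leNgt => /negP; apply.
Qed.

Lemma S_upset mu : upset (S_ mu).
Proof.
split => [p []//|p q [sp h] sq p1 p2]; split => //.
apply: le_trans p1; apply: le_trans h; apply: cdf_lt_le; lra.
Qed.

(** If the defining inequality fails at [p], left continuity makes it fail already with some [s]
    below 1 - p.2 in its place, and this strict failure persists in a neighbourhood of [p]. *)
Lemma S_closed mu : closed (S_ mu).
Proof.
move=> p cp; have sp : square R p.
  by apply: closed_square; apply: closureS cp; exact: (S_upset mu).1.
split => //; rewrite leNgt; apply/negP => /cdf_lt_left[s st ps].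
have [] := cp [set q | q.1 < cdf_lt mu s /\ s < 1 - q.2].
  apply/nbhs_planeP; exists (Num.min (cdf_lt mu s - p.1) (1 - p.2 - s)).
    by rewrite lt_min !subr_gt0 ps.
  move=> q; rewrite !lt_min !ltr_distlC => /andP[/andP[? ?] _] /andP[_ /andP[? ?]] /=.
  by split; lra.
move=> q [[sq h] [q1 /ltW/(cdf_lt_le mu) q2]].
by have := lt_le_trans q1 (le_trans q2 h); rewrite ltxx.
Qed.

Lemma S_threshold (mu : P_s R) : threshold_closed_sets R (S_ (set_val mu)).
Proof.
have uS := S_upset (set_val mu); split.
- exact: S_closed.
- exact: uS.1.
- exact/esym/(set_valP mu).
- exact: uS.2.
- move=> p ep; have sp := edges_square ep; split => //.
  move/(edgesP sp): ep => [->|->]; first by have /andP[] := cdf_lt01 (set_val mu) (1 - p.2).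
  rewrite subrr set_itv_ge ?bnd_simp ?ltxx// measure0.
  by move/squareP: sp => [/andP[]].
Qed.

Lemma prob01_setI mu (A : set mR) : measurable A -> mu A = mu (A `&` I).
Proof.
move=> mA; apply: etrans (measureDI mu mA (@measurable_I01 R)) _.
apply: etrans (add0e _); congr (_ + _)%E.
apply/eqP; rewrite eq_le measure_ge0 andbT.
have <- : mu (~` I) = 0%E by rewrite probability_setC// [X in (_ - X)%E]prob01_I01 subee.
apply: (le_measure mu); [rewrite inE; exact: measurableD|rewrite inE; exact: measurableC|by move=> z []].
Qed.

Lemma prob01_cdf_eq mu nu : (forall t, 0 <= t <= 1 -> cdf_lt mu t = cdf_lt nu t) -> mu = nu.
Proof.
move=> H; apply: prob01_eqP => A mA.
apply: (@measure_unique _ R mR (@RGenInftyO.G R) (fun n => `]-oo, n%:R[%classic) _ _ _ _ mu nu _ _ A mA) => //.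
- exact: RGenInftyO.measurableE.
- move=> _ _ [x ->] [y ->]; exists (Num.min x y).
  by apply/seteqP; split => z /=; rewrite !in_itv /= lt_min;
    [by move=> [-> ->]|by move=> /andP[-> ->]].
- by move=> n; exists n%:R.
- apply/seteqP; split => // x _; exists (Num.truncn `|x|).+1 => //=.
  by rewrite in_itv /=; apply: le_lt_trans (ler_norm x) _; exact: truncnS_gt.
- move=> _ [t ->].
  suff E : mu (`]-oo, t[ `&` I) = nu (`]-oo, t[ `&` I).
    have mt : measurable (`]-oo, t[%classic : set mR) by exact: measurable_itv.
    exact: etrans (prob01_setI mu mt) (etrans E (esym (prob01_setI nu mt))).
  have [t0|t0] := leP t 0.
    rewrite (_ : _ `&` I = set0) ?measure0//; apply/seteqP; split => // z [] /=.
    by rewrite in_itv /= => zt /I01P/andP[z0 _]; have := lt_le_trans zt t0; rewrite ltNge z0.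
  have [t1|t1] := leP t 1.
    rewrite (_ : _ `&` I = `[0, t[%classic); last first.
      apply/seteqP; split => z /=; rewrite !in_itv /=.
        by move=> [zt /I01P/andP[z0 _]]; rewrite z0.
      move=> /andP[z0 zt]; split => //; apply/I01P; rewrite z0 /=.
      by apply: ltW; exact: lt_le_trans t1.
    rewrite -[LHS]fineK ?prob01_fin// -[RHS]fineK ?prob01_fin//; congr EFin.
    by apply: H; rewrite (ltW t0).
  rewrite (_ : _ `&` I = I) ?prob01_I01//; apply/seteqP; split => z; first by case.
  by move=> /[dup] /I01P/andP[_ z1] zI; split => //=; rewrite in_itv /=; exact: le_lt_trans z1 t1.
- by move=> k; rewrite ltey_eq fin_num_measure//; exact: measurable_itv.
Qed.

(** The leftmost point of the set of [mu] at height 1 - t has abscissa [cdf_lt mu t]. Its membership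
    in the other set is an inequality between the two distribution functions, and the roles can be
    exchanged. *)
Lemma S_inj mu nu : S_ mu = S_ nu -> mu = nu.
Proof.
have le la ka : S_ la = S_ ka -> forall t, 0 <= t <= 1 -> cdf_lt ka t <= cdf_lt la t.
  move=> E t t01; have : S_ la (cdf_lt la t, 1 - t).
    split; last by rewrite /= subKr.
    by apply/squareP => /=; split; [exact: cdf_lt01|lra].
  by rewrite E => -[_] /=; rewrite subKr.
by move=> E; apply: prob01_cdf_eq => t t01; apply/eqP; rewrite eq_le !le.
Qed.

Lemma degree_law_dagger S : dagger_symmetric R (degree_law S).
Proof. by rewrite /dagger_symmetric /is_dagger /= S_degree_law; have [_ _ -> _ _] := C_T_P S. Qed.

Definition closed_to_prob S : P_s R := SigSub (mem_set (degree_law_dagger S)).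

Definition prob_to_closed (mu : P_s R) : C_T R := mk_closed (S_threshold mu).

Lemma closed_to_probK : cancel closed_to_prob prob_to_closed.
Proof. by move=> S; apply: C_T_inj; exact: S_degree_law. Qed.

Lemma prob_to_closedK : cancel prob_to_closed closed_to_prob.
Proof. by move=> mu; apply: val_inj; apply: S_inj; exact: S_degree_law. Qed.

End Degree.

(** * Moments and weak convergence *)

Section Moments.
Context (R : realType).
Local Notation I := (I01 R).
Local Notation L1 := (lambda1 R).
Local Notation L2 := (lambda2 R).
Local Notation mR := (measurableTypeR R).
Local Notation plane := (mR * mR)%type.
Implicit Types (S T : C_T R) (mu nu : prob01 R) (p q : R * R) (n k : nat).
Local Hint Resolve measurable_I01 : core.
Local Hint Resolve C_T_P C_T_upset C_T_meas : core.

Lemma prob01_integrable mu (f : R -> R) (M : R) : measurable_fun (I : set mR) f ->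
  (forall x, I x -> `|f x| <= M) -> mu.-integrable I (EFin \o f).
Proof.
move=> mf fM; apply: measurable_bounded_integrable => //.
  by apply: (@le_lt_trans _ _ 1%E); [exact: probability_le1|rewrite ltry].
exists M; split; first exact: num_real.
by move=> x Mx y yI /=; apply: le_trans (fM _ yI) (ltW Mx).
Qed.

Definition moment mu k : R := \int[mu]_(s in I) s ^+ k.

Lemma measurable_power k : measurable_fun (I : set mR) (fun s : R => s ^+ k).
Proof. by apply: measurable_funTS; exact: exprn_measurable. Qed.

Lemma power_bounded k (s : R) : I s -> `|s ^+ k| <= 1.
Proof. by move=> /I01P/andP[s0 s1]; rewrite ger0_norm ?exprn_ge0// exprn_ile1. Qed.

Lemma moment0 mu : moment mu 0 = 1.
Proof.
rewrite /moment; under eq_Rintegral do rewrite expr0.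
by rewrite (Rintegral_cst mu (D := I))// [X in fine X]prob01_I01 mulr1.
Qed.

Lemma integral_poly mu (a : nat -> R) n :
  mu.-integrable I (fun s : R => (\sum_(i < n) a i * s ^+ i)%:E) /\
  \int[mu]_(s in I) (\sum_(i < n) a i * s ^+ i) = \sum_(i < n) a i * moment mu i.
Proof.
elim: n => [|n [IHi IHe]].
  rewrite big_ord0; split.
    apply: (@prob01_integrable mu _ 0) => [|x _]; last by rewrite big_ord0 normr0.
    by under eq_fun do rewrite big_ord0; exact: measurable_cst.
  by under eq_Rintegral do rewrite big_ord0; rewrite (Rintegral_cst mu (D := I))// mul0r.
have ip : mu.-integrable I (EFin \o (fun s : R => s ^+ n)).
  by apply: (@prob01_integrable mu _ 1); [exact: measurable_power|exact: power_bounded].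
have iap : mu.-integrable I (EFin \o (fun s : R => a n * s ^+ n)).
  by rewrite (_ : _ \o _ = fun s => ((a n)%:E * (s ^+ n)%:E)%E)//; exact: integrableZl.
split.
  rewrite (_ : (fun _ => _) = fun s : R =>
      ((\sum_(i < n) a i * s ^+ i)%R%:E + (a n * s ^+ n)%R%:E)%E); first exact: integrableD.
  by apply/funext => s; rewrite big_ord_recr /=.
under eq_Rintegral do rewrite big_ord_recr /=.
by rewrite RintegralD// IHe RintegralZl// big_ord_recr.
Qed.

Lemma integral_horner mu nu (r : {poly R}) : (forall k, (1 <= k)%N -> moment mu k = moment nu k) ->
  \int[mu]_(s in I) r.[s] = \int[nu]_(s in I) r.[s].
Proof.
move=> H; under eq_Rintegral do rewrite horner_coef.
under [RHS]eq_Rintegral do rewrite horner_coef.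
rewrite !(integral_poly _ _ _).2; apply: eq_bigr => -[[|i] _] _ /=; first by rewrite !moment0.
by rewrite H.
Qed.

Lemma bernoulli_le (x : R) m : 0 <= x <= 1 -> 1 - m%:R * x <= (1 - x) ^+ m.
Proof.
move=> /andP[x0 x1]; elim: m => [|m IH]; first by rewrite mul0r subr0 expr0.
rewrite exprS -natr1; have h : (1 - x) * (1 - m%:R * x) <= (1 - x) * (1 - x) ^+ m.
  by apply: ler_wpM2l IH; lra.
apply: le_trans h; have : 0 <= m%:R * x * x by rewrite !mulr_ge0.
nra.
Qed.

Lemma bernoulli_ge (x : R) m : 0 <= x -> 1 + m%:R * x <= (1 + x) ^+ m.
Proof.
move=> x0; elim: m => [|m IH]; first by rewrite mul0r addr0 expr0.
rewrite exprS -natr1; have h : (1 + x) * (1 + m%:R * x) <= (1 + x) * (1 + x) ^+ m.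
  by apply: ler_wpM2l IH; lra.
apply: le_trans h; have : 0 <= m%:R * x * x by rewrite !mulr_ge0.
nra.
Qed.

(** Since (1 - x)^m (1 + x)^m is at most 1, Bernoulli's lower bound 1 + mx for the second factor
    bounds the first. *)
Lemma power_one_sub_le (x : R) m : 0 < x <= 1 -> (0 < m)%N -> (1 - x) ^+ m <= (m%:R * x)^-1.
Proof.
move=> /andP[x0 x1] m0; have mx : 0 < m%:R * x by rewrite mulr_gt0// ltr0n.
rewrite -[leRHS]mul1r ler_pdivlMr//.
have h1 : 0 <= (1 - x) ^+ m by rewrite exprn_ge0//; lra.
have h2 := bernoulli_ge m (ltW x0).
apply: (@le_trans _ _ ((1 - x) ^+ m * (1 + x) ^+ m)).
  by apply: ler_wpM2l => //; lra.
rewrite -exprMn; apply: exprn_ile1; nra.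
Qed.

(* [(1 - g^n)^(2^n)] tends to 1 where [0 <= g < 1/2] and to 0 where [1/2 < g <= 1];
   the second factor settles the value 0 at [s = a]. *)
Definition step_approx (a : R) n (s : R) : R :=
  (1 - ((s + (1 - a)) / 2) ^+ n) ^+ (2 ^ n) * (1 - (1 - (s - a) ^+ 2) ^+ n).

Definition step_poly (a : R) n : {poly R} :=
  (1 - ((2^-1)%:P * ('X + (1 - a)%:P)) ^+ n) ^+ (2 ^ n) * (1 - (1 - ('X - a%:P) ^+ 2) ^+ n).

Lemma step_polyE a n s : (step_poly a n).[s] = step_approx a n s.
Proof. by rewrite /step_poly /step_approx !hornerE (mulrC 2^-1). Qed.

Lemma step_approx_bounds a n s : I a -> I s -> 0 <= step_approx a n s <= 1.
Proof.
move=> /I01P/andP[a0 a1] /I01P/andP[s0 s1]; rewrite /step_approx.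
have u : 0 <= (s + (1 - a)) / 2 <= 1 by apply/andP; split; lra.
have h : 0 <= (1 - (s - a)) * (1 + (s - a)) by apply: mulr_ge0; lra.
have w : 0 <= 1 - (s - a) ^+ 2 <= 1.
  rewrite gerBl sqr_ge0 andbT (_ : 1 - (s - a) ^+ 2 = (1 - (s - a)) * (1 + (s - a)))//.
  by rewrite -subr_sqr expr1n.
move/andP: u => [u0 u1]; move/andP: w => [w0 w1].
have un0 := exprn_ge0 n u0; have wn0 := exprn_ge0 n w0.
have un1 : ((s + (1 - a)) / 2) ^+ n <= 1 by exact: exprn_ile1.
have wn1 : (1 - (s - a) ^+ 2) ^+ n <= 1 by exact: exprn_ile1.
have v0 : 0 <= (1 - ((s + (1 - a)) / 2) ^+ n) ^+ (2 ^ n) by rewrite exprn_ge0// subr_ge0.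
have v1 : (1 - ((s + (1 - a)) / 2) ^+ n) ^+ (2 ^ n) <= 1.
  by apply: exprn_ile1; rewrite ?subr_ge0// gerBl.
have z0 : 0 <= 1 - (1 - (s - a) ^+ 2) ^+ n by rewrite subr_ge0.
have z1 : 1 - (1 - (s - a) ^+ 2) ^+ n <= 1 by rewrite gerBl.
by rewrite mulr_ge0//= mulr_ile1.
Qed.

(** Here [u] is below 1/2 exactly when [s] is below [a]. Then Bernoulli bounds the first factor
    below by 1 - (2u)^n and the second tends to 1. For [s] above [a], [power_one_sub_le] bounds the
    first factor by (2u)^(-n). At [s] equal to [a] the second factor is 0 for every [n]. *)
Lemma step_approx_cvg a s : I a -> I s ->
  (fun n => step_approx a n s) @ \oo --> (\1_(`[0, a[) s : R).
Proof.
move=> aI sI; have bnd := step_approx_bounds _ aI sI.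
move/I01P: (aI) => /andP[a0 a1]; move/I01P: (sI) => /andP[s0 s1].
rewrite /step_approx in bnd *; set u := (s + (1 - a)) / 2 in bnd *.
set w := 1 - (s - a) ^+ 2 in bnd *.
have u0 : 0 <= u by rewrite /u; lra.
have u1 : u <= 1 by rewrite /u; lra.
rewrite indicE; have [sa|sa|sa] := ltgtP s a.
- rewrite mem_set/=; last by rewrite in_itv /= s0.
  rewrite -[1%:R]mulr1; apply: cvgM; last first.
    rewrite -[X in _ --> X]subr0; apply: cvgB; first exact: cvg_cst.
    by apply: cvg_expr; rewrite ger0_norm; rewrite /w; nra.
  have u2 : 2 * u < 1 by rewrite /u; lra.
  apply: (@squeeze_cvgr _ _ _ _ (fun n => 1 - (2 * u) ^+ n) (cst 1)).
  + apply: nearW => n; rewrite exprMn -natrX; have un0 := exprn_ge0 n u0.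
    have un1 : u ^+ n <= 1 by exact: exprn_ile1.
    rewrite bernoulli_le ?un0//=; apply: exprn_ile1; rewrite ?subr_ge0// gerBl//.
  + rewrite -[X in _ --> X]subr0; apply: cvgB; first exact: cvg_cst.
    by apply: cvg_expr; rewrite ger0_norm//; lra.
  + exact: cvg_cst.
- rewrite memNset/=; last by rewrite in_itv /= => /andP[_]; rewrite ltNge (ltW sa).
  have u2 : 1 < 2 * u by rewrite /u; lra.
  have u3 : 0 < u by lra.
  apply: (@squeeze_cvgr _ _ _ _ (cst 0) (fun n => (2 * u)^-1 ^+ n)).
  + apply: nearW => n; have /andP[b0 _] := bnd n; rewrite b0 /=.
    have h : (1 - u ^+ n) ^+ (2 ^ n) <= (2 * u)^-1 ^+ n.
      have -> : (2 * u)^-1 ^+ n = ((2 ^ n)%:R * u ^+ n)^-1 by rewrite exprVn exprMn natrX.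
      apply: power_one_sub_le; last by rewrite expn_gt0.
      by rewrite exprn_gt0//= exprn_ile1.
    apply: le_trans h; rewrite ler_piMr ?exprn_ge0 ?subr_ge0 ?exprn_ile1// gerBl exprn_ge0//.
    by rewrite /w; nra.
  + exact: cvg_cst.
  + apply: cvg_expr; rewrite ger0_norm; last by rewrite invr_ge0; lra.
    by rewrite invf_lt1; lra.
- rewrite memNset/=; last by rewrite in_itv /= sa ltxx andbF.
  rewrite (_ : (fun n => _) = cst 0); first exact: cvg_cst.
  by apply/funext => n; rewrite /w sa subrr expr0n /= subr0 expr1n subrr mulr0.
Qed.

Lemma measurable_horner (r : {poly R}) : measurable_fun (I : set mR) (fun s => r.[s]).
Proof.
apply: measurable_funTS; apply: continuous_measurable_fun.
by move=> x; exact: continuous_horner.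
Qed.

Lemma integral_step_cvg mu a : I a ->
  (fun n => \int[mu]_(s in I) step_approx a n s) @ \oo --> cdf_lt mu a.
Proof.
move=> aI.
have mfn n : measurable_fun (I : set mR) (EFin \o step_approx a n).
  apply/measurable_EFinP; apply: eq_measurable_fun (measurable_horner (step_poly a n)) => s _.
  by rewrite step_polyE.
have mf : measurable_fun (I : set mR) (fun s => (\1_(`[0%R, a[%classic) s : R)%:E).
  by apply/measurable_EFinP; apply: measurable_indic; exact: measurable_itv.
have cf : {ae mu, forall x, I x -> (fun n => (EFin \o step_approx a n) x) @ \oo -->
    (\1_(`[0%R, a[%classic) x : R)%:E}.
  by apply: aeW => x xI; apply: cvg_EFin; [exact: nearW|exact: step_approx_cvg].
have i1 : mu.-integrable I (EFin \o (cst 1 : R -> R)).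
  by apply: (@prob01_integrable mu _ 1) => [|x _]; [exact: measurable_cst|rewrite normr1].
have b1 : {ae mu, forall x n, I x -> (`|(EFin \o step_approx a n) x| <= (EFin \o (cst 1%R : R -> R)) x)%E}.
  apply: aeW => x n xI; have /andP[h0 h1] := step_approx_bounds n aI xI.
  by rewrite /= lee_fin ger0_norm.
have [_ _] := dominated_convergence (@measurable_I01 R) mfn mf cf i1 b1.
rewrite [X in _ --> X](_ : _ = (cdf_lt mu a)%:E) => [|]; first exact: fine_cvg.
rewrite integral_indic//.
rewrite setIidl ?fineK// ?prob01_fin//; try exact: measurable_itv.
move=> z /=; rewrite in_itv /= => /andP[z0 za]; apply/I01P; rewrite z0 /=.
by move/I01P: aI => /andP[_]; apply: le_trans; exact: ltW.
Qed.

(** Equal moments give equal integrals of the polynomials [step_poly t n], and these converge to the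
    masses of [0,t). The moment of order 0 is 1 for every probability measure. *)
Lemma moments_inj mu nu : (forall k, (1 <= k)%N -> moment mu k = moment nu k) -> mu = nu.
Proof.
move=> H; apply: prob01_cdf_eq => t /I01P tI.
have h1 := @integral_step_cvg mu t tI; have h2 := @integral_step_cvg nu t tI.
apply: (cvg_unique _ h1); first exact: Rhausdorff.
rewrite (_ : (fun n => \int[mu]_(s in I) step_approx t n s) =
             (fun n => \int[nu]_(s in I) step_approx t n s))//.
apply/funext => n; under eq_Rintegral do rewrite -step_polyE.
by under [RHS]eq_Rintegral do rewrite -step_polyE; exact: integral_horner.
Qed.

Lemma moment_degree_law S k : moment (degree_law S) k = \int[L1]_(x in I) degree (set_val S) x ^+ k.
Proof.
by apply: (@integral_degree_law _ S _ 1); [exact: measurable_power|exact: power_bounded].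
Qed.

Lemma degree_law_inj S T : degree_law S = degree_law T -> S = T.
Proof. by move=> E; apply: C_T_inj; rewrite -S_degree_law E S_degree_law. Qed.

Lemma degree_moments_inj S T : (forall k, (1 <= k)%N ->
  \int[L1]_(x in I) degree (set_val S) x ^+ k = \int[L1]_(x in I) degree (set_val T) x ^+ k) ->
  S = T.
Proof.
by move=> H; apply: degree_law_inj; apply: moments_inj => k k1; rewrite !moment_degree_law H.
Qed.

(** * Continuity for the weak topology *)

Lemma power_test k : {within I, continuous (fun s : R => s ^+ k)}.
Proof. by apply: continuous_subspaceT => x; exact: exprn_continuous. Qed.

Lemma test_integral_continuous (f : test_function R) :
  continuous (fun mu : P_s R => test_integrals (set_val mu) f).
Proof.
move=> mu; apply: (@continuous_comp _ _ _ (set_val : P_s R -> prob01 R) (fun mu => test_integrals mu f)).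
  exact: initial_continuous.
apply: (@continuous_comp (prob01 R) {ptws test_function R -> R} R (@test_integrals R) (fun h : {ptws test_function R -> R} => h f)).
  exact: initial_continuous.
exact: proj_continuous.
Qed.

Lemma P_s_hausdorff : hausdorff_space (P_s R).
Proof.
apply: (@separated_hausdorff R) => mu nu ne.
have [k [k1 nek]] : exists k, (1 <= k)%N /\ moment (set_val mu) k <> moment (set_val nu) k.
  apply: contrapT => H; apply: ne; apply: val_inj; apply: moments_inj => k k1.
  by apply: contrapT => h; apply: H; exists k.
pose f : test_function R := SigSub (mem_set (@power_test k)).
by exists (fun la : P_s R => test_integrals (set_val la) f) => //; exact: test_integral_continuous.
Qed.

(** Uniform continuity in a form that can be integrated. With [d] a modulus for [e], pairs closer
    than [d] are covered by [e]; for the others the total variation in value, at most 2(|M| + 1), is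
    below K|u - v| with K = 2(|M| + 1)/d. *)
Lemma uniform_bound (f : R -> R) (e : R) : {within I, continuous f} -> 0 < e ->
  exists2 K, 0 <= K & forall u v, I u -> I v -> `|f u - f v| <= e + K * `|u - v|.
Proof.
move=> cf e0.
have cI : compact I by exact: segment_compact.
have [M [_ HM]] := compact_bounded (continuous_compact cf cI).
have fM u : I u -> `|f u| <= `|M| + 1.
  by move=> uI; apply: HM; [rewrite ltr_pwDr// ler_norm|exists u].
have : \forall d \near 0^'+, I `<=` [set u | I u -> forall v, I v -> `|u - v| < d -> `|f u - f v| < e].
  move/compact_near_coveringP: cI; apply => x xI.
  have /cvgrPdist_lt/(_ (e / 2)) := (@subspace_continuousP _ I _ f).1 cf x xI.
  rewrite divr_gt0// => /(_ isT)/nbhs_ballP[r r0 Hr].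
  exists (ball x (r / 2), [set d | d < r / 2]) => /=.
    split; first by apply: nbhsx_ballx; rewrite divr_gt0.
    by apply: nbhs_right_lt; rewrite divr_gt0.
  have {}r0 : 0 < r := r0.
  move=> [u d] [] /= xu dr uI v vI uv.
  have xv : `|x - v| < r.
    by apply: le_lt_trans (ler_distD u _ _) _; move: xu; rewrite /ball /=; lra.
  have xu' : `|x - u| < r by move: xu; rewrite /ball /=; lra.
  apply: le_lt_trans (ler_distD (f x) _ _) _.
  have h1 := Hr u xu' uI; have h2 := Hr v xv vI.
  by rewrite distrC; lra.
move=> H; have [d [/= d0 hd]] := filter_ex (filterI (nbhs_right_gt (0 : R)) H).
have M0 : 0 <= `|M| + 1 by rewrite addr_ge0.
have K0 : 0 <= 2 * (`|M| + 1) / d by rewrite divr_ge0 ?mulr_ge0// ltW.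
exists (2 * (`|M| + 1) / d) => // u v uI vI.
have [uv|uv] := ltP (`|u - v|) d.
  by apply: le_trans (ltW (hd u uI uI v vI uv)) _; rewrite lerDl mulr_ge0.
apply: (@le_trans _ _ (2 * (`|M| + 1) / d * `|u - v|)); last by rewrite lerDr ltW.
apply: (@le_trans _ _ (2 * (`|M| + 1))).
  by apply: le_trans (ler_normB _ _) _; have := fM u uI; have := fM v vI; lra.
by rewrite -mulrA ler_peMr ?mulr_ge0// mulrC ler_pdivlMr// mul1r.
Qed.

Lemma upsetI (A B : set (R * R)) : upset A -> upset B -> upset (A `&` B).
Proof.
move=> [As iA] [Bs iB]; split => [p [/As]//|p q [Ap Bp] sq p1 p2].
by split; [exact: iA p1 p2|exact: iB p1 p2].
Qed.

(** Union and intersection are again increasing, so their degree functions are monotone and can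
    dominate those of [S] and [T]; the symmetric difference lacks this. *)
Lemma measure_dist_area S T : measure_C S T =
  area (set_val S `|` set_val T) - area (set_val S `&` set_val T).
Proof.
have [Ss mS] := C_T_meas S; have [Ts mT] := C_T_meas T.
have hD := meas_sub_symdiff (C_T_meas S) (C_T_meas T); have [sD mD] := hD.
have sU : set_val S `|` set_val T `<=` square R by move=> p [/Ss|/Ts].
have sI : set_val S `&` set_val T `<=` square R by move=> p [/Ss].
have mU : measurable (set_val S `|` set_val T : set plane) by exact: measurableU.
have mI : measurable (set_val S `&` set_val T : set plane) by exact: measurableI.
apply/eqP; rewrite eq_sym subr_eq; apply/eqP/EFin_inj; rewrite EFinD.
rewrite [in RHS]measure_distE ?C_T_meas// -!lambda2_area//.
rewrite -measureU//; last by apply/seteqP; split => // p [[[? ?]|[? ?]] []].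
congr (L2 _); apply/seteqP; split => p.
  have [Sp|Sp] := pselect (set_val S p); have [Tp|Tp] := pselect (set_val T p);
    by [right|left; left|left; right|case].
by move=> [[[Sp _]|[Tp _]]|[Sp _]]; [left|right|left].
Qed.

Lemma degree_le_sub (A B : set (R * R)) x : upset A -> upset B -> I x -> A `<=` B ->
  degree A x <= degree B x.
Proof.
move=> uA uB xI AB; apply: mono01_le_integral; try exact: section_mono01.
move=> y yI; rewrite !indicE; case: (boolP ((x, y) \in A)) => [|_]; last by case: (_ \in _).
by rewrite inE => /AB h; rewrite mem_set.
Qed.

Lemma integrable_degree_comp S (f : R -> R) M : measurable_fun (I : set mR) f ->
  (forall x, I x -> `|f x| <= M) -> L1.-integrable I (EFin \o (f \o degree (set_val S))).
Proof.
move=> mf fM; apply: (@bounded_integrable _ _ _ M) => // [|x xI].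
  apply: (@measurable_comp _ _ _ _ _ _ (I : set mR)) => //.
    by move=> _ [x xI <-]; exact: degree_I01.
  exact: measurable_degree.
by apply: fM; exact: degree_I01.
Qed.

(* [|d_S - d_T|] is at most the degree of [S `|` T] minus that of [S `&` T], both monotone. *)
Lemma integral_degree_dist (f : R -> R) (e K : R) S T : measurable_fun (I : set mR) f ->
  (forall u v, I u -> I v -> `|f u - f v| <= e + K * `|u - v|) -> 0 <= K ->
  `|\int[degree_law S]_(s in I) f s - \int[degree_law T]_(s in I) f s| <= e + K * measure_C S T.
Proof.
move=> mf fK K0.
have I0 : I (0 : R) by apply/I01P; rewrite lexx ler01.
have e0 : 0 <= e by have := fK 0 0 I0 I0; rewrite !subrr !normr0 mulr0 addr0.
have fM x : I x -> `|f x| <= e + K + `|f 0|.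
  move=> xI; apply: le_trans (_ : _ <= `|f x - f 0| + `|f 0|) _.
    by rewrite -[in leLHS](subrK (f 0) (f x)) ler_normD.
  rewrite lerD2r; apply: le_trans (fK x 0 xI I0) _; rewrite lerD2l ler_piMr//.
  by rewrite subr0; move/I01P: xI => /andP[x0 x1]; rewrite ger0_norm.
rewrite !(integral_degree_law _ mf fM).
set U := set_val S `|` set_val T; set N := set_val S `&` set_val T.
have uU : upset U by exact: upsetU.
have uN : upset N by exact: upsetI.
have iS := integrable_degree_comp S mf fM; have iT := integrable_degree_comp T mf fM.
have iU := mono01_integrable (degree_mono01 uU); have iN := mono01_integrable (degree_mono01 uN).
rewrite -RintegralB//.
have iST : L1.-integrable I (EFin \o (fun x => f (degree (set_val S) x) - f (degree (set_val T) x))).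
  exact: (integrableB (@measurable_I01 R) iS iT).
apply: le_trans (le_normr_Rintegral _ iST) _ => //.
have iK : L1.-integrable I (EFin \o (fun x => K * (degree U x - degree N x))).
  exact: (integrableZl (@measurable_I01 R) K (integrableB (@measurable_I01 R) iU iN)).
have ie : L1.-integrable I (EFin \o cst e) by exact: cst_integrable.
apply: (@le_trans _ _ (\int[L1]_(x in I) (e + K * (degree U x - degree N x)))).
  apply: le_Rintegral => //.
  - exact: (integrable_abse iST).
  - exact: (integrableD (@measurable_I01 R) ie iK).
  move=> x xI; apply: le_trans (fK _ _ _ _) _; try exact: degree_I01.
  rewrite lerD2l ler_wpM2l// ler_norml.
  have h1 : degree (set_val S) x <= degree U x by apply: degree_le_sub => // p; left.
  have h2 : degree (set_val T) x <= degree U x by apply: degree_le_sub => // p; right.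
  have h3 : degree N x <= degree (set_val S) x by apply: degree_le_sub => // p [].
  have h4 : degree N x <= degree (set_val T) x by apply: degree_le_sub => // p [].
  by apply/andP; split; lra.
rewrite RintegralD// Rintegral_cst// lambda1_I01 mulr1 lerD2l RintegralZl//; last first.
  exact: (integrableB (@measurable_I01 R) iU iN).
by rewrite RintegralB// measure_dist_area.
Qed.

Lemma continuous_closed_to_prob : continuous (@closed_to_prob R : C_measure R -> P_s R).
Proof.
apply: continuous_initial; apply: continuous_initial.
apply: continuous_ptws => f S.
have cf : {within I, continuous (set_val f)} := set_valP f.
have mf : measurable_fun (I : set mR) (set_val f) 
  by apply: subspace_continuous_measurable_fun; [exact: measurable_I01|exact: cf].
move=> U /nbhs_ballP[e e0 eU].
apply/(dist_space_nbhs _ _ (@measure_C_metric R)).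
have e2 : 0 < e / 2 by rewrite divr_gt0.
have [K K0 fK] := uniform_bound cf e2.
have K1 : 0 < 2 * (K + 1) by lra.
(* Half of [e] goes to the uniform bound and half to the term with [K]; K + 1 guards against K =
   0. *)
exists (e / (2 * (K + 1))); first by rewrite divr_gt0.
move=> T ST; apply: eU; rewrite /ball /=.
apply: le_lt_trans (integral_degree_dist S T mf fK K0) _.
apply: (@le_lt_trans _ _ (e / 2 + (K + 1) * measure_C S T)).
  by rewrite lerD2l ler_wpM2r// ?lerDl// measure_dist_ge0.
rewrite ltr_pdivlMr// in ST; lra.
Qed.

Lemma homeomorphism_closed_to_prob :
  homeomorphism (@closed_to_prob R : C_measure R -> P_s R).
Proof.
apply: homeomorphism_compact.
- exact: C_measure_compact.
- exact: P_s_hausdorff.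
- exact: continuous_closed_to_prob.
- by exists (@prob_to_closed R); [exact: closed_to_probK|exact: prob_to_closedK].
Qed.

End Moments.

(** * The Hausdorff metric and the Fell topology *)

Section HausdorffFell.
Context (R : realType).
Implicit Types (S T : C_T R) (A B : set (R * R)) (p q r : R * R) (n k : nat).
Local Hint Resolve C_T_P C_T_upset C_T_meas : core.
Local Notation dist := (@euclidean_dist R).

Lemma euclidean_dist_ge0 p q : 0 <= dist p q.
Proof. exact: sqrtr_ge0. Qed.

Lemma euclidean_dist_le p q : dist p q <= `|p.1 - q.1| + `|p.2 - q.2|.
Proof.
rewrite /euclidean_dist -[leRHS]ger0_norm ?addr_ge0// -sqrtr_sqr ler_wsqrtr//.
by rewrite [leRHS]sqrrD !real_normK ?num_real// -addrA lerD2l lerDr mulrn_wge0// mulr_ge0.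
Qed.

Lemma euclidean_dist_coord p q : `|p.1 - q.1| <= dist p q /\ `|p.2 - q.2| <= dist p q.
Proof.
by rewrite /euclidean_dist -!sqrtr_sqr; split; rewrite ler_wsqrtr// ?lerDl ?lerDr sqr_ge0.
Qed.

Lemma euclidean_dist_triangle p q r : dist p r <= dist p q + dist q r.
Proof.
pose a := p.1 - q.1; pose b := p.2 - q.2; pose c := q.1 - r.1; pose d := q.2 - r.2.
rewrite /euclidean_dist -/a -/b -/c -/d.
have -> : p.1 - r.1 = a + c by rewrite /a /c addrA subrK.
have -> : p.2 - r.2 = b + d by rewrite /b /d addrA subrK.
have n1 : 0 <= a ^+ 2 + b ^+ 2 by rewrite addr_ge0 ?sqr_ge0.
have n2 : 0 <= c ^+ 2 + d ^+ 2 by rewrite addr_ge0 ?sqr_ge0.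
rewrite -[leRHS]ger0_norm ?addr_ge0 ?sqrtr_ge0// -sqrtr_sqr ler_wsqrtr//.
rewrite [leRHS]sqrrD !sqr_sqrtr// -sqrtrM//.
(* Cauchy-Schwarz: the difference of the squares is (ad - bc)^2. *)
have h : a * c + b * d <= Num.sqrt ((a ^+ 2 + b ^+ 2) * (c ^+ 2 + d ^+ 2)).
  apply: le_trans (ler_norm _) _; rewrite -sqrtr_sqr ler_wsqrtr// -subr_ge0.
  rewrite (_ : _ - _ = (a * d - b * c) ^+ 2) ?sqr_ge0//.
  by rewrite !expr2; lra.
have -> : (a + c) ^+ 2 + (b + d) ^+ 2 = (a ^+ 2 + b ^+ 2) + (a * c + b * d) *+ 2 + (c ^+ 2 + d ^+ 2).
  by rewrite !sqrrD mulrnDl; lra.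
by rewrite lerD2r lerD2l lerMn2r h orbT.
Qed.

Lemma dist_to_set_has_inf p A : A !=set0 -> has_inf [set dist p q | q in A].
Proof.
move=> [q Aq]; split; first by exists (dist p q), q.
by exists 0 => _ [r _ <-]; exact: euclidean_dist_ge0.
Qed.

Lemma dist_to_set_le p q A : A q -> dist_to_set p A <= dist p q.
Proof.
move=> Aq; apply: ge_inf; last by exists q.
by exists 0 => _ [r _ <-]; exact: euclidean_dist_ge0.
Qed.

Lemma dist_to_set_ge p A c : A !=set0 -> (forall q, A q -> c <= dist p q) -> c <= dist_to_set p A.
Proof.
move=> [q Aq] H; apply: lb_le_inf; first by exists (dist p q), q.
by move=> _ [r Ar <-]; exact: H.
Qed.

Lemma dist_to_set_ge0 p A : A !=set0 -> 0 <= dist_to_set p A.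
Proof. by move=> A0; apply: dist_to_set_ge => // q _; exact: euclidean_dist_ge0. Qed.

Lemma dist_to_set_triangle p q A : A !=set0 -> dist_to_set p A <= dist p q + dist_to_set q A.
Proof.
move=> A0; rewrite -lerBlDl; apply: dist_to_set_ge => // r Ar.
rewrite lerBlDl; apply: le_trans (euclidean_dist_triangle p q r); exact: dist_to_set_le.
Qed.

Lemma C_T_nonempty S : set_val S !=set0.
Proof.
have [_ _ _ _ eS] := C_T_P S; exists (1, 1); apply: eS; left; split => //=.
by apply/I01P; rewrite lexx ler01.
Qed.
Hint Resolve C_T_nonempty : core.

Lemma square_dist_le2 p q : square R p -> square R q -> dist p q <= 2.
Proof.
move=> /squareP[/andP[? ?] /andP[? ?]] /squareP[/andP[? ?] /andP[? ?]].
apply: le_trans (euclidean_dist_le p q) _.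
have : `|p.1 - q.1| <= 1 by rewrite ler_norml; lra.
have : `|p.2 - q.2| <= 1 by rewrite ler_norml; lra.
lra.
Qed.

(** The one-sided Hausdorff distance. *)
Definition excess A B := sup [set dist_to_set p B | p in A].

Lemma excess_ub S T p : set_val S p -> dist_to_set p (set_val T) <= excess (set_val S) (set_val T).
Proof.
move=> Sp; apply: ub_le_sup; last by exists p.
(* A [sup] dominates the members of its set only when the set is bounded; 2 bounds all distances in
   the square. *)
exists 2 => _ [q Sq <-]; have [r Tr] := C_T_nonempty T.
apply: le_trans (dist_to_set_le q Tr) _.
by apply: square_dist_le2; [exact: (C_T_upset S).1|exact: (C_T_upset T).1].
Qed.

Lemma excess_le S T c : (forall p, set_val S p -> dist_to_set p (set_val T) <= c) ->
  excess (set_val S) (set_val T) <= c.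
Proof.
move=> H; apply: ge_sup; last by move=> _ [p Sp <-]; exact: H.
by have [p Sp] := C_T_nonempty S; exists (dist_to_set p (set_val T)), p.
Qed.

Lemma excess_ge0 S T : 0 <= excess (set_val S) (set_val T).
Proof.
by have [p Sp] := C_T_nonempty S; apply: le_trans (excess_ub T Sp); exact: dist_to_set_ge0.
Qed.

Lemma excess_triangle S T (U : C_T R) : excess (set_val S) (set_val U) <=
  excess (set_val S) (set_val T) + excess (set_val T) (set_val U).
Proof.
apply: excess_le => p Sp; apply: le_trans (_ : _ <= dist_to_set p (set_val T) + excess (set_val T) (set_val U)) _; last first.
  by rewrite lerD2r; exact: excess_ub.
rewrite -lerBlDr; apply: dist_to_set_ge => // q Tq; rewrite lerBlDr.
apply: le_trans (dist_to_set_triangle p q _) _ => //.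
by rewrite lerD2l; exact: excess_ub.
Qed.

Lemma excess0_sub S T : excess (set_val S) (set_val T) = 0 -> set_val S `<=` set_val T.
Proof.
move=> E p Sp; have [cT _ _ _ _] := C_T_P T; rewrite closure_id in cT; rewrite cT.
move=> U /nbhs_planeP[e e0 eU].
have h : dist_to_set p (set_val T) < e by apply: le_lt_trans (excess_ub T Sp) _; rewrite E.
have he : 0 < e - dist_to_set p (set_val T) by rewrite subr_gt0.
have [_ [q Tq <-] qe] := inf_adherent he (dist_to_set_has_inf p (C_T_nonempty T)).
have [c1 c2] := euclidean_dist_coord p q; move: qe; rewrite -/(dist_to_set p (set_val T)) addrC subrK => qe.
by exists q; split => //; apply: eU; [exact: le_lt_trans c1 qe|exact: le_lt_trans c2 qe].
Qed.

Lemma hausdorff_CE S T : hausdorff_C S T =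
  Num.max (excess (set_val S) (set_val T)) (excess (set_val T) (set_val S)).
Proof. by []. Qed.

Lemma hausdorff_C_metric : is_metric (@hausdorff_C R).
Proof.
split.
- by move=> S T; rewrite hausdorff_CE le_max excess_ge0.
- move=> S T; split => [E|->].
    have h1 := excess_ge0 S T; have h2 := excess_ge0 T S.
    have : excess (set_val S) (set_val T) <= 0 /\ excess (set_val T) (set_val S) <= 0.
      by rewrite -E hausdorff_CE !le_max !lexx orbT.
    move=> [h3 h4]; apply: C_T_inj; apply/seteqP.
    by split; apply: excess0_sub; apply/eqP; rewrite eq_le ?h1 ?h2 ?h3 ?h4.
  rewrite hausdorff_CE maxxx; apply/eqP; rewrite eq_le excess_ge0 andbT.
  apply: excess_le => p Tp; apply: le_trans (dist_to_set_le p Tp) _.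
  by apply: le_trans (euclidean_dist_le p p) _; rewrite !subrr normr0 addr0.
- by move=> S T; rewrite !hausdorff_CE maxC.
- move=> S T U; rewrite !hausdorff_CE ge_max; apply/andP; split.
    apply: le_trans (excess_triangle S T U) _.
    by apply: lerD; rewrite le_max lexx.
  apply: le_trans (excess_triangle U T S) _; rewrite addrC.
  by apply: lerD; rewrite le_max lexx orbT.
Qed.

(** The diagonal shift of [p] serves when it stays below the edges. Otherwise [p] is within 1/n of
    the right or upper edge, all of which [T] contains. *)
Lemma step_le_near n S T p : (0 < n)%N -> step_le n (set_val S) (set_val T) -> set_val S p ->
  exists q, [/\ set_val T q, `|p.1 - q.1| <= n%:R^-1 & `|p.2 - q.2| <= n%:R^-1].
Proof.
move=> n0 ST Sp; have [_ _ _ _ eT] := C_T_P T.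
have sp := (C_T_upset S).1 _ Sp; have /squareP[/andP[p1 p2] /andP[p3 p4]] := sp.
have nV : 0 < n%:R^-1 :> R by rewrite invr_gt0 ltr0n.
have [h1|h1] := ltP (p.1 + n%:R^-1) 1; last first.
  exists (1, p.2); split => /=; first by apply: eT; right; split => //; apply/I01P; rewrite p3.
    by rewrite ler_norml; apply/andP; split; lra.
  by rewrite subrr normr0 ltW.
have [h2|h2] := ltP (p.2 + n%:R^-1) 1; last first.
  exists (p.1, 1); split => /=; first by apply: eT; left; split => //; apply/I01P; rewrite p1.
    by rewrite subrr normr0 ltW.
  by rewrite ler_norml; apply/andP; split; lra.
exists (p.1 + n%:R^-1, p.2 + n%:R^-1); split => /=.
- by apply: ST => //; rewrite -surjective_pairing.
- by rewrite opprD addrA subrr add0r normrN ger0_norm// ltW.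
- by rewrite opprD addrA subrr add0r normrN ger0_norm// ltW.
Qed.

Lemma measure_C_near S (e : R) : 0 < e -> exists2 a : R, 0 < a & forall T, measure_C S T < a ->
  (forall p, set_val S p -> exists q, [/\ set_val T q, `|p.1 - q.1| < e & `|p.2 - q.2| < e]) /\
  (forall p, set_val T p -> exists q, [/\ set_val S q, `|p.1 - q.1| < e & `|p.2 - q.2| < e]).
Proof.
move=> e0; have [n n0 ne] := archi_div_lt ler01 e0; rewrite div1r in ne.
exists (n%:R^-2); first by rewrite invr_gt0 exprn_gt0// ltr0n.
move=> T /(measure_dist_step_le n0 (C_T_upset S) (C_T_upset T) (C_T_meas S) (C_T_meas T))[ST TS].
split => p hp.
  have [q [Tq q1 q2]] := step_le_near n0 ST hp.
  by exists q; split => //; [exact: le_lt_trans q1 ne|exact: le_lt_trans q2 ne].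
have [q [Tq q1 q2]] := step_le_near n0 TS hp.
by exists q; split => //; [exact: le_lt_trans q1 ne|exact: le_lt_trans q2 ne].
Qed.

Lemma homeomorphism_hausdorff : homeomorphism (id : C_measure R -> C_hausdorff R).
Proof.
apply: homeomorphism_compact.
- exact: C_measure_compact.
- by apply: dist_space_hausdorff; exact: hausdorff_C_metric.
- apply: (dist_space_le_continuous (@measure_C_metric R) hausdorff_C_metric) => S e e0.
  (* With e/4 in each coordinate distances stay below e/2, so the bound remains strictly below [e]
     after the supremum. *)
  have e4 : 0 < e / 4 by rewrite divr_gt0.
  have [a a0 ha] := measure_C_near S e4; exists a => // T /ha[h1 h2].
  have H (A B : C_T R) : (forall p, set_val A p -> exists q,
      [/\ set_val B q, `|p.1 - q.1| < e / 4 & `|p.2 - q.2| < e / 4]) ->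
      excess (set_val A) (set_val B) < e.
    move=> h; apply: (@le_lt_trans _ _ (e / 2)); last by lra.
    apply: excess_le => p /h[q [Bq q1 q2]]; apply: le_trans (dist_to_set_le p Bq) _.
    by apply: le_trans (euclidean_dist_le p q) _; lra.
  by rewrite hausdorff_CE gt_max !H.
- by exists id.
Qed.

(** * The Fell topology *)

Lemma fell_subbase_open (X : topologicalType) (A : set (set X)) (B : set (fell_space A)) :
  fell_subbase B -> open B.
Proof.
move=> hB; exists [set B]; last by rewrite bigcup_set1.
by move=> _ ->; exact: finI_from1.
Qed.

(** A point of one set outside the other has a closed box around it that misses the other set.
    Hitting the interior of the box and missing the box are disjoint open conditions. *)
Lemma C_fell_hausdorff : hausdorff_space (C_fell R).
Proof.
rewrite open_hausdorff.
have sep S T p : set_val S p -> ~ set_val T p -> exists U K : set (C_fell R),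
    [/\ open U, open K, U S, K T & U `&` K = set0].
  move=> Sp nT; have [cT _ _ _ _] := C_T_P T.
  have /nbhs_planeP[e e0 eU] : nbhs p (~` set_val T).
    by apply: open_nbhs_nbhs; split => //; exact: closed_openC.
  pose K : set (R * R) := `[p.1 - e / 2, p.1 + e / 2] `*` `[p.2 - e / 2, p.2 + e / 2].
  have e2 : 0 < e / 2 by rewrite divr_gt0.
  have cK : compact K by apply: compact_setX; exact: segment_compact.
  exists (fell_hit (A := threshold_closed_sets R) K°), (fell_miss (A := threshold_closed_sets R) K).
  split.
  - by apply: fell_subbase_open; left; exists K° => //; exact: open_interior.
  - by apply: fell_subbase_open; right; exists K.
  - exists p; split => //; apply/nbhs_planeP; exists (e / 2) => // q.
    by rewrite !ltr_distlC => /andP[? ?] /andP[? ?]; split; rewrite /= in_itv /=; lra.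
  - apply/seteqP; split => // q [Tq] [] /=; rewrite !in_itv /= => /andP[? ?] /andP[? ?].
    by apply: (eU q) => //; rewrite ltr_distlC; apply/andP; split; lra.
  - apply/seteqP; split => // F [[q [Fq /interior_subset Kq]] m].
    by have : (set_val F `&` K) q by []; rewrite m.
move=> S T /eqP ST.
have [p [[Sp nT]|[Tp nS]]] : exists p, (set_val S p /\ ~ set_val T p) \/ (set_val T p /\ ~ set_val S p).
  apply: contrapT => H; apply: ST; apply: C_T_inj; apply/seteqP; split => p hp; apply: contrapT => np;
    apply: H; exists p; by [left|right].
  have [U [K [oU oK US KT UK]]] := sep _ _ _ Sp nT.
  by exists (U, K); split => //=; rewrite ?inE// UK.
have [U [K [oU oK US KT UK]]] := sep _ _ _ Tp nS.
by exists (K, U); split => //=; rewrite ?inE// setIC UK.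
Qed.

Lemma homeomorphism_fell : homeomorphism (id : C_measure R -> C_fell R).
Proof.
apply: homeomorphism_compact.
- exact: C_measure_compact.
- exact: C_fell_hausdorff.
- apply: (@fell_continuous (C_measure R) (R * R)%type) => [U oU|K cK]; rewrite /C_measure dist_space_openE.
    move=> S [p [Sp Up]].
    have /nbhs_planeP[e e0 eU] : nbhs p U by exact: open_nbhs_nbhs.
    have [a a0 ha] := measure_C_near S e0; exists a => // T /ha[h _].
    by have [q [Tq q1 q2]] := h p Sp; exists q; split => //; exact: eU.
  move=> S SK; have [cS _ _ _ _] := C_T_P S.
  (* Compactness of [K] gives one [d] such that no point of [S] is within [d] of [K] in both
     coordinates; a set whose points are all [d]-close to [S] then also misses [K]. *)
  have : \forall d \near 0^'+, K `<=` [set k : R * R | forall s, set_val S s ->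
      ~ (`|k.1 - s.1| < d /\ `|k.2 - s.2| < d)].
    move/compact_near_coveringP: cK; apply => k Kk.
    have nS : ~ set_val S k by move=> Sk; have : (set_val S `&` K) k by []; rewrite SK.
    have /nbhs_planeP[r r0 rU] : nbhs k (~` set_val S).
      by apply: open_nbhs_nbhs; split => //; exact: closed_openC.
    exists ([set k' : R * R | `|k.1 - k'.1| < r / 2 /\ `|k.2 - k'.2| < r / 2], [set d | d < r / 2]) => /=.
      split; first by apply/nbhs_planeP; exists (r / 2) => //; rewrite divr_gt0.
      by apply: nbhs_right_lt; rewrite divr_gt0.
    move=> [k' d] [] /= [k1 k2] dr s Ss [s1 s2]; apply: (rU s) => //.
      by apply: le_lt_trans (ler_distD k'.1 _ _) _; lra.
    by apply: le_lt_trans (ler_distD k'.2 _ _) _; lra.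
  move=> H; have [d [/= d0 hd]] := filter_ex (filterI (nbhs_right_gt (0 : R)) H).
  have [a a0 ha] := measure_C_near S d0; exists a => // T /ha[_ h].
  apply/seteqP; split => // q [Tq Kq].
  by have [s [Ss s1 s2]] := h q Tq; apply: (hd q Kq s Ss).
- by exists id.
Qed.

End HausdorffFell.

(** * The cut distance *)

Section CutDistance.
Context (R : realType).
Local Notation I := (I01 R).
Local Notation L1 := (lambda1 R).
Local Notation L2 := (lambda2 R).
Local Notation mR := (measurableTypeR R).
Local Notation plane := (mR * mR)%type.
Implicit Types (S T : C_T R) (phi psi f : R -> R) (U V W : R * R -> R) (A B : set R) (n k : nat).
Local Hint Resolve measurable_I01 : core.
Local Hint Resolve C_T_P C_T_upset C_T_meas : core.
Local Notation mpb := (@measure_preserving_bijection R).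

Lemma mpb_I01 phi x : mpb phi -> I x -> I (phi x).
Proof. by move=> [[h _ _] _ _ _]; exact: h. Qed.

Lemma mpb_image_measurable phi A : mpb phi -> measurable (A : set mR) -> A `<=` I ->
  measurable (phi @` A : set mR) /\ phi @` A `<=` I.
Proof.
move=> hp mA AI; have [_ _ h _] := hp; split; first exact: h.
by move=> _ [x Ax <-]; apply: mpb_I01 => //; exact: AI.
Qed.

Lemma mpb_preimage_image phi A : mpb phi -> A `<=` I -> I `&` phi @^-1` (phi @` A) = A.
Proof.
move=> [[_ inj _] _ _ _] AI; apply/seteqP; split => [x [xI [y Ay /inj e]]|x Ax].
  by rewrite -e// inE//; exact: AI.
by split; [exact: AI|exists x].
Qed.

(** Change of variables, stated with images because the cut norm ranges over pairs of sets and [phi]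
    carries one pair to another. The extension [law_map] makes [phi] a measurable map of the
    line. *)
Lemma mpb_Rintegral phi f M A : mpb phi -> measurable_fun (I : set mR) f ->
  (forall x, I x -> `|f x| <= M) -> measurable (A : set mR) -> A `<=` I ->
  \int[L1]_(x in A) f (phi x) = \int[L1]_(u in phi @` A) f u.
Proof.
move=> hp mf fM mA AI; have [_ mphi _ mp] := hp.
have [mpA pAI] := mpb_image_measurable hp mA AI.
have XI x : I x -> I (phi x) by exact: mpb_I01.
rewrite /Rintegral; congr fine.
have E : law_map phi @^-1` (phi @` A) = A by rewrite law_map_preimage// mpb_preimage_image.
have mfI : measurable_fun (setT : set mR) (f \_ I).
  by apply/(measurable_restrictT _ _).1; [exact: measurable_I01|exact: mf].
pose g : mR -> \bar R := EFin \o (f \_ I).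
have mg : measurable_fun setT g by exact/measurable_EFinP.
have ig : L1.-integrable (law_map phi @^-1` (phi @` A)) (g \o law_map phi).
  rewrite E; apply: (@bounded_integrable _ _ ((f \_ I) \o law_map phi) M) => //.
  + by apply: measurableT_comp => //; exact: measurable_funTS (measurable_law_map mphi).
  + by move=> x /AI xI /=; rewrite law_mapE// patchE mem_set//; [apply: fM|]; exact: XI.
apply: (etrans _ (etrans (esym (integral_pushforward (measurable_law_map mphi) mg ig mpA)) _)).
  rewrite E; apply: eq_integral => x; rewrite inE => /AI xI /=.
  by rewrite /g /= law_mapE// patchE mem_set//; exact: XI.
transitivity (\int[L1]_(u in phi @` A) g u)%E.
  apply: eq_measure_integral; first exact: (measurable_law_map mphi).
  move=> mf' B mB BA; apply: etrans (mp B mB (subset_trans BA pAI)).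
  by rewrite -(law_map_preimage phi (subset_trans BA pAI)).
by apply: eq_integral => u; rewrite inE => uA; rewrite /g /= patchE mem_set//; exact: pAI.
Qed.

Definition bounded_meas U := measurable_fun (square R : set plane) U /\
  exists M, forall p, square R p -> `|U p| <= M.

Definition pull phi U := fun p : R * R => U (phi p.1, phi p.2).

Lemma measurable_pairmap phi : mpb phi ->
  measurable_fun (square R : set plane) (fun p : plane => (phi p.1, phi p.2) : plane).
Proof.
move=> [_ mphi _ _]; have ml := measurable_law_map mphi.
have mpair : measurable_fun (setT : set plane)
    (fun p : plane => (law_map phi p.1, law_map phi p.2) : plane).
  by apply: measurable_fun_pair; apply: measurableT_comp.
apply: eq_measurable_fun (measurable_funTS (D := square R) mpair) => p.
by rewrite inE => -[p1 p2]; rewrite !law_mapE.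
Qed.

Lemma bounded_meas_pull phi U : mpb phi -> bounded_meas U -> bounded_meas (pull phi U).
Proof.
move=> hp [mU [M UM]]; split; last first.
  by exists M => p [p1 p2]; apply: UM; split; exact: mpb_I01.
apply: (@measurable_comp _ _ _ plane plane mR (square R : set plane) U (square R)) => //.
- exact: measurable_square.
- by move=> _ [p [p1 p2] <-]; split; exact: mpb_I01.
- exact: measurable_pairmap.
Qed.

Lemma bounded_measB U V : bounded_meas U -> bounded_meas V -> bounded_meas (fun p => U p - V p).
Proof.
move=> [mU [M UM]] [mV [N VN]]; split; first exact: measurable_funB.
exists (M + N) => p sp; apply: le_trans (ler_normB _ _) _.
by apply: lerD; [exact: UM|exact: VN].
Qed.

Lemma bounded_meas_ind (S : set (R * R)) : meas_sub S -> bounded_meas (\1_S : R * R -> R).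
Proof.
move=> [_ mS]; split; first exact: measurable_indic.
by exists 1 => p _; have /andP[h0 h1] := ind01 S p; rewrite ger0_norm.
Qed.

Lemma rect_integrable U A B : bounded_meas U -> measurable (A : set mR) -> measurable (B : set mR) ->
  A `<=` I -> B `<=` I -> L2.-integrable (A `*` B) (EFin \o U).
Proof.
move=> [mU [M UM]] mA mB AI BI.
have ABs : A `*` B `<=` square R by move=> p [/AI ? /BI ?]; split.
apply: (integrable_square (M := M)) => //; first exact: measurableX.
  by apply: measurable_funS mU => //; exact: measurable_square.
by move=> p /ABs; exact: UM.
Qed.

Lemma rect_Rintegral U A B : bounded_meas U -> measurable (A : set mR) -> measurable (B : set mR) ->
  A `<=` I -> B `<=` I ->
  \int[L2]_(p in A `*` B) U p = \int[L1]_(x in A) \int[L1]_(y in B) U (x, y).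
Proof.
move=> [mU [M UM]] mA mB AI BI.
have ABs : A `*` B `<=` square R by move=> p [/AI ? /BI ?]; split.
apply: (Rintegral_prod (M := M)) => //; last by move=> p /ABs; exact: UM.
by apply: measurable_funS mU => //; exact: measurable_square.
Qed.

Lemma section_meas U x : bounded_meas U -> I x ->
  measurable_fun (I : set mR) (fun y => U (x, y)) /\
  exists M, forall y, I y -> `|U (x, y)| <= M.
Proof.
move=> [mU [M UM]] xI; split; last by exists M => y yI; apply: UM; split.
have -> : (fun y => U (x, y)) = U \o pair x by [].
apply: (@measurable_comp _ _ _ _ _ _ (square R : set plane)) => //.
- exact: measurable_square.
- by move=> _ [y yI <-]; split.
- exact: measurable_funTS.
Qed.

Lemma section_integral_meas U B : bounded_meas U -> measurable (B : set mR) -> B `<=` I ->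
  measurable_fun (I : set mR) (fun x => \int[L1]_(y in B) U (x, y)) /\
  exists M, forall x, I x -> `|\int[L1]_(y in B) U (x, y)| <= M.
Proof.
move=> bU mB BI; have [mU [M UM]] := bU; split; last first.
  exists M => x xI.
  have [ms _] := section_meas bU xI.
  have si : L1.-integrable B (EFin \o (fun y => U (x, y))).
    apply: (@bounded_integrable _ _ _ M) => //; first exact: measurable_funS ms.
    by move=> y /BI yI; apply: UM; split.
  apply: le_trans (le_normr_Rintegral mB si) _.
  have M0 : 0 <= M by apply: le_trans (normr_ge0 (U (x, x))) _; apply: UM; split.
  apply: (@le_trans _ _ (\int[L1]_(y in B) cst M y)).
    apply: le_Rintegral => //; [exact: (integrable_abse si)|exact: cst_integrable|].
    by move=> y /BI yI; apply: UM; split.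
  rewrite Rintegral_cst// ler_piMr// -lee_fin fineK.
    by rewrite -(lambda1_I01 R); apply: le_measure => //; rewrite inE.
  rewrite ge0_fin_numE//; apply: (@le_lt_trans _ _ 1%E); last exact: ltry.
  by rewrite -(lambda1_I01 R); apply: le_measure => //; rewrite inE.
have fi : L2.-integrable setT (EFin \o (U \_ (I `*` B))).
  rewrite -restrict_EFin; apply/integrable_restrict => //; first exact: measurableX.
  by rewrite setTI; exact: rect_integrable.
have := measurable_fubini_F fi => /(measurable_funTS (D := I)) mF.
have mF2 : measurable_fun (I : set mR) (fine \o (fubini_F (@lebesgue_measure R) (EFin \o (U \_ (I `*` B))))).
  by apply: measurableT_comp => //.
apply: eq_measurable_fun mF2 => x; rewrite inE => xI /=.
rewrite /fubini_F /Rintegral; congr fine; rewrite [RHS]integral_mkcond.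
apply: eq_integral => y _ /=; rewrite !patchE.
case: (boolP (y \in B)) => [|/negP]; rewrite inE => yB.
  by rewrite ifT// inE.
by rewrite ifF//; apply/negP; rewrite inE => -[].
Qed.

(** Fubini allows the change of variables to be made in one coordinate at a time. *)
Lemma pull_Rintegral phi U A B : mpb phi -> bounded_meas U ->
  measurable (A : set mR) -> measurable (B : set mR) -> A `<=` I -> B `<=` I ->
  \int[L2]_(p in A `*` B) pull phi U p = \int[L2]_(p in (phi @` A) `*` (phi @` B)) U p.
Proof.
move=> hp bU mA mB AI BI.
have [mpA pAI] := mpb_image_measurable hp mA AI.
have [mpB pBI] := mpb_image_measurable hp mB BI.
rewrite !rect_Rintegral//; last exact: bounded_meas_pull.
have [ms [M sM]] := section_integral_meas bU mpB pBI.
rewrite -(mpb_Rintegral hp ms sM mA AI).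
apply: eq_Rintegral => x; rewrite inE => /AI xI.
have [mt [N tN]] := section_meas bU (mpb_I01 hp xI).
by rewrite -(mpb_Rintegral hp mt tN mB BI).
Qed.

Lemma mpb_id : mpb id.
Proof.
split => //.
- split => //; first by move=> y yI; exists y.
- by move=> A mA _; rewrite image_id.
- by move=> A mA AI; rewrite setIidr.
Qed.

Lemma mpb_comp phi psi : mpb phi -> mpb psi -> mpb (psi \o phi).
Proof.
move=> hp hq; have [[p1 p2 p3] p4 p5 p6] := hp; have [[q1 q2 q3] q4 q5 q6] := hq; split.
- exact: set_bij_comp (And3 p1 p2 p3) (And3 q1 q2 q3).
- apply: (@measurable_comp _ _ _ _ _ _ (I : set mR)) => //.
  by move=> _ [x xI <-]; exact: p1.
- move=> A mA AI; rewrite -image_comp; apply: q5; first exact: p5.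
  by move=> _ [x /AI xI <-]; exact: p1.
- move=> A mA AI.
  have -> : I `&` (psi \o phi) @^-1` A = I `&` phi @^-1` (I `&` psi @^-1` A).
    by apply/seteqP; split => x [xI] //=; [split => //; split => //; exact: p1|move=> []].
  have mQ := q4 (@measurable_I01 R) A mA.
  by rewrite (p6 _ mQ (@subIsetl _ _ _)) q6.
Qed.

(** Preimages under the inverse are images under [phi] and conversely, so the two measurability
    clauses of the definition change places. *)
Lemma mpb_inv phi : mpb phi -> exists2 psi, mpb psi & forall x, I x -> phi (psi x) = x.
Proof.
move=> hp; have [[p1 p2 p3] p4 p5 p6] := hp.
have ex y : exists x, I y -> I x /\ phi x = y.
  have [yI|nI] := pselect (I y); last by exists 0.
  by have [x xI e] := p3 y yI; exists x.
pose psi y := projT1 (cid (ex y)).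
have psiP y : I y -> I (psi y) /\ phi (psi y) = y by rewrite /psi; case: cid.
have psiK x : I x -> psi (phi x) = x.
  move=> xI; have [h1 h2] := psiP _ (p1 _ xI).
  by apply: p2 => //; rewrite inE.
have pre A : A `<=` I -> I `&` psi @^-1` A = phi @` A.
  move=> AI; apply/seteqP; split => [y [yI Ay]|_ [x Ax <-]].
    by exists (psi y) => //; case: (psiP y yI).
  by split; [apply/p1/AI|rewrite /= psiK//; exact: AI].
have img A : A `<=` I -> psi @` A = I `&` phi @^-1` A.
  move=> AI; apply/seteqP; split => [_ [y Ay <-]|x [xI Ax]].
    by have [h1 h2] := psiP y (AI _ Ay); split => //; rewrite /= h2.
  by exists (phi x) => //; exact: psiK.
exists psi; last by move=> x /psiP[].
split.
- split.
  + by move=> y /psiP[].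
  + move=> y z; rewrite !inE => yI zI e; have [_ <-] := psiP y yI; have [_ <-] := psiP z zI.
    by rewrite e.
  + by move=> x xI; exists (phi x); [exact: p1|exact: psiK].
- move=> _ A mA.
  have -> : I `&` psi @^-1` A = I `&` psi @^-1` (I `&` A).
    by apply/seteqP; split => x [xI] //=; [move=> Ax; split => //; split => //; case: (psiP x xI)|move=> []].
  rewrite pre; last exact: subIsetl.
  apply: p5; last exact: subIsetl.
  by apply: (@measurableI _ mR) => //; exact: measurable_I01.
- by move=> A mA AI; rewrite img//; exact: (p4 (@measurable_I01 R) A mA).
- move=> A mA AI; rewrite pre// -p6; [|exact: p5|by move=> _ [x /AI xI <-]; exact: p1].
  by rewrite mpb_preimage_image.
Qed.

Lemma cut_norm_set_bounded U : bounded_meas U -> exists M, forall A B,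
  measurable (A : set mR) -> measurable (B : set mR) -> A `<=` I -> B `<=` I ->
  `|\int[L2]_(p in A `*` B) U p| <= M.
Proof.
move=> bU; have [mU [M UM]] := bU; exists M => A B mA mB AI BI.
have ABs : A `*` B `<=` square R by move=> p [/AI ? /BI ?]; split.
have mAB : measurable (A `*` B : set plane) by exact: measurableX.
have M0 : 0 <= M.
  apply: le_trans (normr_ge0 (U (0, 0))) _; apply: UM; apply/squareP => /=.
  by rewrite lexx ler01.
apply: le_trans (le_normr_Rintegral _ (rect_integrable bU mA mB AI BI)) _ => //.
apply: (@le_trans _ _ (\int[L2]_(p in A `*` B) cst M p)).
  apply: le_Rintegral => //.
  - exact: (integrable_abse (rect_integrable bU mA mB AI BI)).
  - apply: (integrable_square (M := M)) => // p _; by rewrite ger0_norm.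
  - by move=> p /ABs; exact: UM.
rewrite (Rintegral_cst L2)// ler_piMr// -lee_fin fineK; first exact: lambda2_ltS.
exact: lambda2_fin.
Qed.

Lemma cut_norm_ub U A B : bounded_meas U ->
  measurable (A : set mR) -> measurable (B : set mR) -> A `<=` I -> B `<=` I ->
  `|\int[L2]_(p in A `*` B) U p| <= cut_norm U.
Proof.
move=> bU mA mB AI BI; have [M UM] := cut_norm_set_bounded bU.
apply: ub_le_sup; last by exists A, B.
by exists M => _ [C [D [mC mD CI DI ->]]]; exact: UM.
Qed.

Lemma cut_norm_le U c : (forall A B, measurable (A : set mR) -> measurable (B : set mR) ->
    A `<=` I -> B `<=` I -> `|\int[L2]_(p in A `*` B) U p| <= c) -> cut_norm U <= c.
Proof.
move=> H; apply: ge_sup; first (exists `|\int[L2]_(p in set0 `*` set0) U p|, set0, set0; by split => //; exact: measurable0).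
by move=> _ [C [D [mC mD CI DI ->]]]; exact: H.
Qed.

Lemma cut_norm_ge0 U : bounded_meas U -> 0 <= cut_norm U.
Proof.
by move=> bU; apply: le_trans (cut_norm_ub bU measurable0 measurable0 (@sub0set _ _) (@sub0set _ _)).
Qed.

Lemma cut_norm_triangle U V W : bounded_meas U -> bounded_meas V -> bounded_meas W ->
  cut_norm (fun p => U p - W p) <= cut_norm (fun p => U p - V p) + cut_norm (fun p => V p - W p).
Proof.
move=> bU bV bW; apply: cut_norm_le => A B mA mB AI BI.
have bUV := bounded_measB bU bV; have bVW := bounded_measB bV bW.
have -> : \int[L2]_(p in A `*` B) (U p - W p) =
    \int[L2]_(p in A `*` B) (U p - V p) + \int[L2]_(p in A `*` B) (V p - W p).
  rewrite -(RintegralD (mu := L2)); try exact: rect_integrable; last exact: measurableX.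
  by apply: eq_Rintegral => p _; rewrite addrA subrK.
by apply: le_trans (ler_normD _ _) _; apply: lerD; exact: cut_norm_ub.
Qed.

Lemma cut_normC U V : bounded_meas U -> bounded_meas V ->
  cut_norm (fun p => U p - V p) = cut_norm (fun p => V p - U p).
Proof.
have H U' V' : bounded_meas U' -> bounded_meas V' ->
    cut_norm (fun p => U' p - V' p) <= cut_norm (fun p => V' p - U' p).
  move=> bU bV; apply: cut_norm_le => A B mA mB AI BI.
  have -> : \int[L2]_(p in A `*` B) (U' p - V' p) = - \int[L2]_(p in A `*` B) (V' p - U' p).
    rewrite !(RintegralB (mu := L2)); try exact: rect_integrable; try exact: measurableX.
    by rewrite opprB.
  by rewrite normrN; apply: cut_norm_ub => //; exact: bounded_measB.
by move=> bU bV; apply/eqP; rewrite eq_le !H.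
Qed.

(** Every rectangle integral of the pulled-back function is the integral of [U] over the image
    rectangle. *)
Lemma cut_norm_pull phi U : mpb phi -> bounded_meas U -> cut_norm (pull phi U) <= cut_norm U.
Proof.
move=> hp bU; apply: cut_norm_le => A B mA mB AI BI; rewrite pull_Rintegral//.
have [mpA pAI] := mpb_image_measurable hp mA AI.
have [mpB pBI] := mpb_image_measurable hp mB BI.
exact: cut_norm_ub.
Qed.

Lemma eq_cut_norm U V : (forall p, square R p -> U p = V p) -> cut_norm U = cut_norm V.
Proof.
move=> UV; rewrite /cut_norm; congr sup; apply/seteqP.
split => _ [A [B [mA mB AI BI ->]]]; exists A, B; split => //; congr (`|_|);
  by apply: eq_Rintegral => p; rewrite inE => -[/AI p1 /BI p2]; rewrite UV.
Qed.

Definition cut_at phi U V := cut_norm (fun p => U p - pull phi V p).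

Lemma cut_distE U V : cut_dist U V = inf [set cut_at phi U V | phi in mpb].
Proof. by []. Qed.

Lemma cut_at_ge0 phi U V : mpb phi -> bounded_meas U -> bounded_meas V -> 0 <= cut_at phi U V.
Proof. by move=> hp bU bV; apply: cut_norm_ge0; apply: bounded_measB => //; exact: bounded_meas_pull. Qed.

Lemma cut_at_has_inf U V : bounded_meas U -> bounded_meas V -> has_inf [set cut_at phi U V | phi in mpb].
Proof.
move=> bU bV; split; first by exists (cut_at id U V), id => //; exact: mpb_id.
by exists 0 => _ [phi hp <-]; exact: cut_at_ge0.
Qed.

Lemma cut_dist_le phi U V : mpb phi -> bounded_meas U -> bounded_meas V ->
  cut_dist U V <= cut_at phi U V.
Proof.
move=> hp bU bV; rewrite cut_distE; apply: ge_inf; last by exists phi.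
by have [] := cut_at_has_inf bU bV.
Qed.

Lemma cut_dist_ge c U V : (forall phi, mpb phi -> c <= cut_at phi U V) -> c <= cut_dist U V.
Proof.
move=> H; rewrite cut_distE; apply: lb_le_inf.
  by exists (cut_at id U V), id => //; exact: mpb_id.
by move=> _ [phi hp <-]; exact: H.
Qed.

Lemma cut_dist_ge0 U V : bounded_meas U -> bounded_meas V -> 0 <= cut_dist U V.
Proof. by move=> bU bV; apply: cut_dist_ge => phi hp; exact: cut_at_ge0. Qed.

(** Pulling the difference of [V] and [pull phi U] back along the inverse of [phi] moves the
    rearrangement from [U] to [V] without increasing the cut norm. *)
Lemma cut_dist_sym_le U V : bounded_meas U -> bounded_meas V -> cut_dist U V <= cut_dist V U.
Proof.
move=> bU bV; apply: cut_dist_ge => phi hp; have [psi hq pq] := mpb_inv hp.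
apply: le_trans (cut_dist_le hq bU bV) _.
rewrite /cut_at (cut_normC bV (bounded_meas_pull hp bU)).
apply: le_trans (cut_norm_pull hq (bounded_measB (bounded_meas_pull hp bU) bV)).
rewrite le_eqVlt; apply/orP; left; apply/eqP; apply: eq_cut_norm => p [p1 p2].
by rewrite /pull /= !pq// -surjective_pairing.
Qed.

Lemma cut_dist_sym U V : bounded_meas U -> bounded_meas V -> cut_dist U V = cut_dist V U.
Proof. by move=> bU bV; apply/eqP; rewrite eq_le !cut_dist_sym_le. Qed.

(** The composite [psi \o phi] rearranges [W], with [pull phi V] as the intermediate function; the
    second term is then a pull-back along [phi]. *)
Lemma cut_dist_triangle U V W : bounded_meas U -> bounded_meas V -> bounded_meas W ->
  cut_dist U W <= cut_dist U V + cut_dist V W.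
Proof.
move=> bU bV bW; rewrite -lerBlDr; apply: cut_dist_ge => phi hp.
rewrite lerBlDr -lerBlDl; apply: cut_dist_ge => psi hq; rewrite lerBlDl.
apply: le_trans (cut_dist_le (mpb_comp hp hq) bU bW) _.
have bp := bounded_meas_pull hp bV; have bq := bounded_meas_pull hq bW.
have bpq := bounded_meas_pull hp bq.
apply: le_trans (cut_norm_triangle bU bp bpq) _; rewrite lerD2l.
exact: (cut_norm_pull hp (bounded_measB bV bq)).
Qed.

(** The definition of [phi] speaks of subsets of the line only. Planar null sets are reached by
    applying [pull_Rintegral] to the indicator of [N] on the full square. *)
Lemma pull_negligible phi (N : set plane) : mpb phi -> measurable N -> L2 N = 0%E ->
  L2.-negligible [set p | square R p /\ N (phi p.1, phi p.2)].
Proof.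
move=> hp mN N0; have mP := measurable_pairmap hp.
have mQ : measurable [set p : plane | square R p /\ N (phi p.1, phi p.2)].
  exact: (mP (@measurable_square R) N mN).
exists [set p | square R p /\ N (phi p.1, phi p.2)]; split => //.
have mS : measurable (square R `&` N : set plane).
  by apply: measurableI => //; exact: measurable_square.
have bU := bounded_meas_ind (conj (@subIsetl _ (square R) N) mS).
have := pull_Rintegral hp bU (@measurable_I01 R) (@measurable_I01 R) (@subset_refl _ I) (@subset_refl _ I).
have [[_ _ sj] _ _ _] := hp.
have -> : phi @` I = I.
  by apply/seteqP; split => [_ [x xI <-]|y /sj//]; exact: mpb_I01.
have fin (Z : set plane) : Z `<=` square R -> measurable Z ->
    \int[L2]_(p in square R) \1_Z p = fine (L2 Z).
  by move=> Zs mZ; rewrite /Rintegral integral_indic ?setIidl//; exact: measurable_square.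
rewrite -/(square R) [RHS]fin//.
have -> : L2 (square R `&` N) = 0%E.
  apply/eqP; rewrite eq_le measure_ge0 andbT -N0; apply: lambda2_leS => //; exact: subIsetr.
have -> : \int[L2]_(p in square R) pull phi \1_(square R `&` N) p =
    \int[L2]_(p in square R) \1_[set p | square R p /\ N (phi p.1, phi p.2)] p.
  apply: eq_Rintegral => p; rewrite inE => sp; rewrite /pull !indicE.
  congr (_%:R); congr nat_of_bool; apply/idP/idP; rewrite !inE; first by move=> [].
  by move=> [_ Np]; split => //; case: sp => p1 p2; split; exact: mpb_I01.
rewrite fin//; last by move=> p [].
by move=> /= E; rewrite -[LHS]fineK ?E//; apply: lambda2_fin => // p [].
Qed.

(** None of the functions has to be measurable, so representatives of function classes can be
    replaced by indicators. *)
Lemma negligible_cut_dist U U' V V' :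
  L2.-negligible [set p | square R p /\ U p <> U' p] ->
  L2.-negligible [set p | square R p /\ V p <> V' p] -> cut_dist U V = cut_dist U' V'.
Proof.
move=> nU nV; rewrite !cut_distE; congr inf; apply/seteqP.
suff H phi : mpb phi -> cut_at phi U V = cut_at phi U' V'.
  by split => _ [phi hp <-]; exists phi => //; rewrite H.
move=> hp; rewrite /cut_at /cut_norm; congr sup.
have [N [mN N0 VN]] := nV.
have nP := pull_negligible hp mN N0.
have E A B : A `<=` I -> B `<=` I ->
    \int[L2]_(p in A `*` B) (U p - pull phi V p) = \int[L2]_(p in A `*` B) (U' p - pull phi V' p).
  move=> AI BI; rewrite /Rintegral; congr fine; apply: negligible_eq_integral.
  apply: negligibleS (negligibleU nU nP) => p [[/AI p1 /BI p2] ne].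
  apply: contrapT => nn; apply: ne; congr EFin; congr (_ - _).
    by apply: contrapT => h; apply: nn; left.
  apply: contrapT => h; apply: nn; right; split => //.
  by apply: VN; split => //; split; exact: mpb_I01.
by apply/seteqP; split => _ [A [B [mA mB AI BI ->]]]; exists A, B; split => //; rewrite E.
Qed.

(** * The cut distance between closed sets *)

Definition cut_C (S T : C_T R) : R := cut_dist (\1_(set_val S)) (\1_(set_val T)).

Lemma C_T_bounded_meas S : bounded_meas (\1_(set_val S) : R * R -> R).
Proof. exact: bounded_meas_ind. Qed.
Hint Resolve C_T_bounded_meas : core.

Lemma cut_C_le_measure S T : cut_C S T <= measure_C S T.
Proof.
apply: le_trans (cut_dist_le mpb_id (C_T_bounded_meas S) (C_T_bounded_meas T)) _.
rewrite /measure_C -l1_dist_ind//; apply: cut_norm_le => A B mA mB AI BI.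
have ABs : A `*` B `<=` square R by move=> p [/AI ? /BI ?]; split.
have bST := bounded_measB (C_T_bounded_meas S) (C_T_bounded_meas T).
have mAB : measurable (A `*` B : set plane) by exact: measurableX.
have := le_normr_Rintegral mAB (rect_integrable bST mA mB AI BI).
rewrite (_ : \int[L2]_(p in A `*` B) (\1_(set_val S) p - \1_(set_val T) p) =
  \int[L2]_(p in A `*` B) (\1_(set_val S) p - pull id \1_(set_val T) p)); last first.
  by apply: eq_Rintegral => p _; rewrite /pull /= -surjective_pairing.
move=> h; apply: le_trans h _.
have i1 := rect_integrable bST (@measurable_I01 R) (@measurable_I01 R) (@subset_refl _ I) (@subset_refl _ I).
rewrite /l1_dist /Rintegral; apply: fine_le.
- by apply: integrable_fin_num => //; exact: (integrable_abse (rect_integrable bST mA mB AI BI)).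
- by apply: integrable_fin_num; [exact: measurable_square|exact: (integrable_abse i1)].
- apply: ge0_subset_integral => //; first exact: measurable_square.
  by apply/measurable_EFinP; apply: measurableT_comp => //; case: bST.
Qed.

Lemma cut_C_near S T e : cut_C S T < e -> exists2 phi, mpb phi &
  cut_at phi (\1_(set_val S)) (\1_(set_val T)) < e.
Proof.
move=> lt; have h : 0 < e - cut_C S T by rewrite subr_gt0.
have [_ [phi hp <-] lt2] := inf_adherent h (cut_at_has_inf (C_T_bounded_meas S) (C_T_bounded_meas T)).
by exists phi => //; move: lt2; rewrite -cut_distE -/(cut_C S T) addrC subrK.
Qed.

Lemma power_diff_le (a b : R) k : 0 <= a <= 1 -> 0 <= b <= 1 ->
  `|a ^+ k - b ^+ k| <= k%:R * `|a - b|.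
Proof.
move=> /andP[a0 a1] /andP[b0 b1]; elim: k => [|k IH]; first by rewrite subrr normr0 mul0r.
have -> : a ^+ k.+1 - b ^+ k.+1 = a * (a ^+ k - b ^+ k) + (a - b) * b ^+ k by rewrite !exprS; lra.
have -> : k.+1%:R * `|a - b| = k%:R * `|a - b| + `|a - b| by rewrite -natr1 mulrDl mul1r.
apply: le_trans (ler_normD _ _) _; apply: lerD.
  rewrite normrM ger0_norm//; apply: le_trans IH; exact: ler_piMl.
by rewrite normrM ler_piMr// ger0_norm ?exprn_ge0// exprn_ile1.
Qed.

Lemma mpb_image_I01 phi : mpb phi -> phi @` I = I.
Proof.
move=> hp; have [[_ _ sj] _ _ _] := hp.
by apply/seteqP; split => [_ [x xI <-]|y /sj//]; exact: mpb_I01.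
Qed.

Lemma cut_at_section phi S T x : mpb phi -> I x ->
  \int[L1]_(y in I) (\1_(set_val S) (x, y) - pull phi (\1_(set_val T)) (x, y)) =
  degree (set_val S) x - degree (set_val T) (phi x).
Proof.
move=> hp xI; have pxI := mpb_I01 hp xI.
have [m1 [M1 b1]] := section_meas (C_T_bounded_meas S) xI.
have [m2 [M2 b2]] := section_meas (bounded_meas_pull hp (C_T_bounded_meas T)) xI.
have [m3 [M3 b3]] := section_meas (C_T_bounded_meas T) pxI.
have i1 := bounded_integrable (@measurable_I01 R) (@subset_refl _ I) m1 b1.
have i2 := bounded_integrable (@measurable_I01 R) (@subset_refl _ I) m2 b2.
rewrite (RintegralB (mu := L1) (@measurable_I01 R) i1 i2); congr (_ - _).
have := mpb_Rintegral hp m3 b3 (@measurable_I01 R) (@subset_refl _ I).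
by rewrite mpb_image_I01.
Qed.

(* Cutting along the sets where the difference of the degrees has constant sign. *)
Lemma cut_at_degree phi S T e : mpb phi -> cut_at phi (\1_(set_val S)) (\1_(set_val T)) <= e ->
  \int[L1]_(x in I) `|degree (set_val S) x - degree (set_val T) (phi x)| <= 2 * e.
Proof.
move=> hp ce; pose D x := degree (set_val S) x - degree (set_val T) (phi x).
have [_ mphi _ _] := hp.
have mD : measurable_fun (I : set mR) D.
  apply: measurable_funB; first exact: measurable_degree.
  apply: (@measurable_comp _ _ _ _ _ _ (I : set mR)) => //; last exact: measurable_degree.
  by move=> _ [x xI <-]; exact: mpb_I01.
have D1 x : I x -> `|D x| <= 1.
  move=> xI; have /I01P/andP[h1 h2] := degree_I01 (C_T_upset S) xI.
  have /I01P/andP[h3 h4] := degree_I01 (C_T_upset T) (mpb_I01 hp xI).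
  by rewrite /D ler_norml; lra.
have iD (A : set mR) : measurable A -> A `<=` I -> L1.-integrable A (EFin \o D).
  move=> mA AI; apply: (@bounded_integrable _ _ _ 1) => //.
    by apply: measurable_funS mD => //; exact: measurable_I01.
  by move=> x /AI; exact: D1.
have cut (A : set mR) : measurable A -> A `<=` I -> `|\int[L1]_(x in A) D x| <= e.
  move=> mA AI; apply: le_trans ce.
  have bST := bounded_measB (C_T_bounded_meas S) (bounded_meas_pull hp (C_T_bounded_meas T)).
  apply: le_trans (cut_norm_ub bST mA (@measurable_I01 R) AI (@subset_refl _ I)).
  rewrite rect_Rintegral// le_eqVlt; apply/orP; left; apply/eqP; congr (`|_|).
  by apply: eq_Rintegral => x; rewrite inE => /AI xI; rewrite cut_at_section.
pose P : set mR := I `&` D @^-1` `[0, +oo[; pose N : set mR := I `&` D @^-1` `]-oo, 0[.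
have mP : measurable P by apply: mD => //; exact: measurable_itv.
have mN : measurable N by apply: mD => //; exact: measurable_itv.
have PI : P `<=` I by exact: subIsetl.
have NI : N `<=` I by exact: subIsetl.
have E : I = P `|` N.
  apply/seteqP; split => [x xI|x [[]|[]]//].
  have [h|h] := leP 0 (D x); [left|right]; split => //=; rewrite in_itv /= ?h//.
have ian (A : set mR) : measurable A -> A `<=` I -> L1.-integrable A (EFin \o (fun x => `|D x|)).
  by move=> mA AI; exact: (integrable_abse (iD A mA AI)).
rewrite [X in \int[L1]_(x in X) _]E Rintegral_setU//; last 2 first.
- by rewrite -E; exact: ian.
- apply/disj_setPS => x [[_ /=]]; rewrite in_itv /= andbT => x0 [_ /=].
  by rewrite in_itv /= ltNge x0.
have -> : 2 * e = e + e by lra.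
apply: lerD.
  have -> : \int[L1]_(x in P) `|D x| = \int[L1]_(x in P) D x.
    by apply: eq_Rintegral => x; rewrite inE => -[_ /=]; rewrite in_itv /= andbT => x0; rewrite ger0_norm.
  exact: le_trans (ler_norm _) (cut P mP PI).
have -> : \int[L1]_(x in N) `|D x| = \int[L1]_(x in N) (- 1 * D x).
  by apply: eq_Rintegral => x; rewrite inE => -[_ /=]; rewrite in_itv /= => x0; rewrite ltr0_norm// mulN1r.
rewrite (RintegralZl (mu := L1) (-1) mN (iD N mN NI)).
by rewrite mulN1r; apply: le_trans (ler_norm _) _; rewrite normrN; exact: cut.
Qed.

Lemma power_integral_dist (f g : R -> R) k :
  measurable_fun (I : set mR) f -> measurable_fun (I : set mR) g ->
  (forall x, I x -> 0 <= f x <= 1) -> (forall x, I x -> 0 <= g x <= 1) ->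
  `|\int[L1]_(x in I) f x ^+ k - \int[L1]_(x in I) g x ^+ k| <=
  k%:R * \int[L1]_(x in I) `|f x - g x|.
Proof.
move=> mf mg f01 g01; have mI := @measurable_I01 R.
have pow (h : R -> R) : measurable_fun (I : set mR) h -> (forall x, I x -> 0 <= h x <= 1) ->
    L1.-integrable I (EFin \o (fun x => h x ^+ k)).
  move=> mh h01; apply: (@bounded_integrable _ _ _ 1) => //.
    exact: (measurableT_comp (exprn_measurable k)).
  by move=> x xI; apply: power_bounded; apply/I01P; exact: h01.
have i1 := pow _ mf f01; have i2 := pow _ mg g01.
have iD : L1.-integrable I (EFin \o (fun x => f x - g x)).
  apply: (@bounded_integrable _ _ _ 1) => //; first exact: measurable_funB.
  by move=> x xI; have := f01 x xI; have := g01 x xI; rewrite ler_norml; clear; lra.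
have i12 := integrableB mI i1 i2.
rewrite -(RintegralB (mu := L1) mI i1 i2) -(RintegralZl (mu := L1) k%:R mI (integrable_abse iD)).
apply: le_trans (le_normr_Rintegral mI i12) _.
apply: le_Rintegral => //.
- exact: (integrable_abse i12).
- exact: (integrableZl mI k%:R (integrable_abse iD)).
by move=> x xI; apply: power_diff_le; [exact: f01|exact: g01].
Qed.

(** The infimum need not be attained, so a [phi] with value below 1/n is taken. It preserves the
    moments of the degree function of [T], and [cut_at_degree] then bounds the difference of the
    moments by 2k/n. *)
Lemma cut_C_moment S T k : cut_C S T = 0 ->
  \int[L1]_(x in I) degree (set_val S) x ^+ k = \int[L1]_(x in I) degree (set_val T) x ^+ k.
Proof.
move=> E; apply/eqP; rewrite -subr_eq0 -normr_le0; apply/ler_addgt0Pr => e e0; rewrite add0r.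
have [n n0 /ltW kn] := archi_div_lt (mulr_ge0 (ler0n R k) (ler0n R 2)) e0.
have [|phi hp /ltW lt] := @cut_C_near S T n%:R^-1; first by rewrite E invr_gt0 ltr0n.
have h := cut_at_degree hp lt.
have mS : measurable_fun (I : set mR) (degree (set_val S)) by exact: measurable_degree.
have mT : measurable_fun (I : set mR) (degree (set_val T)) by exact: measurable_degree.
have [_ mphi _ _] := hp.
have mTp : measurable_fun (I : set mR) (fun x => degree (set_val T) (phi x)).
  apply: (@measurable_comp _ _ _ _ _ _ (I : set mR)) => //.
  by move=> _ [x xI <-]; exact: mpb_I01.
have dS x : I x -> 0 <= degree (set_val S) x <= 1 by move=> xI; apply/I01P; exact: degree_I01.
have dT x : I x -> 0 <= degree (set_val T) x <= 1 by move=> xI; apply/I01P; exact: degree_I01.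
have dTp x : I x -> 0 <= degree (set_val T) (phi x) <= 1 by move=> xI; apply: dT; exact: mpb_I01.
have m2 : measurable_fun (I : set mR) (fun x => degree (set_val T) x ^+ k).
  exact: (measurableT_comp (exprn_measurable k)).
have b2 x : I x -> `|degree (set_val T) x ^+ k| <= 1.
  by move=> xI; apply: power_bounded; apply/I01P; exact: dT.
have := mpb_Rintegral hp m2 b2 (@measurable_I01 R) (@subset_refl _ I).
rewrite mpb_image_I01// => <-.
apply: le_trans (power_integral_dist k mS mTp dS dTp) _; apply: le_trans kn.
by rewrite -mulrA; apply: ler_wpM2l.
Qed.

Lemma cut_C_eq S T : cut_C S T = 0 -> S = T.
Proof. by move=> E; apply: degree_moments_inj => k k0; exact: cut_C_moment. Qed.

Lemma cut_C_metric : is_metric (@cut_C).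
Proof.
have mC := @measure_C_metric R.
split.
- by move=> S T; exact: cut_dist_ge0.
- move=> S T; split; first exact: cut_C_eq.
  move=> <-; apply/eqP; rewrite eq_le cut_dist_ge0// andbT.
  by apply: le_trans (cut_C_le_measure S S) _; case: mC => _ /(_ S S)[_ ->].
- by move=> S T; exact: cut_dist_sym.
- by move=> S T U; exact: cut_dist_triangle.
Qed.

Lemma homeomorphism_cut_C :
  homeomorphism (id : C_measure R -> dist_space (@cut_C)).
Proof.
apply: homeomorphism_compact.
- exact: C_measure_compact.
- exact: dist_space_hausdorff cut_C_metric.
- apply: (dist_space_le_continuous (@measure_C_metric R) cut_C_metric) => S e e0.
  by exists e => // T; apply: le_lt_trans; exact: cut_C_le_measure.
- by exists id.
Qed.

Lemma cut_closed_to_fun S T : cut_W (closed_to_fun S) (closed_to_fun T) = cut_C S T.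
Proof.
apply: negligible_cut_dist; exact: repr_class.
Qed.

Lemma cut_W_isometry :
  is_metric (@cut_W R) /\ homeomorphism (@closed_to_fun R : dist_space (@cut_C) -> W_cut R).
Proof.
apply: dist_space_isometry; first exact: closed_to_fun_bij.
  exact: cut_closed_to_fun.
exact: cut_C_metric.
Qed.

End CutDistance.

(** * Homomorphism densities of grid graphs *)

Section GraphDensities.
Context {R : realType}.
Implicit Types (F G H : graph) (S T : C_T R) (n k : nat).
Local Open Scope quotient_scope.

Lemma graph_iso_nvert F G : graph_iso F G -> nvert F = nvert G.
Proof. by move=> /asboolP[f [bf _]]; have := bij_eq_card bf; rewrite !card_ord. Qed.

Lemma graph_isoP F G : reflect (exists f : 'I_(nvert F) -> 'I_(nvert G),
  bijective f /\ forall i j, adj (f i) (f j) = adj i j) (graph_iso F G).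
Proof. exact: asboolP. Qed.

(** An arbitrary relation instead of a graph, so that loops are allowed: the grid relation of a set
    may hold on the diagonal. *)
Definition homs F n (E : rel 'I_n) :=
  #|[pred f : {ffun 'I_(nvert F) -> 'I_n} | [forall i, forall j, adj i j ==> E (f i) (f j)]]|.

Lemma homs_iso_le F F' n n' (E : rel 'I_n) (E' : rel 'I_n') (g : 'I_n -> 'I_n') :
  graph_iso F' F -> injective g -> (forall i j, E i j -> E' (g i) (g j)) ->
  (homs F E <= homs F' E')%N.
Proof.
move=> /graph_isoP[e [[e' eK e'K] eE]] gI gE.
pose h (f : {ffun 'I_(nvert F) -> 'I_n}) := [ffun x => g (f (e x))].
have hI : injective h.
  move=> f1 f2 /ffunP E12; apply/ffunP => x; apply: gI.
  by have := E12 (e' x); rewrite !ffunE e'K.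
rewrite /homs -(fintype.card_image hI); apply/subset_leq_card/fintype.subsetP => _ /fintype.imageP[f + ->].
rewrite !inE => /forallP fE; apply/forallP => i; apply/forallP => j; apply/implyP.
by rewrite -eE !ffunE => /(implyP (forallP (fE _) _)); exact: gE.
Qed.

Lemma hom_densityE F G : hom_density R F G = (homs F (@adj G))%:R / (nvert G)%:R ^+ nvert F.
Proof. by rewrite /hom_density natrX. Qed.

Lemma hom_density_iso F F' G G' : graph_iso F F' -> graph_iso G G' ->
  hom_density R F G = hom_density R F' G'.
Proof.
move=> FF GG; rewrite !hom_densityE; congr (_%:R / (_%:R ^+ _)); try exact: graph_iso_nvert.
apply/eqP; rewrite eqn_leq; apply/andP; split.
  have /graph_isoP[g [bg gE]] := GG.
  by apply: (@homs_iso_le _ _ _ _ _ _ g); rewrite 1?graph_iso_sym ?FF//; [exact: bij_inj|move=> i j; rewrite gE].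
have /graph_isoP[g [bg gE]] : graph_iso G' G by rewrite graph_iso_sym.
by apply: (@homs_iso_le _ _ _ _ _ _ g) => //; [exact: bij_inj|move=> i j; rewrite gE].
Qed.

Lemma repr_ugraph G : graph_iso (repr (\pi_ugraph G)) G.
Proof. by apply/(@eqquotP _ _ ugraph); rewrite reprK. Qed.

Lemma ugraph_eq G H : graph_iso G H -> \pi_ugraph G = \pi_ugraph H.
Proof. by move=> GH; apply/eqquotP. Qed.

Lemma threshold_iso G H : graph_iso G H -> is_threshold R G -> is_threshold R H.
Proof.
move=> GH [w [t wt]]; have /graph_isoP[f [bf fE]] : graph_iso H G by rewrite graph_iso_sym.
exists (w \o f), t => i j ij; rewrite -fE; apply: wt.
by rewrite (inj_eq (bij_inj bf)).
Qed.

Definition grid_point n (i : 'I_n) : R := i%:R / n%:R.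

Lemma cube_mean_sum n k (f : k.-tuple R -> R) :
  cube_mean n f = (\sum_(t : k.-tuple 'I_n) f [tuple of map (@grid_point n) t]) / n%:R ^+ k.
Proof.
elim: k f => [|k IH] f /=.
  rewrite expr0 divr1 (big_pred1 [tuple]) => [|t]; last by apply/esym/eqP; exact: tuple0.
  by congr f; apply: val_inj.
rewrite /grid_mean exprS invfM mulrA [RHS]mulrAC; congr (_ / _).
rewrite (eq_bigr _ (fun i _ => IH _)) -mulr_suml; congr (_ / _).
rewrite pair_big /=.
rewrite (reindex (fun p : 'I_n * k.-tuple 'I_n => [tuple of p.1 :: p.2])) /=; last first.
  exists (fun t : k.+1.-tuple 'I_n => (thead t, [tuple of behead t])) => [[x t] _|t _] /=.
    by congr (_, _); apply: val_inj.
  by rewrite [RHS]tuple_eta.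
by apply: eq_bigr => p _; congr f; apply: val_inj.
Qed.

(** Each edge of [F] occurs once, with i < j, while [E] need not be symmetric; hence both
    orientations appear in the factor. *)
Lemma homs_tuple F n (E : rel 'I_n) : (homs F E)%:R =
  \sum_(t : (nvert F).-tuple 'I_n) \prod_(i < nvert F) \prod_(j < nvert F | (i < j)%N && adj i j)
     (E (tnth t i) (tnth t j) && E (tnth t j) (tnth t i))%:R :> R.
Proof.
rewrite /homs -sum1_card natr_sum.
rewrite (reindex (fun t : (nvert F).-tuple 'I_n => [ffun i => tnth t i])) /=; last first.
  exists (fun f : {ffun 'I_(nvert F) -> 'I_n} => [tuple f i | i < nvert F]) => [t _|f _].
    by apply: eq_from_tnth => i; rewrite tnth_mktuple ffunE.
  by apply/ffunP => i; rewrite ffunE tnth_mktuple.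
rewrite big_mkcond; apply: eq_bigr => t _ /=.
case: ifPn => [|].
  rewrite inE => /forallP h; rewrite big1// => i _; rewrite big1// => j /andP[_ ij].
  have := implyP (forallP (h i) j) ij; have ji : adj j i by rewrite adj_sym.
  by have := implyP (forallP (h j) i) ji; rewrite !ffunE => -> ->.
rewrite inE negb_forall => /existsP[i]; rewrite negb_forall => /existsP[j].
rewrite negb_imply !ffunE => /andP[ij nE]; symmetry.
have : i != j by apply: contraTneq ij => ->; rewrite adj_irr.
rewrite neq_ltn => /orP[lt|lt]; apply/eqP.
  rewrite prodf_seq_eq0; apply/hasP; exists i; rewrite ?mem_index_enum//=.
  rewrite prodf_seq_eq0; apply/hasP; exists j; rewrite ?mem_index_enum//= lt ij/=.
  by rewrite (negbTE nE).
rewrite prodf_seq_eq0; apply/hasP; exists j; rewrite ?mem_index_enum//=.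
rewrite prodf_seq_eq0; apply/hasP; exists i; rewrite ?mem_index_enum//= lt adj_sym ij/=.
by rewrite (negbTE nE) andbF.
Qed.

(** At most k^2 n^(k-1) of the n^k maps are not injective, written without subtraction or division.
    Going from [k] to [k.+1] loses at most k n^k further maps, those whose last value repeats an
    earlier one. *)
Lemma ffact_lower n k : (n ^ k * n <= n * n ^_ k + k ^ 2 * n ^ k)%N.
Proof.
elim: k => [|k IH]; first by rewrite mul0n addn0 ffactn0 expn0 mul1n muln1.
rewrite ffactnSr expnSr.
have h1 : (n ^_ k <= n ^ k)%N.
  by rewrite -[X in (X ^_ _)%N]card_ord -[X in (_ ^_ X)%N]card_ord -card_inj_ffuns;
     apply: leq_trans (max_card _) _; rewrite card_ffun !card_ord.
have [kn|kn] := leqP k n; last first.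
  apply: leq_trans (leq_addl _ _); rewrite mulnC leq_mul2r; apply/orP; right; nia.
have -> : (n ^_ k * (n - k) = n ^_ k * n - n ^_ k * k)%N by rewrite mulnBr.
have := leq_mul2r n (n ^ k * n) (n * n ^_ k + k ^ 2 * n ^ k); rewrite IH orbT => h2.
have h3 : (n ^_ k * k <= n ^_ k * n)%N by rewrite leq_mul2l kn orbT.
set a := (n ^_ k)%N in h1 h2 h3 *; set b := (n ^ k)%N in h1 h2 *.
rewrite mulnBr.
have h4 : (n * (a * k) <= n * (a * n))%N by rewrite leq_mul2l h3 orbT.
have h5 : (n * (a * k) <= n * (b * k))%N by rewrite leq_mul2l leq_mul2r h1 !orbT.
lia.
Qed.

(** An injective map sends edges of [F] to pairs of distinct points, where the relations agree. Only
    non-injective maps can be counted differently. *)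
Lemma homs_loops F n (E E' : rel 'I_n) : (forall i j, i != j -> E i j = E' i j) ->
  (homs F E + n ^_ nvert F <= homs F E' + n ^ nvert F)%N.
Proof.
move=> EE; set k := nvert F; pose inj := [pred f : {ffun 'I_k -> 'I_n} | injectiveb f].
have cn : (n ^_ k + #|[predC inj]| = n ^ k)%N.
  have := cardC inj; rewrite card_ffun !card_ord => <-; congr (_ + _)%N.
  by rewrite -[X in (X ^_ _)%N]card_ord -[X in (_ ^_ X)%N]card_ord -card_inj_ffuns cardsE.
rewrite -cn [X in (_ <= X)%N]addnCA [X in (X <= _)%N]addnC leq_add2l.
rewrite /homs -cardUI; apply: leq_trans (leq_addr _ _).
apply/subset_leq_card/fintype.subsetP => f; rewrite !inE => /forallP fE.
case: (boolP (injectiveb f)) => [/injectiveP fI|_]; last by rewrite orbT.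
rewrite orbF; apply/forallP => i; apply/forallP => j; apply/implyP => ij.
rewrite -EE; first exact: (implyP (forallP (fE i) j)).
by rewrite (inj_eq fI); apply: contraTneq ij => ->; rewrite adj_irr.
Qed.

(* Maps [V(F) -> 'I_n] that are not injective are a proportion at most
   [v(F)^2/n] of all maps. *)
Lemma homs_loops_dist F n (E E' : rel 'I_n) : (0 < n)%N -> (forall i j, i != j -> E i j = E' i j) ->
  `|(homs F E)%:R / n%:R ^+ nvert F - (homs F E')%:R / n%:R ^+ nvert F| <= (nvert F ^ 2)%:R / n%:R :> R.
Proof.
move=> n0 EE; set k := nvert F.
have h1 := homs_loops F EE; have h2 := homs_loops F (fun i j ij => esym (EE i j ij)).
have h3 := ffact_lower n k; rewrite -/k in h1 h2.
have nk0 : 0 < n%:R ^+ k :> R by rewrite exprn_gt0// ltr0n.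
have n0' : 0 < n%:R :> R by rewrite ltr0n.
rewrite -mulrBl normrM (gtr0_norm (_ : 0 < (n%:R ^+ k)^-1)) ?invr_gt0//.
rewrite ler_pdivrMr// mulrAC ler_pdivlMr// -natrX -natrM.
set a := homs F E in h1 h2 *; set b := homs F E' in h1 h2 *.
have H x y : (x + n ^_ k <= y + n ^ k)%N -> (x%:R - y%:R) * n%:R <= (k ^ 2 * n ^ k)%:R :> R.
  move=> h; rewrite mulrBl lerBlDr -!natrM -natrD ler_nat.
  have := leq_mul2r n (x + n ^_ k) (y + n ^ k); rewrite h orbT; lia.
have [ab|/ltW ab] := leP 0 (a%:R - b%:R : R); first by rewrite ger0_norm// H.
by rewrite ler0_norm// opprB H.
Qed.

(** Loops are kept, because the grid average of the density integrand also evaluates [S] at diagonal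
    points; [grid_adj] removes them. *)
Definition grid_rel n S : rel 'I_n := fun i j => `[< set_val S (grid_point i, grid_point j) >].

Lemma grid_rel_sym n S : symmetric (@grid_rel n S).
Proof.
move=> i j; rewrite /grid_rel; have [_ _ dS _ _] := C_T_P S.
by congr (asbool _); rewrite -[in LHS]dS.
Qed.

Definition grid_adj n S : rel 'I_n := fun i j => (i != j) && grid_rel S i j.

Lemma grid_adj_sym n S : symmetric (@grid_adj n S).
Proof. by move=> i j; rewrite /grid_adj eq_sym grid_rel_sym. Qed.

Lemma grid_adj_irr n S : irreflexive (@grid_adj n S).
Proof. by move=> i; rewrite /grid_adj eqxx. Qed.

Definition grid_graph n (n0 : (0 < n)%N) S : graph :=
  Graph n0 (@grid_adj_sym n S) (@grid_adj_irr n S).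

Lemma homs_grid F n S : (homs F (@grid_rel n S))%:R / n%:R ^+ nvert F =
  cube_mean n (fun x : (nvert F).-tuple R =>
    \prod_(i < nvert F) \prod_(j < nvert F | (i < j)%N && adj i j) \1_(set_val S) (tnth x i, tnth x j)).
Proof.
rewrite cube_mean_sum homs_tuple; congr (_ / _).
apply: eq_bigr => t _; apply: eq_bigr => i _; apply: eq_bigr => j _.
rewrite [in X in _ && X]grid_rel_sym andbb indicE !tnth_map /grid_rel.
by congr (_%:R); congr nat_of_bool; apply/asboolP/idP; rewrite inE.
Qed.

(** The square of [nvert F] pays for discarding the loops, the linear term for replacing the
    integral by the grid average. *)
Lemma grid_graph_density F n (n0 : (0 < n)%N) S :
  `|hom_density R F (grid_graph n0 S) - graphon_density F \1_(set_val S)| <=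
  (nvert F ^ 2 + nvert F)%:R / n%:R.
Proof.
rewrite hom_densityE natrD mulrDl.
apply: le_trans (ler_distD ((homs F (@grid_rel n S))%:R / n%:R ^+ nvert F) _ _) _.
apply: lerD.
  by apply: homs_loops_dist => //= i j ij; rewrite /grid_adj ij.
rewrite homs_grid distrC; apply: cube_mean_integral => //.
exact/density_fun_mono/C_T_upset.
Qed.

End GraphDensities.

(** * Threshold graphs as grid graphs *)

Section ThresholdGraphs.
Context {R : realType}.
Implicit Types (F G H : graph) (S T : C_T R) (n k : nat).
Local Open Scope quotient_scope.

(** The ones of a monotone 0-1 sequence form a final segment, so their number tells on which side of
    [j] it begins. *)
Lemma monotone_count n (b : nat -> bool) j : (j < n)%N ->
  {homo b : i k / (i <= k)%N >-> (i ==> k)} ->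
  if b j then (n - j <= \sum_(i < n) b i)%N else (\sum_(i < n) b i <= n - j.+1)%N.
Proof.
move=> jn bm; rewrite -(big_mkord xpredT (fun i => nat_of_bool (b i))); case: ifPn => bj.
  rewrite (big_cat_nat (leq0n j) (ltnW jn)) /=; apply: leq_trans (leq_addl _ _).
  rewrite (eq_big_nat _ _ (F2 := fun _ => 1%N)); first by rewrite sum_nat_const_nat muln1.
  by move=> i /andP[ji _]; have := bm _ _ ji; rewrite bj => /= ->.
rewrite (big_cat_nat (n := j.+1))//= big_nat_cond big1 ?add0n.
  apply: (@leq_trans (\sum_(j.+1 <= i < n) 1)%N); last by rewrite sum_nat_const_nat muln1.
  by apply: leq_sum => i _; case: (b i).
move=> i /andP[/andP[_ ij] _]; have := bm i j ij; rewrite (negbTE bj) implybF.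
by move=> /negbTE ->.
Qed.

Lemma grid_mono n i j : (i <= j)%N -> i%:R / n%:R <= j%:R / n%:R :> R.
Proof. by move=> ij; rewrite ler_wpM2r ?invr_ge0 ?ler0n// ler_nat. Qed.

Lemma grid_point_square n (i j : 'I_n) : square R (grid_point i, grid_point j).
Proof. by split; exact: grid_ord_I01. Qed.

(* The weight of [i] is [i] plus the number [N i] of [j] with [(i/n, j/n)] in [S];
   by monotonicity [(i/n, j/n)] is in [S] iff [N i + j >= n]. *)
Lemma grid_graph_threshold n (n0 : (0 < n)%N) S : is_threshold R (grid_graph n0 S).
Proof.
pose b (i : 'I_n) (j : nat) := `[< set_val S (grid_point i, Num.min 1 (j%:R / n%:R)) >].
have bm i : {homo b i : i k / (i <= k)%N >-> (i ==> k)}.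
  move=> j k jk; apply/implyP => /asboolP h; apply/asboolP.
  have [_ up] := C_T_upset S; apply: up h _ _ _ => //=.
    split => /=; first exact: grid_ord_I01.
    apply/I01P; rewrite le_min ler01 ge_min lexx/= andbT.
    by rewrite divr_ge0 ?ler0n.
  by rewrite le_min !ge_min lexx grid_mono// orbT.
have bE (i j : 'I_n) : b i j = grid_rel S i j.
  by rewrite /b min_r//; have /I01P/andP[] := grid_ord_I01 R j.
pose N i := (\sum_(j < n) b i j)%N.
(* For an edge, N i + j and N j + i are both at least n, so the weights sum to at least 2n; for a
   non-edge both are at most n - 1, with sum at most 2n - 2. *)
exists (fun i : 'I_n => (i + N i)%N%:R), (2 * n - 1)%N%:R => i j ij.
rewrite -natrD ltr_nat /= /grid_adj ij /=.
have := monotone_count (ltn_ord j) (bm i); have := monotone_count (ltn_ord i) (bm j).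
rewrite !bE (grid_rel_sym S j i) -/(N i) -/(N j).
have := ltn_ord i; have := ltn_ord j.
move: (N i) (N j); rewrite /=; move: (grid_rel S i j) (i : nat) (j : nat).
by case=> a c Ni Nj *; split => //; lia.
Qed.

Lemma sort_by n (w : 'I_n -> R) : exists s : 'I_n -> 'I_n,
  bijective s /\ forall i j : 'I_n, (i <= j)%N -> w (s i) <= w (s j).
Proof.
case: n w => [|n] w; first by exists id; split=> [|[]//]; exists id.
pose l := sort (fun i j => w i <= w j) (enum 'I_n.+1).
have sl : size l = n.+1 by rewrite size_sort size_enum_ord.
have ul : uniq l by rewrite sort_uniq enum_uniq.
exists (fun i => nth ord0 l i); split.
  by apply: injF_bij => i j /eqP; rewrite nth_uniq ?sl// => /eqP/val_inj.
move=> i j ij.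
apply: (sorted_leq_nth (leT := fun i j => w i <= w j)); rewrite ?inE ?sl//.
- by move=> x y z; exact: le_trans.
- by apply: sort_sorted => x y; exact: le_total.
Qed.

(** The least increasing set with the edges that contains the grid points of all pairs of weight
    above [t]; a finite union of quadrants, hence closed. *)
Definition staircase n (w : 'I_n -> R) (t : R) : set (R * R) :=
  edges R `|` (square R `&` \bigcup_(p in [set p : 'I_n * 'I_n | t < w p.1 + w p.2])
    ([set q | grid_point p.1 <= q.1] `&` [set q | grid_point p.2 <= q.2])).

Lemma staircase_closed n (w : 'I_n -> R) t : threshold_closed_sets R (staircase w t).
Proof.
have flip q : staircase w t q -> staircase w t (q.2, q.1).
  case=> [[[q1 q2]|[q1 q2]]|[[q1 q2] [[i j] /= h [h1 h2]]]]; [left; right|left; left|right] => //.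
  by split => //; exists (j, i) => //=; rewrite addrC.
split.
- apply: closedU; first exact: closed_edges.
  apply: closedI; first exact: closed_square.
  apply: closed_bigcup => [|p _]; first exact: finite_finset.
  apply: closedI.
    have -> : [set q : R * R | grid_point p.1 <= q.1] = fst @^-1` [set x | grid_point p.1 <= x] by [].
    by apply: closed_comp; [move=> *; exact: cvg_fst|exact: closed_ge].
  have -> : [set q : R * R | grid_point p.2 <= q.2] = snd @^-1` [set x | grid_point p.2 <= x] by [].
  by apply: closed_comp; [move=> *; exact: cvg_snd|exact: closed_ge].
- by move=> q [/edges_square|[]].
- by apply/seteqP; split => q /= /flip; rewrite -?surjective_pairing.
- move=> p q [ep|[sp [ij wij [h1 h2]]]] sq p1 p2; first by left; exact: ((@upset_edges R).2 _ _ ep sq p1 p2).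
  right; split => //; exists ij => //; split => /=; [exact: le_trans h1 p1|exact: le_trans h2 p2].
- by move=> q; left.
Qed.

(** After sorting by weight, a grid point above that of a pair of weight above [t] again belongs to
    such a pair, so the staircase contains no unwanted grid points. Nor do the edges, as all grid
    points have coordinates below 1. *)
Lemma threshold_grid_graph G : is_threshold R G ->
  exists S, graph_iso (grid_graph (nvert_gt0 G) S) G.
Proof.
move=> [w [t wt]]; have [s [bs sm]] := sort_by w.
exists (mk_closed (staircase_closed (w \o s) t)).
apply/graph_isoP; exists s; split => // i j; rewrite /= /grid_adj.
have [<-|ij] := eqVneq i j; first by rewrite adj_irr.
have sij : s i != s j by rewrite (inj_eq (bij_inj bs)).
have n0 : 0 < (nvert G)%:R :> R by rewrite ltr0n nvert_gt0.
have lt1 (k : 'I_(nvert G)) : (grid_point k : R) < 1 by rewrite ltr_pdivrMr// mul1r ltr_nat.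
have le (k l : 'I_(nvert G)) : grid_point k <= grid_point l :> R -> (k <= l)%N.
  by rewrite ler_pM2r ?invr_gt0// ler_nat.
rewrite /grid_rel /=; apply/idP/asboolP.
  move=> /wt -/(_ sij) h; right; split; first exact: grid_point_square.
  by exists (i, j) => //; split => /=.
case=> [|[_ [[k l] /= h [/le ki /le lj]]]].
  by case => [[_ /= E]|[/= E _]]; [have := lt1 j|have := lt1 i]; rewrite E ltxx.
by apply/wt => //; apply: lt_le_trans h _; apply: lerD; exact: sm.
Qed.

End ThresholdGraphs.

(** * Graph limits of threshold graphs *)

Section ThresholdLimits.
Context {R : realType}.
Implicit Types (F G H : graph) (S T : C_T R) (n k : nat) (Gamma : graph_space R).
Local Notation I := (I01 R).
Local Notation L1 := (lambda1 R).
Local Open Scope quotient_scope.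

Lemma close_eq (a b c : R) : 0 <= c ->
  (forall n, (0 < n)%N -> `|a - b| <= c / n%:R) -> a = b.
Proof.
move=> c0 H; apply/eqP; rewrite -subr_eq0 -normr_le0; apply/ler_addgt0Pr => e e0.
by have [n n0 /ltW] := archi_div_lt c0 e0; rewrite add0r; apply: le_trans; exact: H.
Qed.

(** Permuting the variables of an iterated integral is avoided: both densities are approximated by
    the hom densities in the same grid graphs, where the invariance is a matter of counting. *)
Lemma graphon_density_iso F F' S : graph_iso F F' ->
  graphon_density F (\1_(set_val S) : R * R -> R) = graphon_density F' \1_(set_val S).
Proof.
move=> FF; have v := graph_iso_nvert FF; set c : R := (nvert F ^ 2 + nvert F)%:R.
apply: (@close_eq _ _ (2 * c)); first by rewrite mulr_ge0// ler0n.
move=> n n0; have -> : 2 * c / n%:R = c / n%:R + c / n%:R by lra.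
apply: le_trans (ler_distD (hom_density R F (grid_graph n0 S)) _ _) _; apply: lerD.
  by rewrite distrC; exact: grid_graph_density.
by rewrite (hom_density_iso FF (graph_iso_refl _)) /c v; exact: grid_graph_density.
Qed.

(** The factor [c] serves the induction: it collects the values at the coordinates already fixed. *)
Lemma cube_integral_prod k (g : R -> R) (c : R) : L1.-integrable I (EFin \o g) ->
  cube_integral (fun t : k.-tuple R => c * \prod_(i < k) g (tnth t i)) =
  c * (\int[L1]_(x in I) g x) ^+ k.
Proof.
move=> ig; elim: k c => [|k IH] c /=; first by rewrite big_ord0 expr0.
under eq_Rintegral do under eq_fun do rewrite big_ord_recl mulrA.
transitivity (\int[L1]_(x in I) (c * (\int[L1]_(y in I) g y) ^+ k * g x)).
  apply: eq_Rintegral => x _; rewrite mulrAC -IH; apply: cube_integral_eq => t _.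
  rewrite tnth0; congr (_ * _); apply: eq_bigr => i _; by rewrite tnthS.
by rewrite (RintegralZl (mu := L1) _ (@measurable_I01 R) ig) exprSr mulrA.
Qed.

(** The first variable is the centre. Once it is fixed the leaves are independent, and each
    contributes the degree of the centre. *)
Lemma star_density k S : graphon_density (star k) (\1_(set_val S) : R * R -> R) =
  \int[L1]_(x in I) degree (set_val S) x ^+ k.
Proof.
rewrite /graphon_density /=; apply: eq_Rintegral => x; rewrite inE => xI.
rewrite -[RHS]mul1r -cube_integral_prod; last first.
  exact: mono01_integrable (section_mono01 (C_T_upset S) xI).
apply: cube_integral_eq => t _; rewrite mul1r big_ord_recl [X in _ * X]big1 ?mulr1.
  rewrite big_mkcond big_ord_recl /= mul1r; apply: eq_bigr => j _.
  by rewrite /star_adj /= tnth0 tnthS.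
move=> i _; rewrite big_pred0// => j; apply/andP => -[ij].
rewrite /star_adj /=; suff -> : (j == ord0) = false by [].
by apply/eqP => j0; move: ij; rewrite j0 ltn0.
Qed.

Definition limit_of S : graph_space R := graphon_limit \1_(set_val S).

Lemma limit_densityE F S : limit_density F (limit_of S) = graphon_density F \1_(set_val S).
Proof. exact/graphon_density_iso/repr_ugraph. Qed.

Lemma limit_star k S : limit_density (star k) (limit_of S) = moment (degree_law S) k.
Proof. by rewrite limit_densityE star_density moment_degree_law. Qed.

Lemma limit_of_inj : injective limit_of.
Proof.
move=> S T E; apply: degree_law_inj; apply: moments_inj => k _.
by rewrite -!limit_star E.
Qed.

Lemma graph_space_cvg (X : Type) (G : set_system X) (u : X -> graph_space R) Gamma :
  Filter G -> (forall F : ugraph, (fun x => (u x).1 F) @ G --> Gamma.1 F) ->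
  (fun x => (u x).2) @ G --> Gamma.2 -> u @ G --> Gamma.
Proof.
move=> FG h1 h2; case: Gamma h1 h2 => Gamma c /= h1 h2.
have -> : u = (fun x => ((u x).1, (u x).2)) by apply/funext => x; rewrite -surjective_pairing.
have c1 : (fun x => (u x).1 : {ptws ugraph -> R}) @ G --> Gamma.
  apply/cvg_sup => j W /= [_ [[B oB <-] /= Bx] BW].
  by apply: filterS BW _; apply: (h1 j); exact: open_nbhs_nbhs.
exact: (cvg_pair c1 h2).
Qed.

Lemma eval_continuous (F : ugraph) : continuous (fun Gamma : graph_space R => Gamma.1 F).
Proof.
move=> Gamma; apply: (@continuous_comp _ _ _ fst (fun f : {ptws ugraph -> R} => f F)).
  exact: cvg_fst.
exact: proj_continuous.
Qed.

Lemma snd_continuous : continuous (fun Gamma : graph_space R => Gamma.2).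
Proof. by move=> Gamma; exact: cvg_snd. Qed.

Lemma graph_space_separated (x y : graph_space R) : x <> y ->
  exists2 f : graph_space R -> R, continuous f & f x <> f y.
Proof.
move=> xy.
have [E|ne] := pselect (x.2 = y.2); last by exists (fun Gamma : graph_space R => Gamma.2) => //; exact: snd_continuous.
have [F ne] : exists F : ugraph, x.1 F <> y.1 F.
  apply: contrapT => h; apply: xy; rewrite [x]surjective_pairing [y]surjective_pairing E.
  congr (_, _); apply/funext => F; apply: contrapT => ne; apply: h; by exists F.
exists (fun Gamma : graph_space R => Gamma.1 F) => //; exact: eval_continuous.
Qed.

Lemma graph_space_hausdorff : hausdorff_space (graph_space R).
Proof. exact: separated_hausdorff graph_space_separated. Qed.

Lemma limit_of_continuous : continuous (limit_of : C_measure R -> graph_space R).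
Proof.
move=> S; apply: (@graph_space_cvg (C_measure R) (nbhs (S : C_measure R))) => [F|]; last exact: cvg_cst.
move=> U /nbhs_ballP[e e0 eU]; apply/(dist_space_nbhs _ _ (@measure_C_metric R)).
set G := repr F.
have [n n0 ne] := @archi_div_lt R (3 * (nvert G)%:R) e (mulr_ge0 (ler0n _ _) (ler0n _ _)) e0.
exists (n%:R^-2); first by rewrite invr_gt0 exprn_gt0// ltr0n.
move=> T ST; apply: eU; rewrite /ball /=.
have [h1 h2] := measure_dist_step_le n0 (C_T_upset S) (C_T_upset T) (C_T_meas S) (C_T_meas T) ST.
have h3 := step_le_density G n0 (C_T_upset S) (C_T_upset T) h1.
have h4 := step_le_density G n0 (C_T_upset T) (C_T_upset S) h2.
apply: le_lt_trans ne; rewrite ler_norml; apply/andP; split.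
  by rewrite lerBrDr addrC lerBlDr.
by rewrite lerBlDr addrC.
Qed.

Lemma grid_sequence_cvg (G : nat -> graph) (S : nat -> C_T R) F :
  (forall n, graph_iso (grid_graph (nvert_gt0 (G n)) (S n)) (G n)) ->
  (fun n => (nvert (G n))%:R^-1 : R) @ \oo --> (0 : R) ->
  (fun n => hom_density R F (G n) - graphon_density F \1_(set_val (S n))) @ \oo --> (0 : R).
Proof.
move=> GS v0; pose c : R := (nvert F ^ 2 + nvert F)%:R.
have cv : (fun n => c * (nvert (G n))%:R^-1) @ \oo --> (0 : R).
  by rewrite -[X in _ --> X](mulr0 c); apply: cvgM => //; exact: cvg_cst.
have d n : `|hom_density R F (G n) - graphon_density F \1_(set_val (S n))| <= c * (nvert (G n))%:R^-1.
  by rewrite -(hom_density_iso (graph_iso_refl F) (GS n)); exact: grid_graph_density.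
apply: (squeeze_cvgr (f := fun n => - (c * (nvert (G n))%:R^-1)) (h := fun n => c * (nvert (G n))%:R^-1)) => //.
  by apply: nearW => n; rewrite -ler_norml.
by rewrite -[X in _ --> X]oppr0; exact: cvgN.
Qed.

Lemma embeddingE1 G (F : ugraph) : (graph_embedding R (\pi_ugraph G)).1 F = hom_density R (repr F) G.
Proof. exact: hom_density_iso (graph_iso_refl _) (repr_ugraph G). Qed.

Lemma embeddingE2 G : (graph_embedding R (\pi_ugraph G)).2 = (nvert G)%:R^-1.
Proof. by rewrite /= (graph_iso_nvert (repr_ugraph G)). Qed.

Lemma invn_cvg0 : (fun n => n.+1%:R^-1 : R) @ \oo --> (0 : R).
Proof. exact: cvg_harmonic. Qed.

Lemma limit_of_threshold S : threshold_limits R (limit_of S).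
Proof.
pose G n := grid_graph (ltn0Sn n) S.
have cv : (fun n => graph_embedding R (\pi_ugraph (G n))) @ \oo --> limit_of S.
  apply: graph_space_cvg => [F|].
    have h := @grid_sequence_cvg G (fun=> S) (repr F) (fun n => graph_iso_refl _) invn_cvg0.
    have -> : (fun n => (graph_embedding R (\pi_ugraph (G n))).1 F) =
        (fun n => (hom_density R (repr F) (G n) - graphon_density (repr F) \1_(set_val S)) +
          graphon_density (repr F) \1_(set_val S)).
      by apply/funext => n; rewrite subrK embeddingE1.
    rewrite -[X in _ --> X]add0r; apply: cvgD => //; exact: cvg_cst.
  have -> : (fun n => (graph_embedding R (\pi_ugraph (G n))).2) = (fun n => n.+1%:R^-1).
    by apply/funext => n; rewrite embeddingE2.
  exact: invn_cvg0.
split; last first.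
  exists (fun n => \pi_ugraph (G n)); split => // n.
  apply: threshold_iso (grid_graph_threshold (ltn0Sn n) S).
  by rewrite graph_iso_sym; exact: repr_ugraph.
split.
  move=> U /cv /= [n _ /(_ n (leqnn n)) Un].
  by exists (graph_embedding R (\pi_ugraph (G n))); split => //; exists (\pi_ugraph (G n)).
(* The second coordinate of the limit is 0, whereas that of a graph is the inverse of a positive
   integer. *)
case=> H _ /(congr1 snd) /= /eqP; rewrite invr_eq0 pnatr_eq0 => /eqP h.
by have := nvert_gt0 (repr H); rewrite h.
Qed.

Lemma finite_small_graphs N : finite_set [set G : ugraph | (nvert (repr G) <= N)%N].
Proof.
pose ok n (e : {ffun 'I_n * 'I_n -> bool}) := [/\ (0 < n)%N, forall i j, e (i, j) = e (j, i) & forall i, e (i, i) = false].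
(* Matrices that are not adjacency matrices get the one-vertex graph [star 0] as a default value. *)
pose mk n (e : {ffun 'I_n * 'I_n -> bool}) : ugraph := \pi_ugraph (
  match pselect (ok n e) with
  | left h => let: And3 n0 es ei := h in Graph (adj := fun i j => e (i, j)) n0 es ei
  | right _ => star 0 end).
apply: (@sub_finite_set _ _ (\bigcup_(n in `I_N.+1) range (@mk n))); last first.
  apply: bigcup_finite => // n _; apply: finite_image; exact: finite_finset.
move=> G /= GN; exists (nvert (repr G)) => //=.
exists [ffun p => adj p.1 p.2] => //.
rewrite -[RHS]reprK /mk; apply: ugraph_eq; case: pselect => [[n0 es ei]|[]]; last first.
  by split; [exact: nvert_gt0|move=> i j; rewrite !ffunE adj_sym|move=> i; rewrite ffunE adj_irr].
apply/graph_isoP; exists id; split; first by exists id.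
by move=> i j /=; rewrite ffunE.
Qed.

(** If the limit of 1/v(G_n) were not 0, the orders would eventually be bounded by [N]. The
    embeddings would then stay in a finite, hence closed, set, and the limit would be the image of a
    graph, which [graph_limits] excludes. *)
Lemma graph_limit_snd (G : nat -> ugraph) Gamma : graph_limits R Gamma ->
  (fun n => graph_embedding R (G n)) @ \oo --> Gamma -> Gamma.2 = 0.
Proof.
move=> [_ nr] cv; apply: contrapT => /eqP c0; apply: nr.
have c2 : 0 < `|Gamma.2| / 2 by rewrite divr_gt0// normr_gt0.
have cv2 : (fun n => (graph_embedding R (G n)).2) @ \oo --> Gamma.2.
  exact: (@cvg_comp _ _ _ _ (fun Gamma : graph_space R => Gamma.2) _ _ _ cv (@snd_continuous Gamma)).
pose N := Num.truncn (2 / `|Gamma.2|).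
pose A := graph_embedding R @` [set H | (nvert (repr H) <= N)%N].
have fA : finite_set A by apply: finite_image; exact: finite_small_graphs.
have cA : closed A.
  by apply: compact_closed; [exact: graph_space_hausdorff|exact: finite_compact].
suff [H _ <-] : A Gamma by exists H.
apply: (closed_cvg _ cA _ _ cv).
move/cvgr_dist_lt : cv2 => /(_ _ c2); apply: filterS => n /= lt.
exists (G n) => //=; set v := nvert _ in lt *.
have v0 : 0 < v%:R :> R by rewrite ltr0n nvert_gt0.
rewrite truncn_ge_nat; last by rewrite divr_ge0.
rewrite ler_pdivlMr ?normr_gt0// mulrC -ler_pdivlMr//.
have := ler_normB (Gamma.2 - v%:R^-1) (- v%:R^-1).
rewrite opprK subrK normrN (gtr0_norm (_ : 0 < v%:R^-1)) ?invr_gt0// => h.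
by move: lt h; set a := v%:R^-1; set b := `|Gamma.2|; lra.
Qed.

(* By compactness of [C_T] the set of all [limit_of S] is closed. *)
Lemma limit_of_surj Gamma : threshold_limits R Gamma -> exists S, limit_of S = Gamma.
Proof.
move=> [gl [G [tG cv]]]; have c0 := graph_limit_snd gl cv.
have [S GS] := choice (fun n => threshold_grid_graph (tG n)).
have cv2 : (fun n => (nvert (repr (G n)))%:R^-1 : R) @ \oo --> (0 : R).
  by rewrite -c0; exact: (@cvg_comp _ _ _ _ (fun Gamma : graph_space R => Gamma.2) _ _ _ cv (@snd_continuous Gamma)).
have cvS : (fun n => limit_of (S n)) @ \oo --> Gamma.
  apply: graph_space_cvg => [F|]; last by rewrite c0; exact: cvg_cst.
  have h := @grid_sequence_cvg (fun n => repr (G n)) S (repr F) GS cv2.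
  have h1 : (fun n => hom_density R (repr F) (repr (G n))) @ \oo --> Gamma.1 F.
    exact: (@cvg_comp _ _ _ _ (fun Gamma : graph_space R => Gamma.1 F) _ _ _ cv (@eval_continuous F Gamma)).
  have -> : (fun n => (limit_of (S n)).1 F) = (fun n => hom_density R (repr F) (repr (G n)) -
      (hom_density R (repr F) (repr (G n)) - graphon_density (repr F) \1_(set_val (S n)))).
    by apply/funext => n; rewrite opprB addrC subrK.
  by rewrite -[X in _ --> X]subr0; exact: cvgB.
suff [S' _ E] : (limit_of @` setT) Gamma by exists S'.
apply: (closed_cvg _ _ _ _ cvS); last by apply: nearW => n; exists (S n).
apply: compact_closed; first exact: graph_space_hausdorff.
apply: (@continuous_compact (C_measure R)); last exact: C_measure_compact.
by apply: continuous_subspaceT; exact: limit_of_continuous.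
Qed.

Definition closed_to_limit S : T_oo R := SigSub (mem_set (limit_of_threshold S)).

Lemma closed_to_limit_bij : bijective closed_to_limit.
Proof.
apply: inj_surj_bij => [S T /(congr1 set_val)|Gamma]; first exact: limit_of_inj.
have [S E] := limit_of_surj (set_valP Gamma).
by exists S; apply: val_inj.
Qed.

Lemma T_oo_hausdorff : hausdorff_space (T_oo R).
Proof.
apply: separated_hausdorff => x y xy.
have [|f cf ne] := @graph_space_separated (set_val x) (set_val y); first by move=> /val_inj.
by exists (f \o set_val) => // z; apply: continuous_comp; [exact: initial_continuous|exact: cf].
Qed.

Lemma homeomorphism_closed_to_limit :
  homeomorphism (closed_to_limit : C_measure R -> T_oo R).
Proof.
apply: homeomorphism_compact.
- exact: C_measure_compact.
- exact: T_oo_hausdorff.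
- apply: continuous_initial; exact: limit_of_continuous.
- exact: closed_to_limit_bij.
Qed.

Lemma is_degree_distribution_limit S : is_degree_distribution (limit_of S) (degree_law S).
Proof.
split => [k _|mu h]; first by rewrite limit_star.
by apply: moments_inj => k k1; rewrite -limit_star -h.
Qed.

End ThresholdLimits.

Theorem theorem5p3 (R : realType) :
  exists (iTP : T_oo R -> P_s R) (iPC : P_s R -> C_T R)
         (iCO : C_T R -> O_T R) (iCW : C_T R -> W_T R)
         (iOW : O_T R -> W_T R) (iWT : W_T R -> T_oo R),
  (* the mappings *)
  [/\ forall Gamma, is_degree_distribution (set_val Gamma) (set_val (iTP Gamma)),
      forall mu, set_val (iPC mu) = S_ (set_val mu),
      forall S, set_val (iCO S) = (set_val S)°,
      forall S, set_val (iCW S) = class_of \1_(set_val S) &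
      forall S, set_val (iOW S) = class_of \1_(set_val S)] /\
  (forall w W, threshold_function W -> set_val w = class_of W ->
     set_val (iWT w) = graphon_limit W) /\
  (* they are bijections *)
  [/\ bijective iTP, bijective iPC, bijective iCO & bijective iCW] /\
  bijective iOW /\ bijective iWT /\
  (* the diagram commutes *)
  (forall S, iCW S = iOW (iCO S)) /\
  [/\ forall Gamma, iWT (iOW (iCO (iPC (iTP Gamma)))) = Gamma,
      forall mu, iTP (iWT (iOW (iCO (iPC mu)))) = mu,
      forall S, iPC (iTP (iWT (iOW (iCO S)))) = S,
      forall S, iCO (iPC (iTP (iWT (iOW S)))) = S &
      forall w, iOW (iCO (iPC (iTP (iWT w)))) = w] /\
  (* objects corresponding to a probability measure mu *)
  (forall mu : P_s R,
    [/\ set_val (iCO (iPC mu)) = (S_ (set_val mu))°,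
        set_val (iCW (iPC mu)) = class_of (W_ (set_val mu)) &
        set_val (iWT (iCW (iPC mu))) = Gamma_ (set_val mu)]) /\
  (* Gamma |-> nu(Gamma) and mu |-> Gamma_mu are mutually inverse *)
  (forall Gamma : T_oo R, Gamma_ (set_val (iTP Gamma)) = set_val Gamma) /\
  (forall (mu : P_s R) (Gamma : T_oo R),
     set_val Gamma = Gamma_ (set_val mu) -> iTP Gamma = mu) /\
  (* they are homeomorphisms *)
  [/\ homeomorphism (iTP : T_oo R -> P_s R),
      homeomorphism (iPC : P_s R -> C_hausdorff R),
      homeomorphism (iPC : P_s R -> C_fell R) &
      homeomorphism (iPC : P_s R -> C_measure R)] /\
  [/\ homeomorphism (iCO : C_hausdorff R -> O_measure R),
      homeomorphism (iCO : C_fell R -> O_measure R) &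
      homeomorphism (iCO : C_measure R -> O_measure R)] /\
  [/\ homeomorphism (iCW : C_hausdorff R -> W_l1 R),
      homeomorphism (iCW : C_fell R -> W_l1 R) &
      homeomorphism (iCW : C_measure R -> W_l1 R)] /\
  [/\ homeomorphism (iCW : C_hausdorff R -> W_cut R),
      homeomorphism (iCW : C_fell R -> W_cut R) &
      homeomorphism (iCW : C_measure R -> W_cut R)] /\
  [/\ homeomorphism (iOW : O_measure R -> W_l1 R),
      homeomorphism (iOW : O_measure R -> W_cut R),
      homeomorphism (iWT : W_l1 R -> T_oo R) &
      homeomorphism (iWT : W_cut R -> T_oo R)] /\
  (* the spaces are compact metric spaces *)
  [/\ compact_metrizable R (T_oo R), compact_metrizable R (P_s R) &
      compact_metrizable R (C_fell R)] /\
  [/\ compact_metric (@hausdorff_C R), compact_metric (@measure_C R),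
      compact_metric (@measure_O R), compact_metric (@l1_W R) &
      compact_metric (@cut_W R)].
Proof.
have [tc tcK ctK] := @closed_to_limit_bij R.
have [fc fcK cfK] := @closed_to_fun_bij R.
have [oc ocK coK] := @closed_to_open_bij R.
have pK := @closed_to_probK R; have Kp := @prob_to_closedK R.
have mC := @measure_C_metric R; have cC := @C_measure_compact R.
have hH := @homeomorphism_hausdorff R; have hF := @homeomorphism_fell R.
have hP := @homeomorphism_closed_to_prob R; have hT := @homeomorphism_closed_to_limit R.
have [mO hO] := dist_space_isometry (@closed_to_open_bij R) (@measure_closed_to_open R) mC.
have [mL hL] := dist_space_isometry (@closed_to_fun_bij R) (@l1_closed_to_fun R) mC.
have [mK hK'] := @cut_W_isometry R.
have hK := homeomorphism_comp (@homeomorphism_cut_C R) hK'.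
have compactT (X : topologicalType) (f : C_measure R -> X) (hf : homeomorphism f) :=
  homeomorphism_compactT hf cC.
have metrizable (X : topologicalType) (f : C_measure R -> X) (hf : homeomorphism f) :=
  dist_space_homeomorphism hf mC cC.
(* [iTP] and [iWT] are defined by way of the closed sets, so that the laws of the diagram reduce to
   cancelling inverses; that they are the degree distribution and the graphon limit is checked
   separately. *)
pose iTP (Gamma : T_oo R) : P_s R := closed_to_prob (tc Gamma).
pose iWT (w : W_T R) : T_oo R := closed_to_limit (fc w).
pose iPC := @prob_to_closed R; pose iCO := @closed_to_open R.
pose iCW := @closed_to_fun R; pose iOW := @open_to_fun R.
have CW w : iCW (fc w) = w by exact: cfK.
have OC S : iOW (iCO S) = iCW S by rewrite /iOW /iCO -closed_open_fun.
have limitE Gamma : limit_of (tc Gamma) = set_val Gamma by rewrite -[in RHS](ctK Gamma).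
have WT S : iWT (iCW S) = closed_to_limit S by rewrite /iWT fcK.
have TP S : iTP (closed_to_limit S) = closed_to_prob S by rewrite /iTP tcK.
have GammaE (mu : P_s R) : Gamma_ (set_val mu) = limit_of (iPC mu) by [].
exists iTP, iPC, iCO, iCW, iOW, iWT; split; first split => //.
  by move=> Gamma; rewrite -limitE; exact: is_degree_distribution_limit.
split.
  move=> w W tW wW; rewrite (graphon_limit_fun (S := fc w) tW)//.
  by rewrite -wW -[in LHS](cfK w).
split.
  split; [|by exists (@closed_to_prob R)|exact: closed_to_open_bij|exact: closed_to_fun_bij].
  exists (@closed_to_limit R \o iPC) => [Gamma|mu]; first by rewrite /= /iPC /iTP pK ctK.
  by rewrite /= TP Kp.
split; first by exists (iCO \o fc) => [U|w] /=; [rewrite -[U]coK OC fcK|rewrite OC CW].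
split; first by exists (iCW \o tc) => [w | Gamma] /=; [rewrite /iWT tcK CW|rewrite WT ctK].
split; first by move=> S; rewrite OC.
split.
  split.
  - by move=> Gamma; rewrite OC WT /iPC /iTP pK ctK.
  - by move=> mu; rewrite OC WT TP Kp.
  - by move=> S; rewrite OC WT TP /iPC pK.
  - by move=> U; rewrite -[in LHS](coK U) OC WT TP /iPC pK; exact: coK.
  - by move=> w; rewrite OC /iPC /iTP pK tcK CW.
split; first by move=> mu; split => //; rewrite WT.
split; first by move=> Gamma; rewrite GammaE /iPC /iTP pK limitE.
split.
  move=> mu Gamma E; have -> : Gamma = closed_to_limit (iPC mu) by apply: val_inj; exact: E.
  by rewrite TP Kp.
split.
  split.
  (* Both homeomorphisms start at [C_measure], and [TP] says that [iTP] carries the first to the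
     second; the other maps are treated in the same way. *)
  - exact: homeomorphism_factor hT hP TP.
  - exact: homeomorphism_factor hP hH pK.
  - exact: homeomorphism_factor hP hF pK.
  - exact: homeomorphism_inv hP pK.
split.
  split.
  - exact: homeomorphism_factor hH hO (fun=> erefl).
  - exact: homeomorphism_factor hF hO (fun=> erefl).
  - exact: hO.
split.
  split.
  - exact: homeomorphism_factor hH hL (fun=> erefl).
  - exact: homeomorphism_factor hF hL (fun=> erefl).
  - exact: hL.
split.
  split.
  - exact: homeomorphism_factor hH hK (fun=> erefl).
  - exact: homeomorphism_factor hF hK (fun=> erefl).
  - exact: hK.
split.
  split.
  - exact: homeomorphism_factor hO hL OC.
  - exact: homeomorphism_factor hO hK OC.
  - exact: homeomorphism_factor hL hT WT.
  - exact: homeomorphism_factor hK hT WT.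
split.
  split.
  - exact: metrizable hT.
  - exact: metrizable hP.
  - exact: metrizable hF.
split.
- split; [exact: hausdorff_C_metric | exact: compactT hH].
- by split.
- split; [exact: mO | exact: compactT hO].
- split; [exact: mL | exact: compactT hL].
- split; [exact: mK | exact: compactT hK].
Qed.
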